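(* Fix a time period $T\ge1$ and dimensions $n_x,n_y$. For each $n\ge1$ consider the linear RNN with $n$ hidden units and parameters $(W,F,C)$, $W\in\mathbb{R}^{n\times n}$, $F\in\mathbb{R}^{n\times n_x}$, $C\in\mathbb{R}^{n_y\times n}$, which maps an input sequence $\mathbf{x}=(x_0,\ldots,x_{T-1})$, $x_t\in\mathbb{R}^{n_x}$, to the output sequence $\mathbf{y}=(y_0,\ldots,y_{T-1})$ via $$h_t=\tfrac{1}{\sqrt n}Wh_{t-1}+Fx_t,\qquad y_t=\tfrac{1}{\sqrt n}Ch_t,\qquad t=0,\ldots,T-1,\qquad h_{-1}=0.$$ Assume the parameters are initialized with mutually independent entries $W_{ij}\sim\mathcal{N}(0,\nu_W)$, $F_{ij}\sim\mathcal{N}(0,\nu_F)$, $C_{ki}\sim\mathcal{N}(0,\nu_C)$ for constants $\nu_W,\nu_F,\nu_C>0$. Then, as $n\to\infty$: (a) The impulse response coefficients $L_j=n^{-(j+1)/2}CW^jF\in\mathbb{R}^{n_y\times n_x}$, $j=0,\ldots,T-1$, converge in distribution to independent Gaussian matrices, where the components of the limit of $L_j$ are i.i.d. $\mathcal{N}(0,\nu_C\nu_F\nu_W^j)$. (b) For any input sequences $\mathbf{x},\mathbf{x}'$, the NTK of the RNN (with respect to the parameters $(W,F,C)$ at the random initialization) converges almost surely to the deterministic limit $$K(\mathbf{x},\mathbf{x}')=\mathcal{T}(\mathbf{x})^{\top}D(\rho)\,\mathcal{T}(\mathbf{x}')\otimes I_{n_y},$$ where $$\rho_j=\nu_C\big(j\nu_F\nu_W^{j-1}+\nu_W^j\big)+\nu_F\nu_W^j,\qquad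 j=0,\ldots,T-1,$$ $\mathcal{T}(\mathbf{x})\in\mathbb{R}^{Tn_x\times T}$ is the block upper-triangular Toeplitz matrix whose $(j,t)$ block ($j,t=0,\ldots,T-1$) equals $x_{t-j}$ if $j\le t$ and $0$ otherwise (i.e. first block row $(x_0,x_1,\ldots,x_{T-1})$, second $(0,x_0,\ldots,x_{T-2})$, etc.), and $D(\rho)=\mathrm{diag}(\rho_0I_{n_x},\ldots,\rho_{T-1}I_{n_x})$.
   Context: For a model $\hat y=f(x,\theta)$ with output in $\mathbb{R}^{m_y}$ and initial parameter $\theta^0$, the neural tangent kernel (NTK) is the $m_y\times m_y$ matrix $[K(x,x')]_{ij}=\langle \partial f_i(x,\theta^0)/\partial\theta,\ \partial f_j(x',\theta^0)/\partial\theta\rangle$, the inner product being the sum over all parameter entries (here the entries of $W,F,C$). The output sequence is regarded as the stacked vector $(y_0,\ldots,y_{T-1})\in\mathbb{R}^{Tn_y}$, so that for a $T\times T$ matrix $A$ the $(t,s)$ block of $A\otimes I_{n_y}$ is $A_{ts}I_{n_y}$. For $j=0$ the term $j\nu_F\nu_W^{j-1}$ is interpreted as $0$. *)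

(* Defs.v *)
From HB Require Import structures.
From mathcomp Require Import all_boot all_order all_algebra.
From mathcomp Require Import all_classical all_reals all_analysis.
Set Implicit Arguments.
Unset Strict Implicit.
Unset Printing Implicit Defensive.
Import Order.TTheory GRing.Theory Num.Theory.
Import numFieldNormedType.Exports.
Local Open Scope classical_set_scope.
Local Open Scope ring_scope.

Section defs.
Variable R : realType.

(* input sequence (x_0,...,x_{T-1}) extended by 0 for indices >= T
   (only indices < T are ever used) *)
Definition ext_seq (T m : nat) (x : 'I_T -> 'cV[R]_m) (t : nat) : 'cV[R]_m :=
  match insub t with Some i => x i | None => 0 end.

(* hidden_state ... t = h_{t-1}; hidden_state ... 0 = h_{-1} = 0,
   h_t = n^{-1/2} W h_{t-1} + F x_t *)
Fixpoint hidden_state (n nx T : nat) (W : 'M[R]_n) (F : 'M[R]_(n, nx))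
    (x : 'I_T -> 'cV[R]_nx) (t : nat) : 'cV[R]_n :=
  match t with
  | 0 => 0
  | t'.+1 => (Num.sqrt (n%:R))^-1 *: (W *m hidden_state W F x t')
             + F *m ext_seq x t'
  end.

Definition rnn_output (n nx ny T : nat) (W : 'M[R]_n) (F : 'M[R]_(n, nx))
    (C : 'M[R]_(ny, n)) (x : 'I_T -> 'cV[R]_nx) (t : 'I_T) : 'cV[R]_ny :=
  (Num.sqrt (n%:R))^-1 *: (C *m hidden_state W F x t.+1).

Definition param_index (n nx ny : nat) : finType :=
  (('I_n * 'I_n) + ('I_n * 'I_nx) + ('I_ny * 'I_n))%type.

Definition W_of (n nx ny : nat) (th : param_index n nx ny -> R) : 'M[R]_n :=
  \matrix_(i, j) th (inl (inl (i, j))).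
Definition F_of (n nx ny : nat) (th : param_index n nx ny -> R) : 'M[R]_(n, nx) :=
  \matrix_(i, j) th (inl (inr (i, j))).
Definition C_of (n nx ny : nat) (th : param_index n nx ny -> R) : 'M[R]_(ny, n) :=
  \matrix_(i, j) th (inr (i, j)).

Definition params_of (n nx ny : nat) (W : 'M[R]_n) (F : 'M[R]_(n, nx))
    (C : 'M[R]_(ny, n)) : param_index n nx ny -> R :=
  fun p => match p with
           | inl (inl (i, j)) => W i j
           | inl (inr (i, j)) => F i j
           | inr (i, j) => C i j
           end.

Definition model (n nx ny T : nat) (x : 'I_T -> 'cV[R]_nx)
    (th : param_index n nx ny -> R) (o : 'I_T * 'I_ny) : R :=
  rnn_output (W_of th) (F_of th) (C_of th) x o.1 o.2 ord0.

Definition upd (I : finType) (th : I -> R) (p : I) (v : R) : I -> R :=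
  fun q => if q == p then v else th q.

Definition dmodel (n nx ny T : nat) (x : 'I_T -> 'cV[R]_nx)
    (th : param_index n nx ny -> R) (o : 'I_T * 'I_ny) (p : param_index n nx ny) : R :=
  derive1 (fun v : R => model x (upd th p v) o) (th p).

Definition ntk (n nx ny T : nat) (th : param_index n nx ny -> R)
    (x x' : 'I_T -> 'cV[R]_nx) (o o' : 'I_T * 'I_ny) : R :=
  \sum_(p : param_index n nx ny) dmodel x th o p * dmodel x' th o' p.

Definition rho (nuW nuF nuC : R) (j : nat) : R :=
  nuC * (j%:R * nuF * nuW ^+ j.-1 + nuW ^+ j) + nuF * nuW ^+ j.

Definition toeplitz (T nx : nat) (x : 'I_T -> 'cV[R]_nx)
    (ja : 'I_T * 'I_nx) (t : 'I_T) : R :=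
  if (ja.1 <= t)%N then ext_seq x (t - ja.1) ja.2 ord0 else 0.

Definition Drho (T nx : nat) (nuW nuF nuC : R) (ja ja' : 'I_T * 'I_nx) : R :=
  if ja == ja' then rho nuW nuF nuC ja.1 else 0.

(* K(x,x') = T(x)^T D(rho) T(x') (x) I_ny, entry ((t,k),(s,l)) *)
Definition ntk_limit (T nx ny : nat) (nuW nuF nuC : R)
    (x x' : 'I_T -> 'cV[R]_nx) (o o' : 'I_T * 'I_ny) : R :=
  (\sum_(ja : 'I_T * 'I_nx) \sum_(ja' : 'I_T * 'I_nx)
     toeplitz x ja o.1 * Drho nuW nuF nuC ja ja' * toeplitz x' ja' o'.1)
  * (o.2 == o'.2)%:R.

Definition impulse (n nx ny : nat) (W : 'M[R]_n) (F : 'M[R]_(n, nx))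
    (C : 'M[R]_(ny, n)) (j : nat) : 'M[R]_(ny, nx) :=
  ((Num.sqrt (n%:R))^-1 ^+ j.+1) *: (C *m (W ^+ j) *m F).

End defs.

Section prob.
Context {R : realType} {d : measure_display} {Omega : measurableType d}.
Local Open Scope ereal_scope.

Definition mutually_independent (P : probability Omega R) (I : finType)
    (X : I -> Omega -> R) : Prop :=
  forall B : I -> set R, (forall i, measurable (B i)) ->
    P (\bigcap_(i in [set: I]) (X i @^-1` B i)) = \prod_(i : I) P (X i @^-1` B i).

Definition is_gaussian (P : probability Omega R) (v : R) (X : Omega -> R) : Prop :=
  measurable_fun setT X /\
  forall B : set R, measurable B -> P (X @^-1` B) = normal_prob 0 (Num.sqrt v) B.

End prob.

Definition cvg_in_distribution {R : realType} {d d' : measure_display}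
    {Omega : measurableType d} {Omega' : measurableType d'} (K : finType)
    (P : probability Omega R) (Y : nat -> Omega -> (K -> R))
    (Q : probability Omega' R) (Z : Omega' -> (K -> R)) : Prop :=
  forall f : {ptws K -> R} -> R, continuous f -> (exists M : R, forall z, `|f z| <= M) ->
    ((fun n => \int[P]_w (f (Y n w))%:E) @ \oo --> \int[Q]_w (f (Z w))%:E)%E.

Definition param_var {R : realType} (n nx ny : nat) (nuW nuF nuC : R)
    (p : param_index n nx ny) : R :=
  match p with
  | inl (inl _) => nuW
  | inl (inr _) => nuF
  | inr _ => nuC
  end.

(* Main.v *)
Require Import Defs.
From HB Require Import structures.
From mathcomp Require Import all_boot all_order all_algebra.
From mathcomp Require Import all_classical all_reals all_analysis.
From mathcomp Require Import measurable_realfun ring lra zify.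
Import Order.TTheory GRing.Theory Num.Theory.
Import numFieldNormedType.Exports.
Local Open Scope classical_set_scope.
Local Open Scope ring_scope.
Set Implicit Arguments.
Unset Strict Implicit.
Unset Printing Implicit Defensive.

(* Let an atom be n^-1 tr u or n^-1 v^T u v', for a word u in n^{-1/2} W and its transpose and
   columns v, v' of F or of C^T. Gaussian integration by parts in the first letter of an atom
   expresses the expectation of its product with other centred atoms through strictly smaller
   products, with one factor n^-1 for each derivative hitting another atom. By induction a
   product of m centred atoms has expectation O(n^-ceil(m/2)), so fourth central moments are
   O(n^-2) and every atom converges almost surely by Borel-Cantelli. The NTK is a fixed
   polynomial in the atoms, which gives (b). For (a), integration by parts in C reduces the
   mixed moments of the impulse responses to expectations of products of atoms, which converge
   to the Gaussian moments. Convergence in distribution follows by the method of moments: a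
   bounded continuous function is approximated on a box by a trigonometric polynomial
   (a Bernstein polynomial in sines), and the expectation of a trigonometric polynomial is
   controlled by Taylor expansion at zero, because the limit moments are Gaussian. *)

(** The hypotheses fix the law of the parameters for each [n] separately and leave the coupling
    between different [n] free, so almost sure convergence is drawn from bounds that are summable in
    [n]; second central moments, of order 1/n, are too weak for that. The induction cannot stay
    among centred products, because integration by parts creates atoms that are not centred. Factors
    therefore carry a flag, and a new atom is recentred at the price of its limit. The limits are
    defined by the leading part of the same recursion, so that this part cancels exactly. Half a
    power of n per centred factor is the worst case: a derivative that hits a centred factor
    consumes it together with the factor integrated by parts, and pays a single 1/n for the two. *)

(** * Integrals against weighted image measures *)

Section density.
Local Open Scope ereal_scope.
Context d (T : measurableType d) (R : realType).
Variables (mu : {measure set T -> \bar R}) (nu : {measure set (measurableTypeR R) -> \bar R}).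
Variables (G Y : T -> R).
Hypothesis mG : measurable_fun setT G.
Hypothesis G0 : forall x, (0 <= G x)%R.
Hypothesis mY : measurable_fun setT Y.
Hypothesis GY : forall B : set R, measurable B ->
  \int[mu]_x (G x * \1_B (Y x))%:E = nu B.

Import HBNNSimple.

(** By monotone convergence simple functions suffice. The weight [G] and the map [Y] are kept
    general so that one statement serves the law of a variable ([G] constant), a density ([Y] the
    identity), a linear change of variable, and the separation of one independent variable from the
    others ([G] their product). *)
Lemma ge0_integral_density (h : R -> R) : measurable_fun setT h ->
  (forall y, 0 <= h y)%R ->
  \int[mu]_x (G x * h (Y x))%:E = \int[nu]_y (h y)%:E.
Proof.
move=> mh h0.
have mhE : measurable_fun setT (fun y : measurableTypeR R => (h y)%:E) by exact/measurable_EFinP.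
pose g := nnsfun_approx measurableT mhE.
have mg n : @measurable_fun _ _ R R setT (g n).
  exact: (@measurable_funPT _ _ (measurableTypeR R) R (g n)).
have g0 n y : (0 <= g n y)%R by [].
have gh y : (EFin \o (g ^~ y)) @ \oo --> (h y)%:E.
  by apply: (cvg_nnsfun_approx measurableT mhE) => // z _; rewrite lee_fin.
have nd y a b : (a <= b)%N -> (g a y <= g b y)%R.
  by move=> ab; exact/lefP/nd_nnsfun_approx.
transitivity (limn (fun n => \int[mu]_x (G x * g n (Y x))%:E)).
  rewrite -monotone_convergence//=.
  - apply: eq_integral => x _; apply/esym/cvg_lim => //.
    rewrite EFinM; under eq_fun do rewrite EFinM.
    apply: cvgeZl => //; exact: gh.
  - move=> n; apply/measurable_EFinP; apply: measurable_funM => //.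
    exact: (measurableT_comp (mg n) mY).
  - by move=> n x _; rewrite lee_fin mulr_ge0.
  - by move=> x _ a b ab; rewrite lee_fin ler_wpM2l// nd.
transitivity (limn (fun n => \int[nu]_y (g n y)%:E)); last first.
  rewrite -monotone_convergence//=.
  - apply: eq_integral => x _; apply/cvg_lim => //; exact: gh.
  - by move=> n; apply/measurable_EFinP.
  - by move=> n x _; rewrite lee_fin.
  - by move=> x _ a b ab; rewrite lee_fin nd.
congr (limn _); apply/funext => n.
rewrite integralT_nnsfun sintegralE.
have mB r : @measurable _ R (g n @^-1` [set r]).
  by rewrite -[X in measurable X]setTI; exact: mg.
have mI r : measurable_fun setT (fun x => \1_(g n @^-1` [set r]) (Y x) : R).
  exact: (measurableT_comp (@measurable_indic _ R _ _ _ (mB r)) mY).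
have step x : (G x * g n (Y x))%:E =
    \sum_(r \in range (g n)) (r * (G x * \1_(g n @^-1` [set r]) (Y x)))%:E.
  rewrite fsumEFin//; congr (_%:E).
  rewrite fimfunE !fsbig_finite//= mulr_sumr; apply: eq_bigr => r _.
  by rewrite mulrCA.
under eq_integral => x _ do rewrite step.
rewrite ge0_integral_fsum//=.
- apply: eq_fsbigr => r /[!inE] -[y _ gyr].
  under eq_integral do rewrite EFinM.
  rewrite ge0_integralZl_EFin//; first by rewrite (GY (mB r)).
  + by move=> x _; rewrite lee_fin mulr_ge0.
  + by apply/measurable_EFinP; apply: measurable_funM.
  + by rewrite -gyr.
- move=> r; apply/measurable_EFinP; apply: measurable_funM => //.
  exact: measurable_funM.
- move=> r x _; rewrite lee_fin.
  rewrite mulrCA mulr_ge0//.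
  exact: nnfun_muleindic_ge0.
Qed.

Lemma integral_density (h : R -> R) : measurable_fun setT h ->
  \int[mu]_x (G x * h (Y x))%:E = \int[nu]_y (h y)%:E.
Proof.
move=> mh; rewrite integralE [RHS]integralE.
have mp : measurable_fun setT (fun y : R => Num.max (h y) 0%R).
  exact: measurable_maxr.
have mn : measurable_fun setT (fun y : R => Num.max (- h y)%R 0%R).
  by apply: measurable_maxr => //; exact: measurableT_comp.
congr (_ - _).
- transitivity (\int[mu]_x (G x * Num.max (h (Y x)) 0%R)%:E).
    apply: eq_integral => x _; rewrite funeposE -EFin_max.
    by rewrite -{1}(mulr0 (G x)) maxr_pMr.
  rewrite (@ge0_integral_density (fun y : R => Num.max (h y) 0%R))//; last first.
    by move=> y; rewrite le_max lexx orbT.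
  by apply: eq_integral => y _; rewrite funeposE -EFin_max.
- transitivity (\int[mu]_x (G x * Num.max (- h (Y x))%R 0%R)%:E).
    apply: eq_integral => x _; rewrite funenegE -EFinN -EFin_max.
    by rewrite -{1}(mulr0 (G x)) maxr_pMr// mulrN.
  rewrite (@ge0_integral_density (fun y : R => Num.max (- h y)%R 0%R))//; last first.
    by move=> y; rewrite le_max lexx orbT.
  by apply: eq_integral => y _; rewrite funenegE -EFinN -EFin_max.
Qed.

Lemma integrable_density (h : R -> R) : measurable_fun setT h ->
  mu.-integrable setT (fun x => (G x * h (Y x))%:E) <->
  nu.-integrable setT (fun y => (h y)%:E).
Proof.
move=> mh.
have e : \int[mu]_x `|(G x * h (Y x))%:E| = \int[nu]_y `|(h y)%:E|.
  rewrite -(@ge0_integral_density (fun y => `|h y|%R))//.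
    by apply: eq_integral => x _; rewrite abse_EFin normrM ger0_norm.
  exact: measurableT_comp.
have mGh : measurable_fun setT (fun x => (G x * h (Y x))%:E).
  apply/measurable_EFinP; apply: measurable_funM => //.
  exact: measurableT_comp.
have mhE : measurable_fun setT (fun x : R => (h x)%:E).
  exact/measurable_EFinP.
by split=> /integrableP[_]; [rewrite e|rewrite -e] => fin; apply/integrableP; split.
Qed.

End density.

(** * Law, moments and scaling of one centred Gaussian variable *)

Section gaussian_law.
Local Open Scope ereal_scope.
Context d (T : measurableType d) (R : realType) (P : probability T R).
Variables (v : R) (X : T -> R).
Hypotheses (v0 : (0 < v)%R) (gX : is_gaussian P v X).
Let mu := @lebesgue_measure R.
Let pdf := normal_pdf 0%R (Num.sqrt v).

Let mX : measurable_fun setT X. Proof. by case: gX. Qed.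

Let lawX (B : set R) : measurable B ->
  \int[P]_x (1 * \1_B (X x))%:E = normal_prob 0%R (Num.sqrt v) B.
Proof.
move=> mB; rewrite -(gX.2 _ mB).
under eq_integral do rewrite mul1r.
have mXB : measurable (X @^-1` B).
  by rewrite -[X in measurable X]setTI; exact: mX.
by have := integral_indic P measurableT mXB; rewrite setIT => <-.
Qed.

Let pdfP (B : set R) : measurable B ->
  \int[mu]_x (pdf x * \1_B x)%:E = normal_prob 0%R (Num.sqrt v) B.
Proof.
move=> mB; rewrite /normal_prob [RHS]integral_mkcond.
apply: eq_integral => x _; rewrite /patch indicE.
by case: ifP => _; rewrite ?mulr1 ?mulr0.
Qed.

Lemma integral_gaussian (h : R -> R) : measurable_fun setT h ->
  \int[P]_x (h (X x))%:E = \int[mu]_x (pdf x * h x)%:E.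
Proof.
move=> mh.
transitivity (\int[normal_prob 0%R (Num.sqrt v)]_y (h y)%:E).
  rewrite -(@integral_density _ _ _ P _ (cst 1%R) X)//.
  by under [RHS]eq_integral do rewrite mul1r.
rewrite -(@integral_density _ _ _ mu _ pdf idfun)//.
- exact: measurable_normal_pdf.
- by move=> x; exact: normal_pdf_ge0.
- exact: measurable_id.
Qed.

Lemma integrable_gaussian (h : R -> R) : measurable_fun setT h ->
  mu.-integrable setT (fun x => (pdf x * h x)%:E) ->
  P.-integrable setT (fun x => (h (X x))%:E).
Proof.
move=> mh.
move=> ih.
have : (normal_prob 0%R (Num.sqrt v)).-integrable setT (fun y => (h y)%:E).
  apply/(@integrable_density _ _ _ mu _ pdf idfun) => //.
  - exact: measurable_normal_pdf.
  - by move=> x; exact: normal_pdf_ge0.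
  - exact: measurable_id.
move/(@integrable_density _ _ _ P _ (cst 1%R) X) => H.
under eq_fun do rewrite -(mul1r (h _)); exact: H.
Qed.

End gaussian_law.

Section gaussian_moments.
Context (R : realType).
Let mu := @lebesgue_measure R.

(** The fundamental theorem of calculus on [[-n, n]] leaves [F n - F (- n)], at most [2 C / n] by
    the decay hypothesis; dominated convergence passes to the whole line. *)
Lemma integral_derive_eq0 (F f : R -> R) (C : R) :
  (forall x, is_derive x (1:R) F (f x)) -> continuous f ->
  mu.-integrable setT (fun x => (f x)%:E) ->
  (forall x, `|x * F x| <= C) ->
  (\int[mu]_x (f x)%:E = 0)%E.
Proof.
move=> dF cf intf bF.
have dFd x : derivable F x 1 by apply: ex_derive.
have cF : continuous F.
  by move=> x; apply: differentiable_continuous; exact/derivable1_diffP.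
pose f_ n x := (f \_ `[- n%:R, n%:R]) x.
have mf : measurable_fun setT (fun x : R => (f x)%:E).
  exact: measurable_int intf.
have cvgI : ((\int[mu]_x (f_ n x)%:E) @[n --> \oo] --> \int[mu]_x (f x)%:E)%E.
  have := @dominated_convergence _ _ R mu setT measurableT
    (fun n x => (f_ n x)%:E) (fun x => (f x)%:E) (fun x => `|f x|%:E).
  case=> //.
  - move=> n; apply/measurable_EFinP; apply/(measurable_restrictT f) => //.
    by apply: measurable_funTS; exact/measurable_EFinP.
  - apply: aeW => x _; apply: cvg_near_cst.
    near=> n; rewrite /f_ patchE mem_set//=.
    rewrite in_itv/= -ler_norml; near: n; exact: nbhs_infty_ger.
  - by move: (integrable_abse intf).
  - apply: aeW => x n _; rewrite /f_ patchE; case: ifP => //.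
    by rewrite abse0 lee_fin.
have FTC n : (0 < n)%N ->
    (\int[mu]_x (f_ n x)%:E = (F n%:R - F (- n%:R))%:E)%E.
  move=> n0; have n0' : - n%:R < n%:R :> R.
    by rewrite -subr_gt0 opprK -mulr2n mulrn_wgt0// ltr0n.
  rewrite EFinB -(@continuous_FTC2 R f F _ _ n0').
  - rewrite [RHS]integral_mkcond; apply: eq_integral => x _.
    by rewrite /f_ /patch; case: ifP.
  - exact: continuous_subspaceT.
  - split=> //.
    + by apply: cvg_at_right_filter; exact: cF.
    + by apply: cvg_at_left_filter; exact: cF.
  - by move=> x _; rewrite derive1E; apply: derive_val.
have cvg0 : ((\int[mu]_x (f_ n x)%:E) @[n --> \oo] --> (0:R)%:E)%E.
  apply: (@cvg_trans _ ((F n%:R - F (- n%:R))%:E @[n --> \oo])).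
    apply: near_eq_cvg; near=> n; rewrite FTC//.
    by near: n; exact: nbhs_infty_gt.
  apply: cvg_EFin; first exact: nearW.
  apply/cvgrPdist_le => e e0.
  near=> n; rewrite sub0r normrN.
  have n0 : (0 < n)%N by near: n; exact: nbhs_infty_gt.
  have n0r : 0 < n%:R :> R by rewrite ltr0n.
  have h1 : `|F n%:R| <= C / n%:R.
    by rewrite ler_pdivlMr// mulrC -{1}(gtr0_norm n0r) -normrM.
  have h2 : `|F (- n%:R)| <= C / n%:R.
    by rewrite ler_pdivlMr// mulrC -{1}(gtr0_norm n0r) -normrM -normrN -mulNr.
  have h3 : 2 * C / e <= n%:R by near: n; exact: nbhs_infty_ger.
  apply: (le_trans (ler_normB _ _)); apply: (le_trans (lerD h1 h2)).
  have -> : C / n%:R + C / n%:R = 2 * C / n%:R by ring.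
  by rewrite ler_pdivrMr// -ler_pdivrMl// mulrC.
by have := cvg_unique _ cvgI cvg0 => ->.
Unshelve. all: by end_near. Qed.

Variables (v : R) (v0 : 0 < v).
Let pdf := normal_pdf 0 (Num.sqrt v).

Let s0 : Num.sqrt v != 0. Proof. by rewrite gt_eqF// sqrtr_gt0. Qed.

Let c := normal_peak (Num.sqrt v).

Let c0 : 0 <= c. Proof. exact: normal_peak_ge0. Qed.

Let pdfE x : pdf x = c * expR (- (x ^+ 2 / (v *+ 2))).
Proof.
by rewrite /pdf normal_pdfE// -[LHS]/(c * normal_fun 0 (Num.sqrt v) x) /normal_fun subr0 (sqr_sqrtr (ltW v0)) mulNr.
Qed.

Lemma expR_ge_pow (y : R) k : 0 <= y -> y ^+ k <= k`!%:R * expR y.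
Proof.
move=> y0; case: k => [|k].
  by rewrite fact0 mul1r expr0 -expR0 ler_expR.
rewrite mulrC -ler_pdivrMr ?ltr0n ?fact_gt0//.
by apply: le_trans (expR_ge1Dxn k y0); rewrite lerDr.
Qed.

(** Half of the exponent absorbs the power: with [y = x^2 / (4 v)] the density of variance [v]
    decays like [exp (- 2 y)], that of variance [2 v] like [exp (- y)], and a power of [x] is at
    most a constant times [exp y]. This yields both the integrability of all moments and the decay
    of boundary terms. *)
Lemma pow_normal_pdf_bound k : exists2 C, 0 <= C &
  forall x, `|x ^+ k| * pdf x <= C * normal_pdf 0 (Num.sqrt (v *+ 2)) x.
Proof.
have v20 : 0 < v *+ 2 by rewrite mulrn_wgt0.
pose c' := normal_peak (Num.sqrt (v *+ 2)).
have c'0 : 0 < c' by rewrite normal_peak_gt0// gt_eqF// sqrtr_gt0.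
(* From [|x^k| <= 1 + x^(2k)] and [x^(2k) = (4 v)^k y^k <= (4 v)^k k! exp y]. *)
pose D := 1 + (v *+ 4) ^+ k * k`!%:R.
have D0 : 0 <= D by rewrite addr_ge0// mulr_ge0// exprn_ge0// mulrn_wge0// ltW.
exists (c * D / c') => [|x].
  by rewrite divr_ge0 ?mulr_ge0// ltW.
rewrite normal_pdfE; last by rewrite gt_eqF// sqrtr_gt0.
rewrite -[X in _ <= _ * X]/(c' * normal_fun 0 (Num.sqrt (v *+ 2)) x) /normal_fun subr0 (sqr_sqrtr (ltW v20)).
rewrite mulrA divfK ?gt_eqF// pdfE.
have -> : v *+ 2 *+ 2 = v *+ 4 by rewrite -mulrnA.
pose y := x ^+ 2 / (v *+ 4).
have v40 : 0 < v *+ 4 by rewrite mulrn_wgt0.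
have y0 : 0 <= y by rewrite divr_ge0 ?sqr_ge0// ltW.
have -> : x ^+ 2 / (v *+ 2) = y + y.
  rewrite /y; field.
  by rewrite gt_eqF.
rewrite mulNr -/y opprD expRD mulrCA -mulrA ler_wpM2l// mulrA.
rewrite ler_wpM2r ?expR_ge0//.
have key : `|x ^+ k| <= D * expR y; last first.
  by rewrite -ler_pdivlMr ?expR_gt0// -expRN opprK.
have : `|x ^+ k| <= 1 + (x ^+ 2) ^+ k.
  rewrite normrX; have [x1|x1] := leP `|x| 1.
    apply: (@le_trans _ _ 1); first by rewrite exprn_ile1.
    by rewrite lerDl exprn_ge0 ?sqr_ge0.
  apply: (@le_trans _ _ ((x ^+ 2) ^+ k)); last by rewrite lerDr.
  rewrite -[in leRHS](real_normK (num_real x)) -exprM mulnC exprM [leRHS]expr2.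
  by rewrite ler_peMr ?exprn_ge0// exprn_ege1// ltW.
move/le_trans; apply; rewrite mulrDl mul1r lerD//.
  by rewrite -expR0 ler_expR.
have -> : x ^+ 2 = v *+ 4 * y by rewrite /y mulrC divfK// gt_eqF.
rewrite exprMn -mulrA ler_wpM2l ?exprn_ge0 ?(ltW v40)//.
exact: expR_ge_pow.
Qed.

Let mpdfX k : measurable_fun setT (fun x : R => pdf x * x ^+ k).
Proof.
apply: measurable_funM; first exact: measurable_normal_pdf.
exact: measurable_funX.
Qed.

Lemma integrable_pow_normal_pdf k :
  mu.-integrable setT (fun x => (pdf x * x ^+ k)%:E).
Proof.
have [C C0 bC] := pow_normal_pdf_bound k.
apply: (@le_integrable _ (measurableTypeR R) R mu _ measurableT _
   (fun x : measurableTypeR R => C%:E * (normal_pdf 0 (Num.sqrt (v *+ 2)) x)%:E)%E).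
- apply/measurable_EFinP; exact: mpdfX.
- move=> x _; rewrite -EFinM !abse_EFin lee_fin.
  have -> : `|pdf x * x ^+ k| = `|x ^+ k| * pdf x.
    by rewrite normrM mulrC (ger0_norm (normal_pdf_ge0 0 _ x)).
  exact: le_trans (bC x) (ler_norm _).
- by apply: integrableZl => //; exact: integrable_normal_pdf.
Qed.

(** The derivative of [pdf x * x ^+ k] is [k x^(k-1) pdf x - x^(k+1) pdf x / v] and has integral
    zero. For [k = 0] the truncated predecessor is harmless, as its factor is [0]. *)
Lemma integral_pow_normal_pdf k :
  \int[mu]_x (pdf x * x ^+ k.+1) = v * (k%:R * \int[mu]_x (pdf x * x ^+ k.-1)).
Proof.
pose F (x : R) := pdf x * x ^+ k.
pose f (x : R) := k%:R * (pdf x * x ^+ k.-1) - v^-1 * (pdf x * x ^+ k.+1).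
have dpdf (x : R) : is_derive x (1:R) pdf (- (x / v) * pdf x).
  rewrite (_ : pdf = (fun x => c * expR (- (x ^+ 2 / (v *+ 2))))); last first.
    by apply/funext => y; rewrite pdfE.
  apply: is_derive_eq.
  rewrite /GRing.scale/=; field.
  by rewrite gt_eqF.
have dF (x : R) : is_derive x (1:R) F (f x).
  have dX : is_derive x (1:R) (fun y : R => y ^+ k) (k%:R * x ^+ k.-1).
    have := @is_deriveX _ _ id k x 1 1 (is_derive_id x 1).
    by rewrite exprfctE /GRing.scale/= mulr1.
  have dM := @is_deriveM _ _ pdf (fun y : R => y ^+ k) x 1 _ _ (dpdf x) dX.
  apply: (is_derive_eq dM).
  rewrite /f /GRing.scale/=.
  have -> : x ^+ k.+1 = x * x ^+ k by rewrite exprS.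
  by field; rewrite gt_eqF.
have cpdf : continuous pdf by exact: continuous_normal_pdf.
have cf : continuous f.
  move=> x; apply: cvgB; apply: cvgM; try exact: cvg_cst.
    by apply: cvgM; [exact: cpdf|exact: exprn_continuous].
  by apply: cvgM; [exact: cpdf|exact: exprn_continuous].
have i1 := integrable_pow_normal_pdf k.-1.
have i2 := integrable_pow_normal_pdf k.+1.
have i1' : mu.-integrable setT (fun x => (k%:R * (pdf x * x ^+ k.-1))%:E).
  by under eq_fun do rewrite EFinM; exact: integrableZl.
have i2' : mu.-integrable setT (fun x => (v^-1 * (pdf x * x ^+ k.+1))%:E).
  by under eq_fun do rewrite EFinM; exact: integrableZl.
have intf : mu.-integrable setT (fun x => (f x)%:E).
  by rewrite /f; under eq_fun do rewrite EFinB; exact: integrableB.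
have [C C0 bC] := pow_normal_pdf_bound k.+1.
have bF x : `|x * F x| <= C * normal_peak (Num.sqrt (v *+ 2)).
  have -> : x * F x = x ^+ k.+1 * pdf x by rewrite /F exprS; ring.
  rewrite normrM (ger0_norm (normal_pdf_ge0 0 _ x)).
  apply: (le_trans (bC x)); rewrite ler_wpM2l// normal_pdf_ub//.
  by rewrite gt_eqF// sqrtr_gt0 mulrn_wgt0.
have := integral_derive_eq0 dF cf intf bF.
move=> /(congr1 fine); rewrite -/(Rintegral _ _ _) /f RintegralB//.
rewrite !RintegralZl//= => /eqP; rewrite subr_eq0 => /eqP ->.
by rewrite mulrA mulfV ?mul1r// gt_eqF.
Qed.

Variables (d : measure_display) (T : measurableType d) (P : probability T R).
Variables (X : T -> R).
Hypothesis gX : is_gaussian P v X.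

Lemma integrable_gaussian_pow k : P.-integrable setT (fun w => (X w ^+ k)%:E).
Proof.
apply: (integrable_gaussian gX (h := fun x => x ^+ k)).
  exact: measurable_funX.
exact: integrable_pow_normal_pdf.
Qed.

Lemma gaussian_moment k :
  \int[P]_w (X w ^+ k.+1) = v * (k%:R * \int[P]_w (X w ^+ k.-1)).
Proof.
have e j : \int[P]_w (X w ^+ j) = \int[mu]_x (pdf x * x ^+ j).
  rewrite /Rintegral (integral_gaussian gX (h := fun x => x ^+ j))//.
by rewrite !e integral_pow_normal_pdf.
Qed.

End gaussian_moments.

(** The density lemmas take their right-hand side as a bundled measure; this packages the scaled
    image of [m] under [f] as one. *)
Lemma measure_scaled_pushforward d1 d2 (T1 : measurableType d1)
  (T2 : measurableType d2) (R : realType) (m : {measure set T1 -> \bar R})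
  (f : T1 -> T2) (mf : measurable_fun setT f) (a : {nonneg R}) :
  exists nu : {measure set T2 -> \bar R}, forall A, measurable A ->
    nu A = (\int[m]_x (a%:num * \1_A (f x))%:E)%E.
Proof.
exists (mscale a (measure_function_pushforward__canonical__measure_function_Measure m mf)).
move=> A mA; rewrite /mscale/= /pushforward.
under eq_integral do rewrite EFinM.
have mfA : measurable (f @^-1` A).
  by rewrite -[X in measurable X]setTI; exact: mf.
rewrite ge0_integralZl_EFin//=.
- congr (_ * _)%E.
  have := integral_indic m measurableT mfA; rewrite setIT. by move/esym.
- apply/measurable_EFinP.
  by apply: (measurableT_comp _ mf); exact: measurable_indic.
Qed.

Section gaussian_scale.
Context (R : realType).
Let mu := @lebesgue_measure R.

(** Lebesgue measure is determined by half-open intervals, where the claim reads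
    [a (y / a - x / a) = y - x]. *)
Lemma lebesgue_measure_scale (a : R) (B : set R) : 0 < a -> measurable B ->
  (\int[mu]_x (a * \1_B (a * x))%:E = mu B)%E.
Proof.
move=> a0 mB.
pose f (x : measurableTypeR R) : measurableTypeR R := a * x.
have mf : measurable_fun setT f by exact: measurable_funM.
have [nu nuE] := measure_scaled_pushforward mu mf (NngNum (ltW a0)).
rewrite -nuE//; apply/esym/lebesgue_measure_unique => //= _ [[x y]] _ <-.
rewrite nuE//=.
under eq_integral do rewrite EFinM.
rewrite ge0_integralZl_EFin//=; last 2 first.
- apply/measurable_EFinP.
  exact (measurableT_comp (measurable_indic (measurable_itv _)) mf).
- exact: ltW.
transitivity (a%:E * \int[mu]_z (\1_(f @^-1` `]x, y]) z)%:E)%E; last by [].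
have -> : f @^-1` `]x, y] = `]x / a, y / a]%classic.
  apply/seteqP; split => z /=; rewrite !in_itv/= /f ltr_pdivrMr// ler_pdivlMr//;
  by rewrite mulrC.
rewrite integral_indic// setIT.
transitivity (a%:E * mu `](x / a)%R, (y / a)%R])%E; last by [].
rewrite /mu !(@lebesgue_measure_itv R (Interval _ _))/= !lte_fin.
rewrite ltr_pM2r ?invr_gt0//.
case: ifPn => _; last by rewrite mule0.
by rewrite -!EFinD -EFinM -mulrBl mulrC divfK// gt_eqF.
Qed.

Variables (d : measure_display) (T : measurableType d) (P : probability T R).

(** The substitution [x -> a x] with constant weight [a] turns one density into the other. It serves
    to build the limit law of (a) out of entries of [W]. *)
Lemma is_gaussian_scale (v a : R) (X : T -> R) : 0 < v -> 0 < a ->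
  is_gaussian P v X -> is_gaussian P (a ^+ 2 * v) (fun w => a * X w).
Proof.
move=> v0 a0 gX; have mX := gX.1.
have maX : measurable_fun setT (fun w => a * X w) by exact: measurable_funM.
split=> // B mB.
have mXB : measurable ((fun w => a * X w) @^-1` B).
  by rewrite -[X in measurable X]setTI; exact: maX.
have := integral_indic P measurableT mXB; rewrite setIT => <-.
have mBa : measurable_fun setT (fun x : R => \1_B (a * x) : R).
  by apply: (measurableT_comp (measurable_indic mB)); exact: measurable_funM.
have := integral_gaussian gX mBa; rewrite -/mu => e.
transitivity (\int[mu]_x (normal_pdf 0 (Num.sqrt v) x * \1_B (a * x))%:E)%E.
  by rewrite -e; apply: eq_integral.
rewrite /normal_prob [RHS]integral_mkcond.
pose h (y : R) := normal_pdf 0 (Num.sqrt (a ^+ 2 * v)) y * \1_B y.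
have mh : measurable_fun setT h.
  by apply: measurable_funM; [exact: measurable_normal_pdf|exact: measurable_indic].
transitivity (\int[mu]_x (h x)%:E)%E; last first.
  apply: eq_integral => x _; rewrite /h /patch indicE.
  by case: ifP => _; rewrite ?mulr1 ?mulr0.
rewrite -(@integral_density _ (measurableTypeR R) R mu mu (cst a) (fun x => a * x) _ _ _ _ h mh)//.
- apply: eq_integral => x _; congr (_%:E); rewrite /h mulrA; congr (_ * _).
  have s0 : Num.sqrt v != 0 by rewrite gt_eqF// sqrtr_gt0.
  have av0 : 0 < a ^+ 2 * v by rewrite mulr_gt0// exprn_gt0.
  have s1 : Num.sqrt (a ^+ 2 * v) != 0 by rewrite gt_eqF// sqrtr_gt0.
  rewrite !normal_pdfE//.
  rewrite -[LHS]/(normal_peak (Num.sqrt v) * normal_fun 0 (Num.sqrt v) x).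
  rewrite -[X in _ = _ * X]/(normal_peak _ * normal_fun 0 (Num.sqrt (a ^+ 2 * v)) (a * x)).
  rewrite mulrA; congr (_ * _).
    rewrite /normal_peak (sqr_sqrtr (ltW v0)) (sqr_sqrtr (ltW av0)).
    have -> : a ^+ 2 * v * pi *+ 2 = a ^+ 2 * (v * pi *+ 2) by ring.
    rewrite (@sqrtrM _ (a ^+ 2)) ?sqr_ge0// sqrtr_sqr (gtr0_norm a0).
    by rewrite invfM mulVKf ?gt_eqF.
  rewrite /normal_fun !subr0 (sqr_sqrtr (ltW v0)) (sqr_sqrtr (ltW av0)).
  congr (expR _); field.
  by rewrite !gt_eqF.
- by move=> ?; exact: ltW.
- exact: measurable_funM.
- by move=> A mA; exact: lebesgue_measure_scale.
Qed.

End gaussian_scale.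

Lemma Rintegral_probability_cst d (T : measurableType d) (R : realType)
  (P : probability T R) (r : R) : \int[P]_w r = r.
Proof.
have h : P [set: T] = 1%E by exact: probability_setT.
transitivity (r * fine 1%E); last by rewrite mulr1.
by rewrite Rintegral_cst//; congr (_ * fine _); exact: h.
Qed.

Lemma Rintegral_sum d (T : measurableType d) (R : realType)
  (mu : {measure set T -> \bar R}) (I : Type) (s : seq I) (f : I -> T -> R) :
  (forall i, mu.-integrable setT (fun x => (f i x)%:E)) ->
  \int[mu]_x (\sum_(i <- s) f i x) = \sum_(i <- s) \int[mu]_x f i x.
Proof.
move=> intf; elim: s => [|i s IH].
  under eq_Rintegral do rewrite big_nil.
  by rewrite big_nil Rintegral_cst// mul0r.
under eq_Rintegral do rewrite big_cons.
rewrite big_cons -IH RintegralD//; first exact: intf.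
rewrite (_ : EFin \o (fun x => \sum_(j <- s) f j x) = (fun x => \sum_(j <- s) (f j x)%:E)%E).
  exact: integrable_sum.
by apply/funext => x /=; rewrite sumEFin.
Qed.

(** * Expectations of products of independent variables *)

Section independence.
Context d (T : measurableType d) (R : realType) (P : probability T R).
Variables (I : finType) (X : I -> T -> R).
Hypothesis mX : forall i, measurable_fun setT (X i).
Hypothesis indep : mutually_independent P X.

Let mhX (h : R -> R) i : measurable_fun setT h ->
  measurable_fun setT (fun w => h (X i w)).
Proof. by move=> mh; apply: (measurableT_comp mh). Qed.

Let expectation_prod_indic (h : I -> R -> R) (B : I -> set R) :
  (forall i, measurable (B i)) -> (forall i, h i = \1_(B i)) ->
  (\int[P]_w (\prod_i h i (X i w))%:E =
   (\prod_i \int[P]_w (h i (X i w)))%R%:E)%E.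
Proof.
move=> mB hB.
have mXB i : measurable (X i @^-1` B i).
  by rewrite -[X in measurable X]setTI; exact: mX.
have mI : measurable (\bigcap_(i in [set: I]) (X i @^-1` B i)).
  by apply: fin_bigcap_measurable => //; exact: finite_finset.
transitivity (\int[P]_w (\1_(\bigcap_(i in [set: I]) (X i @^-1` B i)) w)%:E)%E.
  apply: eq_integral => w _; congr (_%:E).
  under eq_bigr do rewrite hB.
  rewrite indicE; case: (boolP (w \in _)) => [|].
    rewrite inE => wB; apply: big1 => i _.
    by rewrite indicE mem_set//; exact: wB.
  rewrite notin_setE => wB.
  have [i wi] : exists i, ~ B i (X i w).
    by apply/existsNP => H; apply: wB => i _; exact: H.
  by rewrite (bigD1 i)//= indicE memNset// mul0r.
rewrite integral_indic// setIT; apply: etrans (indep mB) _.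
rewrite -prodEFin; apply: eq_bigr => i _.
rewrite /Rintegral hB fineK.
  have := integral_indic P measurableT (mXB i); rewrite setIT => <-.
  by [].
have -> : (\int[P]_w (\1_(B i) (X i w))%:E = P (X i @^-1` B i))%E.
  by have := integral_indic P measurableT (mXB i); rewrite setIT => <-.
exact: fin_num_measure.
Qed.

(** Independence is given on sets, so indicators are exchanged for general functions one index at a
    time: [s] lists the indices whose factor may be arbitrary. For the next index [j] the product
    [G] of the other factors becomes a weight, and the induction hypothesis with an indicator placed
    at [j] identifies the weighted law of [X j]. *)
Let expectation_prod_upto (s : seq I) (h : I -> R -> R) :
  (forall i, measurable_fun setT (h i)) -> (forall i x, 0 <= h i x) ->
  (forall i, P.-integrable setT (fun w => (h i (X i w))%:E)) ->
  (forall i, i \notin s -> exists2 B, measurable B & h i = \1_B) ->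
  (\int[P]_w (\prod_i h i (X i w))%:E =
   (\prod_i \int[P]_w (h i (X i w)))%R%:E)%E.
Proof.
elim: s h => [|j s IH] h mh h0 ih hs.
  have /choice[B BP] : forall i, exists B, measurable B /\ h i = \1_B.
    by move=> i; have [B mB hB] := hs i isT; exists B.
  by apply: (expectation_prod_indic (B := B)) => i; have [] := BP i.
pose G w := \prod_(i | i != j) h i (X i w).
pose c := \prod_(i | i != j) \int[P]_w (h i (X i w)).
have c0 : 0 <= c by apply: prodr_ge0 => i _; exact: Rintegral_ge0.
have mG : measurable_fun setT G.
  apply: (eq_measurable_fun (fun w => \prod_i if i != j then h i (X i w) else 1)).
    by move=> w _; rewrite /G [RHS]big_mkcond.
  by apply: measurable_prod => i _; case: (i != j) => //; exact: mhX.
have G0 w : 0 <= G w by exact: prodr_ge0.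
have [nu nuE] := @measure_scaled_pushforward _ _ _ (measurableTypeR R) _ P _ (mX j) (NngNum c0).
have GB (B : set R) : measurable B -> (\int[P]_w (G w * \1_B (X j w))%:E = nu B)%E.
  move=> mB; rewrite nuE//=.
  pose h' i := if i == j then \1_B else h i.
  have mXB : measurable (X j @^-1` B).
    by rewrite -[X in measurable X]setTI; exact: mX.
  have iB : P.-integrable setT (fun w => (\1_B (X j w) : R)%:E).
    exact: (integrable_indic P mXB).
  have e1 w : G w * \1_B (X j w) = \prod_i h' i (X i w).
    rewrite [RHS](bigD1 j)//= /h' eqxx mulrC; congr (_ * _).
    by apply: eq_bigr => i /negPf ->.
  under eq_integral do rewrite e1.
  rewrite IH.
  - rewrite (bigD1 j)//= {1}/h' eqxx.
    have -> : \prod_(i | i != j) \int[P]_w h' i (X i w) = c.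
      by apply: eq_bigr => i /negPf ij; rewrite /h' ij.
    under [RHS]eq_integral do rewrite EFinM.
    rewrite integralZl// mulrC EFinM; congr (_ * _)%E.
    by rewrite /Rintegral fineK//; exact: integrable_fin_num.
  - by move=> i; rewrite /h'; case: ifP => // _; exact: measurable_indic.
  - by move=> i x; rewrite /h'; case: ifP.
  - by move=> i; rewrite /h'; case: ifP => // /eqP ->.
  - move=> i is'; rewrite /h'; case: ifPn => [_|ij]; first by exists B.
    by apply: hs; rewrite in_cons negb_or ij.
have key : (\int[P]_w (G w * h j (X j w))%:E = \int[P]_w (c * h j (X j w))%:E)%E.
  rewrite (ge0_integral_density mG G0 (mX j) GB (mh j) (h0 j)).
  rewrite -(@ge0_integral_density _ _ _ P nu (cst c) (X j))//.
  by move=> A mA; rewrite nuE.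
transitivity (\int[P]_w (G w * h j (X j w))%:E)%E.
  by apply: eq_integral => w _; rewrite [in LHS](bigD1 j)//= mulrC.
rewrite key; under eq_integral do rewrite EFinM.
rewrite integralZl// [in RHS](bigD1 j)//= mulrC EFinM; congr (_ * _)%E.
by rewrite /Rintegral fineK//; exact: integrable_fin_num.
Qed.

Variable f : I -> R -> R.
Hypothesis mf : forall i, measurable_fun setT (f i).
Hypothesis intf : forall i, P.-integrable setT (fun w => (f i (X i w))%:E).

Lemma integrable_prod_independent :
  P.-integrable setT (fun w => (\prod_i f i (X i w))%:E).
Proof.
apply/integrableP; split.
  apply/measurable_EFinP.
  by apply: measurable_prod => i _; exact: mhX.
under eq_integral do rewrite abse_EFin normr_prod.
rewrite (@expectation_prod_upto (enum I) (fun i x => `|f i x|)) ?ltry//.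
- by move=> i; exact: measurableT_comp.
- by move=> i; have := integrable_abse (intf i).
- by move=> i; rewrite mem_enum.
Qed.

(** Each factor is split into its positive and negative parts; expanding the product gives a signed
    sum over sign choices [e] of products of nonnegative factors. *)
Lemma expectation_prod_independent :
  \int[P]_w (\prod_i f i (X i w)) = \prod_i \int[P]_w f i (X i w).
Proof.
pose q (b : bool) i x := if b then Num.max (- f i x) 0 else Num.max (f i x) 0.
have fq' i x : f i x = Num.max (f i x) 0 - Num.max (- f i x) 0.
  have /orP[h|h] := le_total 0 (f i x).
    have -> : Num.max (f i x) 0 = f i x by exact: max_l.
    have -> : Num.max (- f i x) 0 = 0 by apply: max_r; rewrite oppr_le0.
    by rewrite subr0.
  have -> : Num.max (f i x) 0 = 0 by exact: max_r.
  have -> : Num.max (- f i x) 0 = - f i x by apply: max_l; rewrite oppr_ge0.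
  by rewrite sub0r opprK.
have fq i x : f i x = \sum_(b : bool) (-1) ^+ b * q b i x.
  by rewrite big_bool/= expr1 expr0 mul1r mulN1r addrC; exact: fq'.
have mq b i : measurable_fun setT (q b i).
  rewrite /q; case: b; apply: measurable_maxr => //.
  exact: measurableT_comp.
have q0 b i x : 0 <= q b i x by rewrite /q; case: b; rewrite le_max lexx orbT.
have qf b i x : `|q b i x| <= `|f i x|.
  rewrite ger0_norm// /q; case: b; rewrite ge_max normr_ge0 andbT.
    by rewrite -normrN ler_norm.
  exact: ler_norm.
have iq b i : P.-integrable setT (fun w => (q b i (X i w))%:E).
  apply: (le_integrable measurableT _ _ (intf i)).
    by apply/measurable_EFinP; exact: mhX.
  by move=> w _; rewrite !abse_EFin lee_fin.
have ip (e : {ffun I -> bool}) :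
    P.-integrable setT (fun w => (\prod_i q (e i) i (X i w))%:E).
  apply/integrableP; split.
    apply/measurable_EFinP.
    by apply: measurable_prod => i _; exact: mhX.
  under eq_integral do rewrite abse_EFin ger0_norm ?prodr_ge0//.
  rewrite (@expectation_prod_upto (enum I) (fun i => q (e i) i)) ?ltry//.
  by move=> i; rewrite mem_enum.
transitivity (\int[P]_w (\sum_(e : {ffun I -> bool})
    (\prod_i (-1) ^+ e i) * \prod_i q (e i) i (X i w))).
  apply: eq_Rintegral => w _.
  under eq_bigr do rewrite fq.
  rewrite bigA_distr_bigA/=; apply: eq_bigr => e _.
  by rewrite big_split.
rewrite Rintegral_sum; last first.
  by move=> e; under eq_fun do rewrite EFinM; exact: integrableZl.
have eE i : \int[P]_w f i (X i w) = \sum_(b : bool) (-1) ^+ b * \int[P]_w q b i (X i w).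
  under eq_Rintegral do rewrite fq.
  rewrite Rintegral_sum; last first.
    by move=> b; under eq_fun do rewrite EFinM; exact: integrableZl.
  by apply: eq_bigr => b _; rewrite RintegralZl//; exact: iq.
under [RHS]eq_bigr do rewrite eE.
rewrite [RHS]bigA_distr_bigA/=; apply: eq_bigr => e _.
rewrite RintegralZl//; last exact: ip.
rewrite big_split/=; congr (_ * _).
rewrite /Rintegral (@expectation_prod_upto (enum I) (fun i => q (e i) i))//.
by move=> i; rewrite mem_enum.
Qed.

End independence.

(** * Gaussian integration by parts for polynomials *)

Section stein.
Context d (T : measurableType d) (R : realType) (P : probability T R).
Variables (I : finType) (nu : I -> R) (X : I -> T -> R).

Definition monom (l : seq I) (w : T) : R := \prod_(i <- l) X i w.

Fixpoint dmonom (p : I) (l : seq I) (w : T) : R :=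
  if l is i :: l' then (p == i)%:R * monom l' w + X i w * dmonom p l' w else 0.

Definition peval (s : seq (R * seq I)) (w : T) : R :=
  \sum_(c <- s) c.1 * monom c.2 w.

Definition dpeval (p : I) (s : seq (R * seq I)) (w : T) : R :=
  \sum_(c <- s) c.1 * dmonom p c.2 w.

(** A certificate that [g] is a polynomial in the variables [X], together with a formal gradient:
    both are read off the same list of coefficients and index lists. The closure lemmas below thus
    differentiate while they build, and the calculus in the parameters stays algebraic. *)
Definition ispoly (g : T -> R) (dg : I -> T -> R) :=
  exists s, (forall w, g w = peval s w) /\ forall p w, dg p w = dpeval p s w.

Lemma dmonom_cat p l1 l2 w :
  dmonom p (l1 ++ l2) w = dmonom p l1 w * monom l2 w + monom l1 w * dmonom p l2 w.
Proof.
elim: l1 => [|i l1 IH] /=; first by rewrite /monom big_nil; ring.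
by rewrite IH /monom big_cat big_cons/=; ring.
Qed.

Lemma ispoly_ext g g' dg dg' : (forall w, g w = g' w) ->
  (forall p w, dg p w = dg' p w) -> ispoly g' dg' -> ispoly g dg.
Proof.
move=> gg dd [s [h1 h2]]; exists s.
by split=> [w|p w]; [rewrite gg h1|rewrite dd h2].
Qed.

Lemma ispoly_cst c : ispoly (fun=> c) (fun _ _ => 0).
Proof.
exists [:: (c, [::])]; split=> [w|p w].
  by rewrite /peval big_seq1 /monom big_nil mulr1.
by rewrite /dpeval big_seq1 /= mulr0.
Qed.

Lemma ispoly_var i : ispoly (X i) (fun p _ => (p == i)%:R).
Proof.
exists [:: (1, [:: i])]; split=> [w|p w].
  by rewrite /peval big_seq1 /monom big_seq1 mul1r.
by rewrite /dpeval big_seq1 /= /monom big_nil; ring.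
Qed.

Lemma ispolyD g dg h dh : ispoly g dg -> ispoly h dh ->
  ispoly (fun w => g w + h w) (fun p w => dg p w + dh p w).
Proof.
move=> [s [h1 h2]] [t [k1 k2]]; exists (s ++ t); split=> [w|p w].
  by rewrite h1 k1 /peval big_cat.
by rewrite h2 k2 /dpeval big_cat.
Qed.

Lemma ispolyM g dg h dh : ispoly g dg -> ispoly h dh ->
  ispoly (fun w => g w * h w) (fun p w => dg p w * h w + g w * dh p w).
Proof.
move=> [s [h1 h2]] [t [k1 k2]].
exists [seq (a.1 * b.1, a.2 ++ b.2) | a <- s, b <- t]; split=> [w|p w].
  rewrite h1 k1 /peval big_allpairs_dep mulr_suml; apply: eq_bigr => a _.
  rewrite mulr_sumr; apply: eq_bigr => b _.
  by rewrite /monom big_cat/=; ring.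
rewrite h1 k1 h2 k2 /peval /dpeval big_allpairs_dep !mulr_suml -big_split/=.
apply: eq_bigr => a _; rewrite !mulr_sumr -big_split/=; apply: eq_bigr => b _.
by rewrite dmonom_cat; ring.
Qed.

Lemma ispoly_sum (J : Type) (s : seq J) (g : J -> T -> R) (dg : J -> I -> T -> R) :
  (forall j, ispoly (g j) (dg j)) ->
  ispoly (fun w => \sum_(j <- s) g j w) (fun p w => \sum_(j <- s) dg j p w).
Proof.
move=> H; elim: s => [|j s IH].
  by apply: ispoly_ext (ispoly_cst 0) => *; rewrite big_nil.
by apply: ispoly_ext (ispolyD (H j) IH) => *; rewrite big_cons.
Qed.

Lemma ispolyZ c g dg : ispoly g dg ->
  ispoly (fun w => c * g w) (fun p w => c * dg p w).
Proof.
by move=> H; apply: ispoly_ext (ispolyM (ispoly_cst c) H) => // *; ring.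
Qed.

(** Gives integrability of derivatives, so that their expectations may be summed. *)
Lemma ispoly_deriv p g dg : ispoly g dg -> exists ddg, ispoly (dg p) ddg.
Proof.
move=> [s [_ h2]].
have mm l : exists dd, ispoly (monom l) dd.
  exists (fun q w => dmonom q l w); exists [:: (1, l)].
  by split=> [w|q w]; rewrite /peval /dpeval big_seq1 mul1r.
have dm l : exists dd, ispoly (dmonom p l) dd.
  elim: l => [|i l [dd IH]]; first by eexists; exact: (ispoly_cst 0).
  have [d1 H1] := mm l.
  by eexists; exact: (ispolyD (ispolyZ _ H1) (ispolyM (ispoly_var i) IH)).
have /choice[dd ddP] : forall c : R * seq I, exists dd, ispoly (fun w => c.1 * dmonom p c.2 w) dd.
  by move=> c; have [dd H] := dm c.2; eexists; exact: (ispolyZ _ H).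
by eexists; apply: ispoly_ext (ispoly_sum s ddP) => // w; rewrite h2.
Qed.

Hypothesis nu0 : forall i, 0 < nu i.
Hypothesis gX : forall i, is_gaussian P (nu i) (X i).
Hypothesis indep : mutually_independent P X.

Local Notation E g := (Rintegral P setT g).

Let mX i : measurable_fun setT (X i). Proof. by case: (gX i). Qed.

Lemma monomE l w : monom l w = \prod_i X i w ^+ count_mem i l.
Proof.
elim: l => [|j l IH].
  by rewrite /monom big_nil big1// => i _; rewrite expr0.
rewrite /monom big_cons -/(monom l w) IH /= (bigD1 j)//= [RHS](bigD1 j)//= eqxx.
rewrite mulrA -exprS; congr (_ * _); apply: eq_bigr => i /negPf ij.
by rewrite eq_sym ij.
Qed.

Lemma integrable_monom l : P.-integrable setT (fun w => (monom l w)%:E).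
Proof.
under eq_fun do rewrite monomE.
apply: (integrable_prod_independent mX indep (f := fun i x => x ^+ count_mem i l)).
- by move=> i; exact: measurable_funX.
- by move=> i; exact: (integrable_gaussian_pow (nu0 i) (gX i)).
Qed.

Lemma expectation_monom l :
  E (monom l) = \prod_i E (fun w => X i w ^+ count_mem i l).
Proof.
have -> : monom l = (fun w => \prod_i X i w ^+ count_mem i l).
  by apply/funext => w; exact: monomE.
apply: (expectation_prod_independent mX indep (f := fun i x => x ^+ count_mem i l)).
- by move=> i; exact: measurable_funX.
- by move=> i; exact: (integrable_gaussian_pow (nu0 i) (gX i)).
Qed.

Lemma dmonomE p l w : dmonom p l w = (count_mem p l)%:R * monom (rem p l) w.
Proof.
elim: l => [|i l IH] /=; first by rewrite mul0r.
rewrite IH eq_sym; case: eqVneq => [->|ip] /=; last first.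
  by rewrite mul0r !add0r {2}/monom big_cons mulrCA.
rewrite mul1r natrD mulrDl mul1r; congr (_ + _).
have [pl|pl] := boolP (p \in l).
  rewrite mulrCA; congr (_ * _).
  by rewrite /monom (perm_big _ (perm_to_rem pl)) big_cons.
by rewrite (count_memPn pl); ring.
Qed.

(** Independence turns both sides into products of one-dimensional moments, which differ only at
    [p]; there [gaussian_moment] applies with exponent [count_mem p l]. *)
Lemma stein_monom p l : E (fun w => X p w * monom l w) = nu p * E (dmonom p l).
Proof.
have -> : (fun w => X p w * monom l w) = monom (p :: l).
  by apply/funext => w; rewrite /monom big_cons.
rewrite expectation_monom.
have -> : dmonom p l = (fun w => (count_mem p l)%:R * monom (rem p l) w).
  by apply/funext => w; exact: dmonomE.
rewrite RintegralZl//; last exact: integrable_monom.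
rewrite expectation_monom (bigD1 p)//= [in RHS](bigD1 p)//= eqxx.
rewrite (gaussian_moment (nu0 p) (gX p)) -!mulrA; congr (_ * (_ * _)).
rewrite count_mem_rem eqxx subn1; congr (_ * _).
by apply: eq_bigr => i /negPf ip; rewrite count_mem_rem eq_sym ip subn0.
Qed.

Lemma ispoly_integrable g dg : ispoly g dg -> P.-integrable setT (fun w => (g w)%:E).
Proof.
move=> [s [h1 _]]; under eq_fun do rewrite h1 /peval -sumEFin.
apply: integrable_sum => // c _; under eq_fun do rewrite EFinM.
by apply: integrableZl => //; exact: integrable_monom.
Qed.

Lemma ispoly_measurable g dg : ispoly g dg -> measurable_fun setT g.
Proof.
by move=> /ispoly_integrable/measurable_int/measurable_EFinP.
Qed.

Lemma stein p g dg : ispoly g dg -> E (fun w => X p w * g w) = nu p * E (dg p).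
Proof.
move=> [s [h1 h2]].
under eq_Rintegral do rewrite h1 /peval mulr_sumr.
under [in RHS]eq_Rintegral do rewrite h2 /dpeval.
have iXm l : P.-integrable setT (fun w => (X p w * monom l w)%:E).
  have -> : (fun w => (X p w * monom l w)%:E) = (fun w => (monom (p :: l) w)%:E).
    by apply/funext => w; rewrite /monom big_cons.
  exact: integrable_monom.
rewrite Rintegral_sum; last first.
  move=> c; under eq_fun do rewrite mulrCA EFinM.
  exact: integrableZl.
have id c : P.-integrable setT (fun w => (dmonom p c w)%:E).
  under eq_fun do rewrite dmonomE EFinM.
  by apply: integrableZl => //; exact: integrable_monom.
rewrite Rintegral_sum; last first.
  by move=> c; under eq_fun do rewrite EFinM; exact: integrableZl.
rewrite mulr_sumr; apply: eq_bigr => c _.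
under eq_Rintegral do rewrite mulrCA.
rewrite [in LHS]RintegralZl//; last exact: iXm.
rewrite [in RHS]RintegralZl//; last exact: id.
by rewrite stein_monom mulrCA.
Qed.

End stein.

(** * Words in a matrix and its transpose, and their contractions *)

Section words.
Context (R : fieldType) (n : nat) (A : finType).
Variables (Wm : 'M[R]_n) (v : A -> 'cV[R]_n).

Definition letter (b : bool) : 'M[R]_n := if b then Wm^T else Wm.

Fixpoint wordmx (u : seq bool) : 'M[R]_n :=
  if u is b :: u' then letter b *m wordmx u' else 1%:M.

(** The word of the transposed product: reversal for the order, negation for each letter. *)
Definition tword (u : seq bool) := rev (map negb u).

Lemma wordmx_cat u1 u2 : wordmx (u1 ++ u2) = wordmx u1 *m wordmx u2.
Proof. by elim: u1 => [|b u IH] /=; rewrite ?mul1mx// IH mulmxA. Qed.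

Lemma wordmx_tword u : wordmx (tword u) = (wordmx u)^T.
Proof.
elim: u => [|b u IH]; first by rewrite /= trmx1.
rewrite /tword /= rev_cons -cats1 wordmx_cat -/(tword u) IH /= trmx_mul mulmx1.
by congr (_ *m _); case: b => /=; rewrite ?trmxK.
Qed.

Lemma size_tword u : size (tword u) = size u.
Proof. by rewrite size_rev size_map. Qed.

Fixpoint splits (u : seq bool) : seq (seq bool * bool * seq bool) :=
  if u is b :: u' then
    ([::], b, u') :: [seq (b :: s.1.1, s.1.2, s.2) | s <- splits u']
  else [::].

Lemma size_splits u s : s \in splits u -> (size s.1.1 + size s.2).+1 = size u.
Proof.
elim: u s => [//|b u IH] s; rewrite inE => /predU1P[->//|/mapP[t tu ->]] /=.
by rewrite -(IH t tu).
Qed.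

(** The product rule for [wordmx u] when the letter [c] moves in direction [D], so that the opposite
    letter moves in direction [D^T]. *)
Definition dword (c : bool) (D : 'M[R]_n) (u : seq bool) : 'M[R]_n :=
  \sum_(s <- splits u)
    wordmx s.1.1 *m (if s.1.2 == c then D else D^T) *m wordmx s.2.

Lemma dword_cons c D b u : dword c D (b :: u) =
  (if b == c then D else D^T) *m wordmx u + letter b *m dword c D u.
Proof.
rewrite /dword /= big_cons /= mul1mx; congr (_ + _).
by rewrite big_map mulmx_sumr; apply: eq_bigr => s _; rewrite /= !mulmxA.
Qed.

Lemma trace_mul_delta (N : 'M[R]_n) i j : \tr (N *m delta_mx i j) = N j i.
Proof.
rewrite /mxtrace (bigD1 j)//= big1 => [|k kj].
  rewrite addr0 mxE (bigD1 i)//= big1 => [|l li].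
    by rewrite mxE !eqxx mulr1 addr0.
  by rewrite mxE (negPf li) /= mulr0.
by rewrite mxE big1 // => l _; rewrite mxE (negPf kj) andbF mulr0.
Qed.

(* The atom [(u, None)] stands for [n^-1 tr u] and [(u, Some (a, b))] for [n^-1 v_a^T u v_b];
   the letter [true] of the word [u] is the transposed matrix. *)
Definition atom : Type := (seq bool * option (A * A))%type.

Definition atommx (q : option (A * A)) : 'M[R]_n :=
  if q is Some (a, b) then v b *m (v a)^T else 1%:M.

Definition atomv (x : atom) : R := n%:R^-1 * \tr (wordmx x.1 *m atommx x.2).

Definition datomv c D (x : atom) : R :=
  n%:R^-1 * \tr (dword c D x.1 *m atommx x.2).

Definition cval (cs : seq (nat * seq atom)) : R :=
  \sum_(k <- cs) n%:R^-1 ^+ k.1 * \prod_(x <- k.2) atomv x.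

(** Contraction of the first letter [c] with a later letter of the same atom. An opposite letter
    cuts the word into two atoms, without loss; an equal letter ([self]) transposes the part in
    between, leaves a single atom and costs [n^-1]. *)
Definition lead (c : bool) u (q : option (A * A)) : seq (nat * seq atom) :=
  [seq (0%N, [:: (s.1.1, None); (s.2, q)]) | s <- splits u & s.1.2 != c].

Definition self (c : bool) u (q : option (A * A)) : seq (nat * seq atom) :=
  [seq (1%N, [:: (tword s.1.1 ++ s.2, q)]) | s <- splits u & s.1.2 == c].

(** Contraction of the first letter of [c :: u] with the letter [b] of another atom [u1 b u2]. The
    two traces merge into one, and one of the two normalisations is left over as [n^-1]. If both
    atoms are bilinear forms, the merged trace breaks up at the vectors into two bilinear forms,
    which use both normalisations; hence the exponent [0]. *)
Definition cross1 (c : bool) u (q : option (A * A)) u1 (b : bool) u2 (q' : option (A * A)) :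
    nat * seq atom :=
  let ut := if b == c then tword u else u in
  match q, q' with
  | None, _ => (1%N, [:: (u1 ++ ut ++ u2, q')])
  | Some (a1, a2), None =>
    (1%N, if b == c then [:: (tword u ++ u2 ++ u1, Some (a2, a1))]
          else [:: (u2 ++ u1 ++ u, q)])
  | Some (a1, a2), Some (a3, a4) =>
    (0%N, if b == c then [:: (tword u ++ u2, Some (a2, a4)); (u1, Some (a3, a1))]
          else [:: (u2, Some (a1, a4)); (u1 ++ u, Some (a3, a2))])
  end.

Definition cross c u q (y : atom) : seq (nat * seq atom) :=
  [seq cross1 c u q s.1.1 s.1.2 s.2 y.2 | s <- splits y.1].

Hypothesis n0 : n%:R != 0 :> R.

(** The sum over matrix units glues indices. At an equal letter [E_ij] joins the two pieces into a
    single trace with one of them transposed; at an opposite letter [E_ji] separates them into two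
    traces. *)
Lemma sum_dword_delta c u (Q : 'M[R]_n) :
  \sum_i \sum_j (dword c (delta_mx i j) u *m Q) j i =
  \sum_(s <- splits u)
    if s.1.2 == c then \tr ((wordmx s.1.1)^T *m wordmx s.2 *m Q)
    else \tr (wordmx s.1.1) * \tr (wordmx s.2 *m Q).
Proof.
rewrite /dword.
under eq_bigr => i _ do under eq_bigr => j _ do rewrite mulmx_suml summxE.
under eq_bigr => i _ do rewrite exchange_big/=.
rewrite exchange_big/=; apply: eq_bigr => -[[u1 b] u2] _ /=.
have dE (M N : 'M[R]_n) i j k l : (M *m delta_mx i j *m N) k l = M k i * N j l.
  rewrite mxE (bigD1 j)//= big1 => [|r rj].
    rewrite addr0 mxE (bigD1 i)//= big1 => [|r ri].
      by rewrite mxE !eqxx mulr1 addr0.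
    by rewrite mxE (negPf ri) /= mulr0.
  rewrite mxE big1 ?mul0r// => k' _.
  by rewrite mxE (negPf rj) andbF mulr0.
case: ifP => _.
  rewrite /mxtrace; under [RHS]eq_bigr => i _ do rewrite -mulmxA mxE.
  apply: eq_bigr => i _; apply: eq_bigr => j _.
  by rewrite -mulmxA dE; congr (_ * _); rewrite mxE.
rewrite /mxtrace mulr_suml exchange_big/=; apply: eq_bigr => j _.
rewrite mulr_sumr; apply: eq_bigr => i _.
by rewrite trmx_delta -mulmxA dE.
Qed.

Lemma self_contraction c u q :
  n%:R^-1 ^+ 2 * (\sum_i \sum_j (dword c (delta_mx i j) u *m atommx q) j i) =
  cval (lead c u q) + cval (self c u q).
Proof.
rewrite sum_dword_delta /cval /lead /self !big_map !big_filter.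
rewrite mulr_sumr [in RHS]big_mkcond [X in _ + X]big_mkcond -big_split/=.
apply: eq_bigr => -[[u1 b] u2] _ /=; case: (b == c) => /=.
  rewrite add0r expr1 big_seq1 /atomv /= wordmx_cat wordmx_tword.
  by rewrite expr2 mulrA.
by rewrite addr0 expr0 mul1r big_cons big_seq1 /atomv /= mulmx1; ring.
Qed.

Lemma mxtr11 (a b : 'cV[R]_n) (M : 'M[R]_n) :
  \tr (M *m (b *m a^T)) = (a^T *m M *m b) 0 0.
Proof. by rewrite mulmxA mxtrace_mulC mulmxA /mxtrace big_ord1. Qed.

Lemma cross_contraction c u q y :
  n%:R^-1 * (\sum_i \sum_j (wordmx u *m atommx q) j i *
     datomv c (delta_mx i j) y) = cval (cross c u q y).
Proof.
case: y => w q'.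
have stepE (D : 'M[R]_n) : datomv c D (w, q') =
    \sum_(s <- splits w) n%:R^-1 *
      \tr ((wordmx s.2 *m atommx q' *m wordmx s.1.1) *m (if s.1.2 == c then D else D^T)).
  rewrite /datomv /= -mulr_sumr /dword mulmx_suml raddf_sum/=; congr (_ * _).
  apply: eq_bigr => s _.
  by rewrite -[wordmx _ *m _ *m _ *m _]mulmxA mxtrace_mulC !mulmxA.
under eq_bigr => i _ do under eq_bigr => j _ do rewrite stepE mulr_sumr.
under eq_bigr => i _ do rewrite exchange_big/=.
rewrite exchange_big/= mulr_sumr /cval /cross big_map.
apply: eq_bigr => -[[u1 b] u2] _ /=.
set N := wordmx u2 *m _ *m _.
transitivity (n%:R^-1 ^+ 2 *
    \tr ((if b == c then (wordmx u *m atommx q)^T else wordmx u *m atommx q) *m N)).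
  rewrite expr2 -mulrA; congr (_ * _).
  transitivity (\sum_i \sum_j (wordmx u *m atommx q) j i *
      (n%:R^-1 * (if b == c then N j i else N i j))).
    apply: eq_bigr => i _; apply: eq_bigr => j _; congr (_ * (_ * _)).
    by case: (b == c); rewrite ?trmx_delta trace_mul_delta.
  rewrite /mxtrace; case: (b == c).
    rewrite mulr_sumr; apply: eq_bigr => i _.
    rewrite mxE mulr_sumr; apply: eq_bigr => j _.
    rewrite mulrCA; congr (_ * (_ * _)).
    by rewrite [RHS]mxE.
  rewrite exchange_big/= mulr_sumr; apply: eq_bigr => j _.
  rewrite mxE mulr_sumr; apply: eq_bigr => i _.
  by rewrite mulrCA.
rewrite /N /cross1 {N stepE}.
case: q => [[a1 a2]|]; last first.
  rewrite /= mulmx1 expr1 big_seq1 /atomv/= !wordmx_cat expr2 -mulrA.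
  congr (_ * (_ * _)).
  have -> : (if b == c then (wordmx u)^T else wordmx u) =
    wordmx (if b == c then tword u else u).
    by case: ifP => _; rewrite ?wordmx_tword.
  by rewrite [in LHS]mulmxA [in LHS]mxtrace_mulC !mulmxA.
have trE (M : 'M[R]_n) x y : \tr (M *m (v y *m (v x)^T)) = ((v x)^T *m M *m v y) 0 0.
  exact: mxtr11.
have m11 (x y : 'M[R]_1) : (x *m y) 0 0 = x 0 0 * y 0 0 by rewrite mxE big_ord1.
case: q' => [[a3 a4]|].
  case: (b == c) => /=; rewrite expr0 mul1r big_cons big_seq1 /atomv/=.
    rewrite !trE wordmx_cat wordmx_tword.
    rewrite !trmx_mul trmxK.
    transitivity (n%:R^-1 ^+ 2 * \tr (((v a2)^T *m (wordmx u)^T *m wordmx u2 *m v a4)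
         *m ((v a3)^T *m wordmx u1 *m v a1))).
      by congr (_ * _); rewrite -[v a1 *m _ *m _]mulmxA -[v a1 *m _ *m _]mulmxA mxtrace_mulC !mulmxA.
    by rewrite {1}/mxtrace big_ord1 m11 !mulmxA; ring.
  rewrite !trE wordmx_cat.
  transitivity (n%:R^-1 ^+ 2 * \tr (((v a1)^T *m wordmx u2 *m v a4)
         *m ((v a3)^T *m wordmx u1 *m wordmx u *m v a2))).
    by congr (_ * _); rewrite [wordmx u *m (_ *m _)]mulmxA -[wordmx u *m v a2 *m _ *m _]mulmxA mxtrace_mulC !mulmxA.
  by rewrite {1}/mxtrace big_ord1 m11 !mulmxA; ring.
case: (b == c) => /=; rewrite expr1 big_seq1 /atomv/= mulmx1 expr2 -mulrA !wordmx_cat.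
  rewrite wordmx_tword !trmx_mul trmxK; congr (_ * (_ * _)).
  by rewrite -[v a1 *m _ *m _ *m _]mulmxA mxtrace_mulC !mulmxA.
congr (_ * (_ * _)).
by rewrite mxtrace_mulC !mulmxA.
Qed.

End words.

Lemma size_splits_lt u s : s \in splits u ->
  (size s.1.1 < size u)%N /\ (size s.2 < size u)%N.
Proof. by move/size_splits <-; rewrite !ltnS leq_addr leq_addl. Qed.

(** * Limits of normalised traces of words *)

Section limits.
Context (R : realType) (A : finType) (nuW : R) (nuv : A -> R).

(** [tlim] is [nuW] to half the length times the number of noncrossing pairings of letters with
    opposite letters. The recursion chooses the partner of the first letter; the two remaining parts
    are shorter but not structural subterms, hence the fuel. *)
Fixpoint tlim_fuel (k : nat) (u : seq bool) : R :=
  match k, u with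
  | _, [::] => 1
  | k'.+1, c :: u' => nuW * \sum_(s <- splits u' | s.1.2 != c)
      tlim_fuel k' s.1.1 * tlim_fuel k' s.2
  | 0, _ => 0
  end.

Definition tlim u := tlim_fuel (size u) u.

Lemma tlim_fuelE k u : (size u <= k)%N -> tlim_fuel k u = tlim u.
Proof.
rewrite /tlim.
suff H j k' u' : (size u' <= j)%N -> (size u' <= k')%N ->
    tlim_fuel j u' = tlim_fuel k' u' by move=> h; exact: H.
elim: j k' u' => [|j IH] [|k'] [|c u']//= uj uk.
congr (_ * _); rewrite big_seq_cond [RHS]big_seq_cond.
apply: eq_bigr => s /andP[su _].
have [s1 s2] := size_splits_lt su.
by congr (_ * _); apply: IH; [exact: leq_trans (ltnW s1) uj|exact: leq_trans (ltnW s1) uk|exact: leq_trans (ltnW s2) uj|exact: leq_trans (ltnW s2) uk].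
Qed.

Lemma tlim_cons c u : tlim (c :: u) =
  nuW * \sum_(s <- splits u | s.1.2 != c) tlim s.1.1 * tlim s.2.
Proof.
rewrite {1}/tlim /=; congr (_ * _); rewrite big_seq_cond [RHS]big_seq_cond.
apply: eq_bigr => s /andP[su _].
have [s1 s2] := size_splits_lt su.
by congr (_ * _); apply: tlim_fuelE; exact: ltnW.
Qed.

Lemma tlim_nseq b k : tlim (nseq k b) = (k == 0)%:R.
Proof.
case: k => [//|k]; rewrite tlim_cons big_seq_cond big1 ?mulr0// => s /andP[].
suff : s \in splits (nseq k b) -> s.1.2 = b by move=> H /H ->; rewrite eqxx.
elim: k s => [//|k IH] s; rewrite inE => /predU1P[->//|/mapP[t /IH + ->]].
by [].
Qed.

Lemma splits_cat p q : splits (p ++ q) =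
  [seq (s.1.1, s.1.2, s.2 ++ q) | s <- splits p] ++
  [seq (p ++ s.1.1, s.1.2, s.2) | s <- splits q].
Proof.
elim: p => [|b p IH] /=; first by rewrite -[LHS]map_id; apply: eq_map => -[[]].
by rewrite IH map_cat -!map_comp.
Qed.

Lemma splits_nseq b k s : s \in splits (nseq k b) ->
  s.1.2 = b /\ s.2 = nseq (size s.2) b.
Proof.
elim: k s => [//|k IH] s; rewrite inE => /predU1P[->/=|/mapP[t /IH + ->]//].
by rewrite size_nseq.
Qed.

(** Only the fully nested pairing contributes: if the first letter is not paired with the last one,
    the part behind its partner is a nonempty word in a single letter, whose limit is [0]. *)
Lemma tlim_nseq_cat b i j :
  tlim (nseq i b ++ nseq j (~~ b)) = (i == j)%:R * nuW ^+ i.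
Proof.
elim: i j => [|i IH] j; first by rewrite /= tlim_nseq expr0 mulr1 eq_sym.
case: j => [|j]; first by rewrite cats0 tlim_nseq !mul0r.
rewrite -[nseq i.+1 b ++ _]/(b :: (nseq i b ++ nseq j.+1 (~~ b))) tlim_cons.
have -> : nseq j.+1 (~~ b) = nseq j (~~ b) ++ [:: ~~ b].
  by rewrite -(nseqD j 1) addn1.
rewrite catA splits_cat big_cat/= splits_cat map_cat big_cat/= !big_map/=.
rewrite big_seq_cond big1 ?add0r => [|s /andP[/splits_nseq[-> _]]]; last by rewrite eqxx.
rewrite big_seq_cond big1 ?add0r => [|s /andP[/splits_nseq[_ ->] _]]; last first.
  by rewrite -(nseqD _ 1) tlim_nseq addn1 mulr0.
rewrite big_cons big_nil cats0 /= addr0.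
have -> : ~~ b != b by case: b {IH}.
rewrite mulr1 IH eqSS exprS; ring.
Qed.

End limits.

Section picks.
Variable S : eqType.

(** Picks by position, so that repeated elements are picked separately, as the Leibniz rule for a
    product over a list requires. *)
Fixpoint picks (l : seq S) : seq (S * seq S) :=
  if l is x :: l' then (x, l') :: [seq (y.1, x :: y.2) | y <- picks l'] else [::].

Lemma perm_picks l y : y \in picks l -> perm_eq l (y.1 :: y.2).
Proof.
elim: l y => [//|x l IH] y; rewrite inE => /predU1P[->//|/mapP[z /IH zl ->]] /=.
rewrite (perm_trans (y := x :: z.1 :: z.2)) ?perm_cons//.
by apply/permP => a /=; lia.
Qed.

End picks.

(** * Loop equations for the random atoms *)

Section random_words.
Context d (T : measurableType d) (R : realType) (P : probability T R).
Variables (n nx ny : nat) (X : param_index n nx ny -> T -> R).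
Hypothesis n0 : (0 < n)%N.
Local Notation I := (param_index n nx ny).
Local Notation A := ('I_nx + 'I_ny)%type.
Local Notation isp := (ispoly X).

Let c : R := (Num.sqrt n%:R)^-1.

Let nR0 : (n%:R : R) != 0. Proof. by rewrite pnatr_eq0 -lt0n. Qed.

Let cc : c * c = n%:R^-1.
Proof. by rewrite -invfM -expr2 sqr_sqrtr ?ler0n. Qed.

Definition vec_index (a : A) (i : 'I_n) : I :=
  match a with inl k => inl (inr (i, k)) | inr k => inr (k, i) end.

Definition letter_index (b : bool) (i j : 'I_n) : I :=
  inl (inl (if b then (j, i) else (i, j))).

Definition rW (w : T) : 'M[R]_n := \matrix_(i, j) (c * X (inl (inl (i, j))) w).
Definition rv (w : T) (a : A) : 'cV[R]_n := \col_i X (vec_index a i) w.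
Definition dW (r : I) : 'M[R]_n := \matrix_(i, j) (c * (r == inl (inl (i, j)))%:R).
Definition dv (r : I) (a : A) : 'cV[R]_n := \col_i (r == vec_index a i)%:R.

Definition ispolymx p q (M : T -> 'M[R]_(p, q)) (dM : I -> T -> 'M[R]_(p, q)) :=
  forall i j, isp (fun w => M w i j) (fun r w => dM r w i j).

Lemma ispolymxM p q r (M : T -> 'M[R]_(p, q)) dM (N : T -> 'M[R]_(q, r)) dN :
  ispolymx M dM -> ispolymx N dN ->
  ispolymx (fun w => M w *m N w) (fun k w => dM k w *m N w + M w *m dN k w).
Proof.
move=> HM HN i j.
apply: ispoly_ext (ispoly_sum _ (fun k => ispolyM (HM i k) (HN k j))) => [w|k w].
  by rewrite mxE.
by rewrite !mxE -big_split.
Qed.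

Lemma ispolymx_tr p q (M : T -> 'M[R]_(p, q)) dM :
  ispolymx M dM -> ispolymx (fun w => (M w)^T) (fun k w => (dM k w)^T).
Proof. by move=> H i j; apply: ispoly_ext (H j i) => *; rewrite mxE. Qed.

Lemma ispolymx_cst p q (M : 'M[R]_(p, q)) : ispolymx (fun=> M) (fun _ _ => 0).
Proof. by move=> i j; apply: ispoly_ext (ispoly_cst X (M i j)) => *; rewrite ?mxE. Qed.

Lemma ispolymx_ext p q (M M' : T -> 'M[R]_(p, q)) dM dM' : (forall w, M w = M' w) ->
  (forall r w, dM r w = dM' r w) -> ispolymx M' dM' -> ispolymx M dM.
Proof. by move=> h1 h2 H i j; apply: ispoly_ext (H i j) => *; rewrite ?h1 ?h2. Qed.

Lemma ispoly_trace p (M : T -> 'M[R]_p) dM : ispolymx M dM ->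
  isp (fun w => \tr (M w)) (fun r w => \tr (dM r w)).
Proof. by move=> H; exact: (ispoly_sum _ (fun i => H i i)). Qed.

Lemma ispolymx_rW : ispolymx rW (fun r _ => dW r).
Proof.
move=> i j; apply: ispoly_ext (ispolyZ c (ispoly_var X (inl (inl (i, j))))) => *;
by rewrite mxE.
Qed.

Lemma ispolymx_rv a : ispolymx (fun w => rv w a) (fun r _ => dv r a).
Proof.
by move=> i j; apply: ispoly_ext (ispoly_var X (vec_index a i)) => *; rewrite mxE.
Qed.

Lemma ispolymx_word u : ispolymx (fun w => wordmx (rW w) u)
  (fun r w => dword (rW w) false (dW r) u).
Proof.
elim: u => [|b u IH].
  apply: ispolymx_ext (ispolymx_cst 1%:M) => // r w.
  by rewrite /dword /= big_nil.
have Hb : ispolymx (fun w => letter (rW w) b)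
    (fun r _ => if b == false then dW r else (dW r)^T).
  by case: b; [exact: ispolymx_tr ispolymx_rW|exact: ispolymx_rW].
by apply: ispolymx_ext (ispolymxM Hb IH) => // r w; rewrite dword_cons.
Qed.

Definition datommx (r : I) (w : T) (q : option (A * A)) : 'M[R]_n :=
  if q is Some (a, b) then dv r b *m (rv w a)^T + rv w b *m (dv r a)^T else 0.

Lemma ispolymx_atommx q :
  ispolymx (fun w => atommx (rv w) q) (fun r w => datommx r w q).
Proof.
case: q => [[a b]|]; last exact: ispolymx_cst.
by apply: ispolymxM; [exact: ispolymx_rv|apply: ispolymx_tr; exact: ispolymx_rv].
Qed.

Local Notation aval x w := (atomv (rW w) (rv w) x).

Definition datom (x : atom A) (r : I) (w : T) : R :=
  n%:R^-1 * \tr (dword (rW w) false (dW r) x.1 *m atommx (rv w) x.2 +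
                 wordmx (rW w) x.1 *m datommx r w x.2).

Lemma ispoly_atom x : isp (fun w => aval x w) (datom x).
Proof.
apply: ispolyZ; apply: ispoly_trace; apply: ispolymxM.
  exact: ispolymx_word.
exact: ispolymx_atommx.
Qed.

Lemma dW_vec a i : dW (vec_index a i) = 0.
Proof.
apply/matrixP => k l; rewrite !mxE; case: a => a /=; by rewrite mulr0.
Qed.

Lemma dv_letter b i j a : dv (letter_index b i j) a = 0.
Proof. by apply/matrixP => k l; rewrite !mxE; case: a. Qed.

Lemma dW_letter b i j : dW (letter_index b i j) =
  c *: (if b then (delta_mx i j)^T else delta_mx i j).
Proof.
apply/matrixP => k l; rewrite /letter_index; case: b; rewrite ?trmx_delta !mxE;
congr (_ * _%:R); rewrite (inj_eq (@inl_inj _ _)) (inj_eq (@inl_inj _ _)) xpair_eqE.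
  by rewrite [k == _]eq_sym [l == _]eq_sym.
by rewrite [k == _]eq_sym [l == _]eq_sym.
Qed.

Lemma dwordZ (Wm D : 'M[R]_n) b a u : dword Wm b (a *: D) u = a *: dword Wm b D u.
Proof.
rewrite /dword scaler_sumr; apply: eq_bigr => s _.
have ZE (M N D' : 'M[R]_n) : M *m (a *: D') *m N = a *: (M *m D' *m N).
  by rewrite -scalemxAr -scalemxAl.
case: ifP => _; first exact: ZE.
have -> : (a *: D)^T = a *: D^T by apply/matrixP => i j; rewrite !mxE.
exact: ZE.
Qed.

Lemma dword_tr (Wm D : 'M[R]_n) b u : dword Wm b D^T u = dword Wm (~~ b) D u.
Proof.
rewrite /dword; apply: eq_bigr => s _; rewrite trmxK.
by case: (s.1.2); case: b.
Qed.

(** The parameter at place [(i, j)] of the letter [b] moves that letter along [E_ij]. For [b = true]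
    this rests on [dword_tr]: to move [W] along [E_ji] is to move its transpose along [E_ij]. *)
Lemma dword_letter (Wm : 'M[R]_n) b i j u :
  dword Wm false (dW (letter_index b i j)) u = c *: dword Wm b (delta_mx i j) u.
Proof. by rewrite dW_letter dwordZ; case: b; rewrite ?dword_tr. Qed.

Lemma datom_letter x b i j w : datom x (letter_index b i j) w =
  c * datomv (rW w) (rv w) b (delta_mx i j) x.
Proof.
rewrite /datom /datomv dword_letter.
have -> : datommx (letter_index b i j) w x.2 = 0.
  by case: x.2 => [[a a']|//]; rewrite /datommx !dv_letter trmx0 mul0mx mulmx0 addr0.
by rewrite mulmx0 addr0 -scalemxAl mxtraceZ mulrCA.
Qed.

(** Contraction of the vector [v_a] of the atom [n^-1 v_a^T v_b] with the vectors of [y]: each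
    occurrence of [v_a] in [y] is replaced in turn by [v_b]. *)
Definition crossV (a b : A) (y : atom A) : seq (nat * seq (atom A)) :=
  if y.2 is Some (a', b') then
    (if a == b' then [:: (0%N, [:: (y.1, Some (a', b))])] else [::]) ++
    (if a == a' then [:: (0%N, [:: (y.1, Some (b, b'))])] else [::])
  else [::].

Lemma vec_index_eq a b i k :
  (vec_index a i == vec_index b k) = (a == b) && (i == k).
Proof.
apply/eqP/andP => [|[/eqP-> /eqP->]//].
by case: a b => a [] b //= [-> ->].
Qed.

Lemma sum_dv w a b b' :
  \sum_i rv w b i 0 *: dv (vec_index a i) b' = (a == b')%:R *: rv w b.
Proof.
apply/matrixP => k l; rewrite summxE (bigD1 k)//= big1 => [|i ik].
  by rewrite !mxE vec_index_eq eqxx andbT addr0 mulrC.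
by rewrite !mxE vec_index_eq (negPf ik) andbF mulr0.
Qed.

Lemma cross_contractionV a b y w :
  \sum_i rv w b i 0 * datom y (vec_index a i) w =
  cval (rW w) (rv w) (crossV a b y).
Proof.
case: y => u q; rewrite /datom /=.
transitivity (n%:R^-1 * \tr (wordmx (rW w) u *m
    \sum_i rv w b i 0 *: datommx (vec_index a i) w q)).
  rewrite mulmx_sumr raddf_sum/= mulr_sumr; apply: eq_bigr => i _.
  have -> : dword (rW w) false (dW (vec_index a i)) u = 0.
    rewrite dW_vec /dword big1// => s _.
    by case: ifP => _; rewrite ?trmx0 mulmx0 mul0mx.
  by rewrite mul0mx add0r -scalemxAr mxtraceZ; ring.
case: q => [[a' b']|]; last first.
  by rewrite big1 ?mulmx0 ?mxtrace0 ?mulr0 ?/cval ?big_nil// => i _; rewrite scaler0.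
have -> : \sum_i rv w b i 0 *: datommx (vec_index a i) w (Some (a', b')) =
    (a == b')%:R *: (rv w b *m (rv w a')^T) + (a == a')%:R *: (rv w b' *m (rv w b)^T).
  under eq_bigr do rewrite scalerDr scalemxAl scalemxAr -linearZ/=.
  rewrite big_split/= -mulmx_suml -mulmx_sumr sum_dv -scalemxAl; congr (_ + _).
  by rewrite -linear_sum sum_dv linearZ/= scalemxAr.
rewrite mulmxDr mxtraceD mulrDr /cval /crossV big_cat/=.
rewrite -!scalemxAr !mxtraceZ; congr (_ + _).
  by case: (a == b'); rewrite ?big_nil ?big_seq1 /atomv/= ?big_seq1/=; ring.
by case: (a == a'); rewrite ?big_nil ?big_seq1 /atomv/= ?big_seq1/=; ring.
Qed.

Variables (nuW nuF nuC : R).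
Hypotheses (nuW0 : 0 < nuW) (nuF0 : 0 < nuF) (nuC0 : 0 < nuC).
Hypothesis gX : forall p, is_gaussian P (param_var nuW nuF nuC p) (X p).
Hypothesis indep : mutually_independent P X.

Definition nuv (a : A) : R := match a with inl _ => nuF | inr _ => nuC end.

Let nu0 (p : I) : 0 < param_var nuW nuF nuC p.
Proof. by case: p => [[]|]. Qed.

Local Notation E g := (Rintegral P setT g).

Let steinX p g dg (H : isp g dg) :
  E (fun w => X p w * g w) = param_var nuW nuF nuC p * E (dg p).
Proof. exact: (stein nu0 gX indep). Qed.

Let integrableX g dg (H : isp g dg) : P.-integrable setT (fun w => (g w)%:E).
Proof. exact: (ispoly_integrable nu0 gX indep H). Qed.

Definition nontrivial_atom (x : atom A) := (x.1 != [::]) || (x.2 != None).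

(** An atom with empty word is integrated by parts in its vector [v_a]. If [a = b], the [n]
    coordinates of [v_b] cancel the normalisation and the leading term is the empty product. *)
Definition leadx (x : atom A) : seq (nat * seq (atom A)) :=
  match x with
  | (b :: u, q) => lead b u q
  | ([::], Some (a, b)) => if a == b then [:: (0%N, [::])] else [::]
  | _ => [::]
  end.

Definition selfx (x : atom A) : seq (nat * seq (atom A)) :=
  if x is (b :: u, q) then self b u q else [::].

Definition crossx (x y : atom A) : seq (nat * seq (atom A)) :=
  match x with
  | (b :: u, q) => cross b u q y
  | ([::], Some (a, b)) => crossV a b y
  | _ => [::]
  end.

Definition nux (x : atom A) : R :=
  match x with
  | ([::], Some (a, _)) => nuv a
  | _ => nuW
  end.

Lemma expectation_contraction (J : Type) (s : seq J) (p : J -> I) (k : R)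
  (g : J -> T -> R) (dg : J -> I -> T -> R) :
  (forall j, param_var nuW nuF nuC (p j) = k) ->
  (forall j, isp (g j) (dg j)) ->
  E (fun w => \sum_(j <- s) X (p j) w * g j w) =
  k * E (fun w => \sum_(j <- s) dg j (p j) w).
Proof.
move=> pk H.
rewrite [LHS]Rintegral_sum; last first.
  by move=> j; exact: integrableX (ispolyM (ispoly_var X (p j)) (H j)).
rewrite [in RHS]Rintegral_sum; last first.
  by move=> j; have [dd Hd] := ispoly_deriv (p j) (H j); exact: integrableX Hd.
by rewrite mulr_sumr; apply: eq_bigr => j _; rewrite (steinX _ (H j)) pk.
Qed.

Variable flim : bool * atom A -> R.

Definition fprod (l : seq (bool * atom A)) (w : T) : R :=
  \prod_(f <- l) (aval f.2 w - flim f).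

Lemma ispoly_fprod l : isp (fprod l)
  (fun r w => \sum_(y <- picks l) datom y.1.2 r w * fprod y.2 w).
Proof.
elim: l => [|f l IH].
  by apply: ispoly_ext (ispoly_cst X 1) => *; rewrite ?big_nil// /fprod big_nil.
have Hf := ispolyD (ispoly_atom f.2) (ispoly_cst X (- flim f)).
apply: ispoly_ext (ispolyM Hf IH) => [w|r w]; first by rewrite /fprod big_cons.
rewrite /= big_cons addr0 big_map mulr_sumr; congr (_ + _).
by apply: eq_bigr => y _; rewrite [X in _ * X = _]/fprod big_cons mulrCA.
Qed.

(** Integration by parts in all entries of the first letter, or of the first vector if the word is
    empty. The derivative falls on the rest of the atom, which gives [leadx] and [selfx], or on a
    factor of [fprod l], which gives [crossx] and [n^-1]. The atom [n^-1 tr 1] contains no variable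
    to integrate and is excluded. *)
Lemma loop_equation x l : nontrivial_atom x ->
  E (fun w => aval x w * fprod l w) =
  nux x * E (fun w =>
    (cval (rW w) (rv w) (leadx x) + cval (rW w) (rv w) (selfx x)) * fprod l w +
    n%:R^-1 * \sum_(y <- picks l)
      cval (rW w) (rv w) (crossx x y.1.2) * fprod y.2 w).
Proof.
case: x => -[|b u] q; last first.
  move=> _ /=.
  pose s := enum {: 'I_n * 'I_n}.
  (* The cofactor of the parameter at place [(i, j)] of the first letter, hence the entry [(j, i)]
     of the rest. The factor [c] is the scaling of that letter; a second [c], from the letter that
     is differentiated, completes [n^-1]. *)
  pose m ij w := n%:R^-1 * c * (wordmx (rW w) u *m atommx (rv w) q) ij.2 ij.1.
  pose dm ij r w := n%:R^-1 * c * (dword (rW w) false (dW r) u *m atommx (rv w) q +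
                 wordmx (rW w) u *m datommx r w q) ij.2 ij.1.
  have Hm (ij : 'I_n * 'I_n) : isp (m ij) (dm ij).
    exact: ispolyZ (ispolymxM (ispolymx_word u) (ispolymx_atommx q) _ _).
  have Hg ij := ispolyM (Hm ij) (ispoly_fprod l).
  transitivity (E (fun w => \sum_(ij <- s) X (letter_index b ij.1 ij.2) w *
      (m ij w * fprod l w))).
    apply: eq_Rintegral => w _; rewrite big_enum/= -(pair_bigA _ (fun i j =>
      X (letter_index b i j) w * (m (i, j) w * fprod l w)))/=.
    rewrite /atomv/= -mulmxA /mxtrace mulr_sumr mulr_suml.
    apply: eq_bigr => i _; rewrite mxE mulr_sumr mulr_suml; apply: eq_bigr => j _.
    have -> : letter (rW w) b i j = c * X (letter_index b i j) w.
      by rewrite /letter_index; case: b {Hm}; rewrite !mxE.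
    by rewrite /m/=; ring.
  rewrite (expectation_contraction (k := nuW) s _ Hg)//; congr (_ * _).
  apply: eq_Rintegral => w _.
  rewrite big_enum/= -(pair_bigA _ (fun i j => dm (i, j) (letter_index b i j) w * fprod l w +
     m (i, j) w * \sum_(y <- picks l) datom y.1.2 (letter_index b i j) w * fprod y.2 w))/=.
  under eq_bigr do rewrite big_split/=.
  rewrite big_split/=; congr (_ + _).
    rewrite -self_contraction expr2 -{2}cc !mulr_sumr mulr_suml; apply: eq_bigr => i _.
    rewrite !mulr_sumr mulr_suml; apply: eq_bigr => j _; congr (_ * _).
    rewrite /dm/= dword_letter.
    have -> : datommx (letter_index b i j) w q = 0.
      by case: q {m dm Hm Hg} => [[a a']|//]; rewrite /datommx !dv_letter trmx0 mul0mx mulmx0 addr0.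
    by rewrite mulmx0 addr0 -scalemxAl mxE; ring.
  transitivity (n%:R^-1 * \sum_(y <- picks l) (n%:R^-1 * (\sum_i \sum_j
     (wordmx (rW w) u *m atommx (rv w) q) j i *
     datomv (rW w) (rv w) b (delta_mx i j) y.1.2)) * fprod y.2 w).
    rewrite -{2}cc.
    under eq_bigr do under eq_bigr do rewrite mulr_sumr.
    under eq_bigr do rewrite exchange_big/=.
    rewrite exchange_big/= mulr_sumr; apply: eq_bigr => y _.
    rewrite !mulr_sumr mulr_suml mulr_sumr; apply: eq_bigr => i _.
    rewrite !mulr_sumr mulr_suml mulr_sumr; apply: eq_bigr => j _.
    by rewrite datom_letter /m/=; ring.
  congr (_ * _); apply: eq_bigr => y _; congr (_ * _).
  exact: cross_contraction.
case: q => [[a b]|//] _ /=.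
pose s := enum 'I_n.
pose m i w := n%:R^-1 * rv w b i 0.
have Hm i : isp (m i) (fun r w => n%:R^-1 * dv r b i 0).
  exact: ispolyZ (ispolymx_rv b i 0).
have Hg i := ispolyM (Hm i) (ispoly_fprod l).
transitivity (E (fun w => \sum_(i <- s) X (vec_index a i) w * (m i w * fprod l w))).
  apply: eq_Rintegral => w _; rewrite big_enum/= /atomv/= mul1mx.
  rewrite /mxtrace mulr_sumr mulr_suml; apply: eq_bigr => i _.
  by rewrite mxE big_ord1 !mxE /m mxE; ring.
rewrite (expectation_contraction (k := nuv a) s _ Hg); last by case: a {Hg}.
congr (_ * _); apply: eq_Rintegral => w _.
rewrite big_enum/= big_split/=; congr (_ + _).
  rewrite -mulr_suml; congr (_ * _).
  rewrite /cval big_nil addr0 -mulr_sumr.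
  under eq_bigr do rewrite mxE vec_index_eq.
  case: (a == b) => /=; last by rewrite big1 ?big_nil ?mulr0//.
  under eq_bigr do rewrite eqxx.
  rewrite big_seq1/= big_nil expr0 mulr1 sumr_const card_ord mulVf//.
transitivity (n%:R^-1 * \sum_(y <- picks l) (\sum_i rv w b i 0 * datom y.1.2 (vec_index a i) w) * fprod y.2 w).
  under eq_bigr do rewrite mulr_sumr.
  rewrite exchange_big/= mulr_sumr; apply: eq_bigr => y _.
  rewrite mulr_suml mulr_sumr; apply: eq_bigr => i _.
  by rewrite /m; ring.
congr (_ * _); apply: eq_bigr => y _; congr (_ * _).
exact: cross_contractionV.
Qed.

End random_words.

(** * Bounds on products of centred atoms, uniform in the width *)

Section uniform_bounds.
Context d (T : measurableType d) (R : realType) (P : probability T R).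
Variables (nx ny : nat) (nuW nuF nuC : R).
Hypotheses (nuW0 : 0 < nuW) (nuF0 : 0 < nuF) (nuC0 : 0 < nuC).
Variable X : forall n, param_index n nx ny -> T -> R.
Hypothesis gX : forall n, (0 < n)%N ->
  forall p : param_index n nx ny, is_gaussian P (param_var nuW nuF nuC p) (X p).
Hypothesis indep : forall n, (0 < n)%N -> mutually_independent P (@X n).
Local Notation A := ('I_nx + 'I_ny)%type.
Local Notation E g := (Rintegral P setT g).
Local Notation aval n x w := (atomv (rW (@X n) w) (rv (@X n) w) x).
Local Notation cv n k w := (cval (rW (@X n) w) (rv (@X n) w) k).

Let nu0 n (p : param_index n nx ny) : 0 < param_var nuW nuF nuC p.
Proof. by case: p => [[]|]. Qed.

Lemma intX n g dg : (0 < n)%N -> ispoly (@X n) g dg ->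
  P.-integrable setT (fun w => (g w)%:E).
Proof. by move=> n0; exact: (ispoly_integrable (@nu0 n) (gX n0) (indep n0)). Qed.

(** Vectors enter the limit only through their variance, and distinct vectors are asymptotically
    orthogonal. *)
Definition alim (x : atom A) : R := tlim nuW x.1 *
  (if x.2 is Some (a, b) then (a == b)%:R * nuv nuF nuC a else 1).

Definition flim (f : bool * atom A) : R := f.1%:R * alim f.2.

Definition fp n l w := fprod (@X n) flim l w.

(** Polynomiality is bundled with the bound because it provides the integrability under which
    expectations are added. *)
Definition bounded_order (e : nat) (G : forall n : nat, T -> R) :=
  (forall n, (0 < n)%N -> exists dg, ispoly (@X n) (G n) dg) /\
  exists2 K : R, 0 <= K & forall n, (0 < n)%N -> `|E (G n)| <= K * n%:R^-1 ^+ e.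

Lemma bounded_order_ext e G G' : (forall n w, (0 < n)%N -> G n w = G' n w) ->
  bounded_order e G -> bounded_order e G'.
Proof.
move=> GG [pG [K K0 bG]]; split.
  move=> n n0; have [dg Hg] := pG n n0; exists dg.
  by apply: ispoly_ext Hg => // w; rewrite GG.
exists K => // n n0; rewrite -(_ : E (G n) = E (G' n)) ?bG//.
by apply: eq_Rintegral => w _; rewrite GG.
Qed.

Lemma bounded_order0 e : bounded_order e (fun _ _ => 0).
Proof.
split; first by move=> n _; eexists; exact: (ispoly_cst _ 0).
by exists 0 => // n n0; rewrite Rintegral_cst// !mul0r normr0.
Qed.

Lemma bounded_orderD e G H : bounded_order e G -> bounded_order e H ->
  bounded_order e (fun n w => G n w + H n w).
Proof.
move=> [pG [K K0 bG]] [pH [L L0 bH]]; split.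
  move=> n n0; have [dg Hg] := pG n n0; have [dh Hh] := pH n n0.
  by eexists; exact: ispolyD Hg Hh.
exists (K + L) => [|n n0]; first exact: addr_ge0.
have [dg Hg] := pG n n0; have [dh Hh] := pH n n0.
rewrite RintegralD//; [|exact: intX Hg|exact: intX Hh].
by rewrite mulrDl (le_trans (ler_normD _ _))// lerD ?bG ?bH.
Qed.

Lemma bounded_orderZ e a G : bounded_order e G ->
  bounded_order e (fun n w => a * G n w).
Proof.
move=> [pG [K K0 bG]]; split.
  by move=> n n0; have [dg Hg] := pG n n0; eexists; exact: ispolyZ Hg.
exists (`|a| * K) => [|n n0]; first exact: mulr_ge0.
have [dg Hg] := pG n n0; rewrite RintegralZl//; last exact: intX Hg.
by rewrite normrM -mulrA ler_wpM2l// bG.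
Qed.

Lemma bounded_orderV e k G : bounded_order e G ->
  bounded_order (k + e) (fun n w => n%:R^-1 ^+ k * G n w).
Proof.
move=> [pG [K K0 bG]]; split.
  by move=> n n0; have [dg Hg] := pG n n0; eexists; exact: ispolyZ Hg.
exists K => // n n0.
have [dg Hg] := pG n n0; rewrite RintegralZl//; last exact: intX Hg.
rewrite normrM ger0_norm ?exprn_ge0 ?invr_ge0//.
by rewrite exprD mulrCA ler_wpM2l ?bG// exprn_ge0 ?invr_ge0.
Qed.

Lemma bounded_order_le e e' G : (e <= e')%N -> bounded_order e' G -> bounded_order e G.
Proof.
move=> ee [pG [K K0 bG]]; split=> //; exists K => // n n0.
rewrite (le_trans (bG n n0))// ler_wpM2l// ler_wiXn2l// ?invr_ge0//.
by rewrite invf_le1 ?ltr0n// ler1n.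
Qed.

Lemma bounded_order_sum e (J : eqType) (s : seq J) (G : J -> forall n : nat, T -> R) :
  (forall j, j \in s -> bounded_order e (G j)) ->
  bounded_order e (fun n w => \sum_(j <- s) G j n w).
Proof.
elim: s => [|j s IH] H.
  by apply: bounded_order_ext (bounded_order0 e) => n w _; rewrite big_nil.
apply: bounded_order_ext (bounded_orderD (H j (mem_head _ _)) (IH _)).
  by move=> n w _; rewrite big_cons.
by move=> i si; apply: H; rewrite inE si orbT.
Qed.

Definition qdeg (q : option (A * A)) : nat := if q is Some _ then 2 else 0.
Definition deg (x : atom A) := (size x.1 + qdeg x.2)%N.
(* An uncentred factor weighs one more than a centred one, so that splitting it into its
   centred part and its limit decreases the measure. *)
Definition fmeas (f : bool * atom A) := (2 * deg f.2 + 1 + ~~ f.1)%N.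
Definition meas l := (\sum_(f <- l) fmeas f)%N.
Definition cen (l : seq (bool * atom A)) := count (fun f => f.1) l.
Definition ups (ys : seq (atom A)) : seq (bool * atom A) := [seq (false, y) | y <- ys].
Definition degs (ys : seq (atom A)) := (\sum_(y <- ys) (2 * deg y + 2))%N.

Lemma meas_ups ys : meas (ups ys) = degs ys.
Proof. by rewrite /meas big_map; apply: eq_bigr => y _; rewrite /fmeas /=; lia. Qed.

Lemma cen_ups ys : cen (ups ys) = 0%N.
Proof. by rewrite /cen count_map; elim: ys. Qed.

Lemma cen_cat l l' : cen (l ++ l') = (cen l + cen l')%N.
Proof. exact: count_cat. Qed.

Lemma meas_cat l l' : meas (l ++ l') = (meas l + meas l')%N.
Proof. exact: big_cat. Qed.

Lemma fp_ups n ys l w : fp n (ups ys ++ l) w = \prod_(y <- ys) aval n y w * fp n l w.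
Proof.
rewrite /fp /fprod big_cat big_map; congr (_ * _).
by apply: eq_bigr => y _; rewrite /flim mul0r subr0.
Qed.

(** When the atoms are replaced by their limits one after the other, each replacement leaves a
    product with one more centred factor, hence the exponent for [(cen l).+1]. The first hypothesis
    is the induction hypothesis of [fprod_bound], available below the measure [N]. *)
Lemma telescope e l ys N :
  (forall l', (meas l' < N)%N -> bounded_order (uphalf (cen l')) (fun n w => fp n l' w)) ->
  e = uphalf (cen l).+1 -> (degs ys + meas l <= N)%N ->
  bounded_order e (fun n w =>
    (\prod_(y <- ys) aval n y w - \prod_(y <- ys) alim y) * fp n l w).
Proof.
move=> H ->; elim: ys => [|y ys IH] dN.
  by apply: bounded_order_ext (bounded_order0 _) => n w _; rewrite !big_nil; ring.
have dE : degs (y :: ys) = (2 * deg y + 2 + degs ys)%N by rewrite /degs big_cons.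
have m1 : (meas ((true, y) :: ups ys ++ l) < N)%N.
  by rewrite /meas big_cons -/(meas _) meas_cat meas_ups /fmeas /=; lia.
have m2 : (degs ys + meas l <= N)%N by lia.
have b1 := H _ m1.
have cE : cen ((true, y) :: ups ys ++ l) = (cen l).+1.
  by rewrite -cat1s !cen_cat cen_ups.
rewrite cE in b1.
apply: bounded_order_ext (bounded_orderD b1 (bounded_orderZ (alim y) (IH m2))).
move=> n w _; have -> : fp n ((true, y) :: ups ys ++ l) w =
    (aval n y w - alim y) * (\prod_(y <- ys) aval n y w * fp n l w).
  by rewrite -fp_ups /fp /fprod big_cons /flim /= mul1r.
by rewrite !big_cons; ring.
Qed.

Lemma lead_exp (x : atom A) k : k \in leadx x -> k.1 = 0%N.
Proof.
case: x => -[|b u] [[a a']|] //=.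
- by case: ifP => // _; rewrite inE => /eqP ->.
- by move=> /mapP[s _ ->].
- by move=> /mapP[s _ ->].
Qed.

Lemma degE u (q : option (A * A)) : deg (u, q) = (size u + qdeg q)%N. Proof. by []. Qed.

(** The reason for doubling degrees in the measure: contracting a letter removes two letters but may
    create two uncentred atoms. At [2 deg + 2] each, two atoms of total degree [deg x - 2] weigh
    [2 deg x], just below the weight [2 deg x + 1] of the centred [x]. *)
Lemma lead_deg (x : atom A) k : k \in leadx x -> (degs k.2 < 2 * deg x + 1)%N.
Proof.
case: x => -[|b u] q.
  by case: q => [[a a']|] //=; case: ifP => // _; rewrite inE => /eqP -> /=; rewrite /degs big_nil.
move=> /mapP[s]; rewrite mem_filter => /andP[_ /size_splits su] ->.
rewrite /degs big_cons big_seq1 !degE; move: (qdeg q) => m.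
rewrite /deg /= in su *; rewrite /= ; lia.
Qed.

Lemma self_deg (x : atom A) k : k \in selfx x ->
  (k.1 = 1%N) /\ (degs k.2 < 2 * deg x + 1)%N.
Proof.
case: x => -[|b u] q //= /mapP[[[u1 b1] u2]].
rewrite mem_filter => /andP[_ /size_splits /= su] ->.
split=> //; rewrite /degs big_seq1 !degE; move: (qdeg q) => m.
rewrite /= size_cat size_tword; lia.
Qed.

Lemma cross_deg (x y : atom A) k : k \in crossx x y ->
  (degs k.2 < 2 * deg x + 1 + (2 * deg y + 1))%N.
Proof.
case: x => -[|b u] q.
  case: q => [[a a']|] //=; rewrite /crossV; case: y => u [[a1 a2]|] //=.
  rewrite mem_cat => /orP[]; case: ifP => // _; rewrite inE => /eqP -> /=;
  by rewrite /degs big_seq1 /deg /=; lia.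
case: y => v q' /mapP[[[u1 b1] u2] /size_splits /= su] ->; rewrite /cross1 /deg /degs.
case: q => [[a1 a2]|]; case: q' => [[a3 a4]|]; case: ifP => _ /=;
  rewrite ?big_cons ?big_nil /deg /= ?size_cat ?size_tword; lia.
Qed.

(** With [m = cen l], the target for [(true, x) :: l] is the exponent [ceil ((m + 1) / 2)]. In the
    loop equation the leading part minus its limit has a centred factor in the place of [x]; [selfx]
    keeps the [m] centred factors and brings [n^-1]; [crossx] consumes at most one of them and
    brings [n^-1], and [1 + ceil ((m - 1) / 2)] is exactly the target. *)
Lemma fprod_bound l : bounded_order (uphalf (cen l)) (fun n w => fp n l w).
Proof.
have [N] := ubnP (meas l); elim: N l => [//|N IH] l lN.
have {}IH l' : (meas l' < meas l)%N -> bounded_order (uphalf (cen l')) (fun n w => fp n l' w).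
  by move=> h; apply: IH; apply: leq_trans h _; rewrite -ltnS.
clear N lN.
case: l IH => [|[c x] l] IH.
  split; first by move=> n _; eexists; exact: ispoly_fprod.
  exists 1 => // n n0; rewrite mul1r expr0.
  rewrite (_ : E _ = 1) ?normr1//.
  under eq_Rintegral do rewrite /fp /fprod big_nil.
  by rewrite Rintegral_probability_cst.
have mE : meas ((c, x) :: l) = (fmeas (c, x) + meas l)%N by rewrite /meas big_cons.
case: c mE IH => mE IH; last first.
  have m1 : (meas ((true, x) :: l) < meas ((false, x) :: l))%N.
    by rewrite mE /meas big_cons /fmeas /=; lia.
  have m2 : (meas l < meas ((false, x) :: l))%N by rewrite mE /fmeas /=; lia.
  have b1 := bounded_order_le _ (IH _ m1).
  have b2 := bounded_orderZ (alim x) (IH _ m2).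
  apply: bounded_order_ext (bounded_orderD (b1 (uphalf (cen l)) _) b2).
    by move=> n w _; rewrite /fp /fprod !big_cons /flim /= mul1r mul0r subr0; ring.
  by rewrite /cen; apply: uphalf_leq => /=; lia.
have [nt|] := boolP (nontrivial_atom x); last first.
  (* The trivial atom equals its limit [1], so its centred factor vanishes. *)
  case: x {mE IH} => -[|b u] [[a a']|]//= _.
  apply: bounded_order_ext (bounded_order0 _) => n w n0.
  rewrite /fp /fprod big_cons /flim /atomv /alim /= mulmx1 mxtrace1.
  by rewrite mulVf ?mul1r ?subrr ?mul0r// pnatr_eq0 -lt0n.
(* The limits solve the leading part of the loop equation exactly; after subtraction only the
   differences collected in [H1] remain of it. *)
have limE : alim x = nux nuW nuF nuC x * \sum_(k <- leadx x) \prod_(y <- k.2) alim y.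
  case: x {mE IH} nt => -[|b u] q; last first.
    move=> _; rewrite {1}/alim /= tlim_cons /lead big_map big_filter -mulrA; congr (_ * _).
    rewrite mulr_suml; apply: eq_bigr => s _.
    by rewrite big_cons big_seq1 /alim /= mulr1 mulrA.
  case: q => [[a a']|]//= _; rewrite /alim /= /tlim /= mul1r mulrC.
  by case: eqP => [->|_]; rewrite ?big_seq1 ?big_nil.
have mx : fmeas (true, x) = (2 * deg x + 1)%N by rewrite /fmeas /= addn0.
have eE : uphalf (cen ((true, x) :: l)) = uphalf (cen l).+1 by [].
rewrite eE; set e := uphalf _.
pose H1 n w := \sum_(k <- leadx x)
  (\prod_(y <- k.2) aval n y w - \prod_(y <- k.2) alim y) * fp n l w.
pose H2 n w := \sum_(k <- selfx x) fp n (ups k.2 ++ l) w * n%:R^-1 ^+ k.1.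
pose H3 n w := \sum_(y <- picks l) \sum_(k <- crossx x y.1.2)
  n%:R^-1 ^+ k.1.+1 * fp n (ups k.2 ++ y.2) w.
have b1 : bounded_order e H1.
  apply: bounded_order_sum => k kl; apply: telescope IH _ _ => //.
  by rewrite mE mx leq_add2r ltnW// lead_deg.
have b2 : bounded_order e H2.
  apply: bounded_order_sum => k ks; have [k1 kd] := self_deg ks.
  have m1 : (meas (ups k.2 ++ l) < meas ((true, x) :: l))%N.
    by rewrite meas_cat meas_ups mE mx ltn_add2r.
  have := bounded_orderV k.1 (IH _ m1); rewrite cen_cat cen_ups add0n k1 => h.
  have ee : (e <= 1 + uphalf (cen l))%N by rewrite /e /=; lia.
  apply: bounded_order_ext (bounded_order_le ee h) => n w _.
  exact: mulrC.
have b3 : bounded_order e H3.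
  apply: bounded_order_sum => y yl; apply: bounded_order_sum => k ks.
  have pl := perm_picks yl.
  have ml : meas l = (fmeas y.1 + meas y.2)%N by rewrite /meas (perm_big _ pl) big_cons.
  have cl : cen l = (y.1.1 + cen y.2)%N by rewrite /cen (permP pl).
  have kd := cross_deg ks.
  have m1 : (meas (ups k.2 ++ y.2) < meas ((true, x) :: l))%N.
    rewrite meas_cat meas_ups mE mx ml addnA ltn_add2r; apply: leq_trans kd _.
    by rewrite leq_add2l /fmeas leq_addr.
  have := bounded_orderV k.1.+1 (IH _ m1); rewrite cen_cat cen_ups add0n.
  apply: bounded_order_le.
  by rewrite /e cl; case: y.1.1 => /=; lia.
have [pH [K K0 bH]] := bounded_orderZ (nux nuW nuF nuC x) (bounded_orderD b1 (bounded_orderD b2 b3)).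
split; first by move=> n _; eexists; exact: ispoly_fprod.
exists K => // n n0; apply: le_trans (bH n n0).
rewrite le_eqVlt; apply/orP; left; apply/eqP; congr (`|_|).
have Hl := ispoly_fprod (@X n) flim l.
transitivity (E (fun w => aval n x w * fp n l w) - alim x * E (fun w => fp n l w)).
  rewrite -RintegralZl//; last exact: intX Hl.
  rewrite -RintegralB//; last 2 first.
  - exact: intX (ispolyM (ispoly_atom (@X n) x) Hl).
  - exact: intX (ispolyZ _ Hl).
  by apply: eq_Rintegral => w _; rewrite /fp /fprod big_cons /flim /= mul1r mulrBl.
rewrite (loop_equation n0 nuW0 nuF0 nuC0 (gX n0) (indep n0) flim l nt) limE -mulrA -mulrBr.
have pR : exists dR, ispoly (@X n) (fun w =>
    (cv n (leadx x) w + cv n (selfx x) w) * fprod (@X n) flim l w +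
    n%:R^-1 * \sum_(y <- picks l) cv n (crossx x y.1.2) w * fprod (@X n) flim y.2 w) dR.
  have cvP s : exists ds, ispoly (@X n) (fun w => cv n s w) ds.
    have prP (ys : seq (atom A)) : exists dp, ispoly (@X n) (fun w => \prod_(y <- ys) aval n y w) dp.
      elim: ys => [|y ys [dp Hp]].
        by eexists; apply: ispoly_ext (ispoly_cst _ 1) => *; rewrite ?big_nil.
      by eexists; apply: ispoly_ext (ispolyM (ispoly_atom _ y) Hp) => *; rewrite ?big_cons.
    have /choice[dp dpP] := fun k : nat * seq (atom A) => prP k.2.
    by eexists; exact: (ispoly_sum s (fun k => ispolyZ _ (dpP k))).
  have [d1 P1] := cvP (leadx x); have [d2 P2] := cvP (selfx x).
  have /choice[d3 P3] := fun y : (bool * atom A) * seq (bool * atom A) => cvP (crossx x y.1.2).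
  eexists; apply: ispolyD; first exact: ispolyM (ispolyD P1 P2) Hl.
  by apply: ispolyZ; exact: (ispoly_sum _ (fun y => ispolyM (P3 y) (ispoly_fprod _ _ _))).
have [dR HR] := pR.
have [pH' _] := bounded_orderD b1 (bounded_orderD b2 b3).
have [dH HH] := pH' n n0.
rewrite [RHS]RintegralZl//; last exact: intX HH.
congr (_ * _); rewrite -RintegralZl//; last exact: intX Hl.
rewrite -RintegralB//; [|exact: intX HR|exact: intX (ispolyZ _ Hl)].
apply: eq_Rintegral => w _; rewrite -/(fp n l w).
have -> : cv n (leadx x) w = \sum_(k <- leadx x) \prod_(y <- k.2) aval n y w.
  rewrite /cval big_seq [RHS]big_seq; apply: eq_bigr => k kl.
  by rewrite (lead_exp kl) expr0 mul1r.
have -> : H1 n w = (\sum_(k <- leadx x) \prod_(y <- k.2) aval n y w -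
    \sum_(k <- leadx x) \prod_(y <- k.2) alim y) * fp n l w.
  by rewrite /H1 -sumrB mulr_suml.
have -> : H2 n w = cv n (selfx x) w * fp n l w.
  rewrite /H2 /cval mulr_suml; apply: eq_bigr => k _.
  by rewrite fp_ups mulrC mulrA.
have -> : H3 n w = n%:R^-1 * \sum_(y <- picks l) cv n (crossx x y.1.2) w * fp n y.2 w.
  rewrite /H3 mulr_sumr; apply: eq_bigr => y _.
  rewrite /cval mulr_suml mulr_sumr; apply: eq_bigr => k _.
  by rewrite fp_ups exprS -!mulrA.
rewrite -/(fp n _ _); ring.
Qed.

End uniform_bounds.

(** * Derivatives of the network in its parameters *)

Section ntk_formula.
Context (R : realType) (n nx ny T : nat).
Local Notation A := ('I_nx + 'I_ny)%type.
Local Notation I := (param_index n nx ny).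
Let c : R := (Num.sqrt n%:R)^-1.

Let cc : c * c = n%:R^-1.
Proof. by rewrite -invfM -expr2 sqr_sqrtr ?ler0n. Qed.

Definition ismxderive p q (M : R -> 'M[R]_(p, q)) (dM : 'M[R]_(p, q)) (r : R) :=
  forall i j, is_derive r (1:R) (fun v => M v i j) (dM i j).

Lemma ismxderiveD p q (M N : R -> 'M[R]_(p, q)) dM dN r :
  ismxderive M dM r -> ismxderive N dN r ->
  ismxderive (fun v => M v + N v) (dM + dN) r.
Proof.
move=> HM HN i j; rewrite mxE.
rewrite (_ : (fun v => _) = (fun v => M v i j) + (fun v => N v i j)); last first.
  by apply/funext => v; rewrite mxE.
exact: is_deriveD.
Qed.

Lemma ismxderiveM p q k (M : R -> 'M[R]_(p, q)) (N : R -> 'M[R]_(q, k)) dM dN r :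
  ismxderive M dM r -> ismxderive N dN r ->
  ismxderive (fun v => M v *m N v) (dM *m N r + M r *m dN) r.
Proof.
move=> HM HN i j.
rewrite (_ : (fun v => _) = \sum_l ((fun v => M v i l) * (fun v => N v l j))); last first.
  by apply/funext => v; rewrite mxE fct_sumE.
have H l := @is_deriveM _ _ (fun v => M v i l) (fun v => N v l j) r 1 _ _ (HM i l) (HN l j).
apply: (is_derive_eq (is_derive_sum H)).
rewrite !mxE -big_split/=; apply: eq_bigr => l _.
by rewrite /GRing.scale/= addrC [N r l j * _]mulrC.
Qed.

Lemma ismxderive_cst p q (M : 'M[R]_(p, q)) r : ismxderive (fun=> M) 0 r.
Proof. by move=> i j; rewrite mxE; exact: is_derive_cst. Qed.

Lemma ismxderiveZ p q (M : R -> 'M[R]_(p, q)) dM r a :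
  ismxderive M dM r -> ismxderive (fun v => a *: M v) (a *: dM) r.
Proof.
move=> HM i j; rewrite mxE.
rewrite (_ : (fun v => _) = a \*: (fun v => M v i j)); last first.
  by apply/funext => v; rewrite mxE.
exact: (@is_deriveZ _ _ _ (fun v => M v i j) a r 1 _ (HM i j)).
Qed.

Definition dlt (p : I) : I -> R := fun q => (q == p)%:R.

Lemma is_derive_upd (th : I -> R) p q :
  is_derive (th p) (1:R) (fun v => upd th p v q) (dlt p q).
Proof.
rewrite /upd /dlt; case: eqP => _; [exact: is_derive_id|exact: is_derive_cst].
Qed.

Variables (W : 'M[R]_n) (F : 'M[R]_(n, nx)) (C : 'M[R]_(ny, n)).
Let th := params_of W F C.
Let Wt := c *: W.
Definition colv (a : A) : 'cV[R]_n := match a with inl i => col i F | inr k => (row k C)^T end.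

Let W_th : W_of th = W. Proof. by apply/matrixP => i j; rewrite mxE. Qed.
Let F_th : F_of th = F. Proof. by apply/matrixP => i j; rewrite mxE. Qed.
Let C_th : C_of th = C. Proof. by apply/matrixP => i j; rewrite mxE. Qed.
Let upd_th p : upd th p (th p) = th.
Proof. by apply/funext => q; rewrite /upd; case: eqP => [->|]. Qed.

Local Notation pw j := (wordmx Wt (nseq j false)).

(** Variation of constants. It is applied to the hidden state, driven by the input, and to its
    derivative in a parameter, driven by [gdrive]. *)
Lemma unroll q (u : nat -> 'M[R]_(n, q)) (g : nat -> 'M[R]_(n, q)) :
  u 0%N = 0 -> (forall t, u t.+1 = Wt *m u t + g t) ->
  forall t, u t = \sum_(j < t) pw j *m g (t - j.+1)%N.
Proof.
move=> u0 uS; elim=> [|t IH]; first by rewrite u0 big_ord0.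
rewrite uS IH big_ord_recl /= mul1mx subn1 addrC; congr (_ + _).
by rewrite mulmx_sumr; apply: eq_bigr => j _; rewrite mulmxA.
Qed.

Variables (x : 'I_T -> 'cV[R]_nx).
Local Notation hs t := (hidden_state W F x t).

Lemma hidden_unroll t : hs t = \sum_(j < t) pw j *m (F *m ext_seq x (t - j.+1)).
Proof. by apply: (unroll (g := fun t => F *m ext_seq x t)) => // s; rewrite /Wt -scalemxAl. Qed.

(** Differentiating the state recursion in [p] gives the same recursion for the derivative, with
    this forcing term. *)
Definition gdrive p t := c *: (W_of (dlt p) *m hs t) + F_of (dlt p) *m ext_seq x t.

Fixpoint dhid p t : 'cV[R]_n :=
  if t is t'.+1 then Wt *m dhid p t' + gdrive p t' else 0.

Lemma is_derive_hidden p t : ismxderive (fun v =>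
  hidden_state (W_of (upd th p v)) (F_of (upd th p v)) x t) (dhid p t) (th p).
Proof.
elim: t => [|t IH]; first exact: ismxderive_cst.
have HW : ismxderive (fun v => W_of (upd th p v)) (W_of (dlt p)) (th p).
  move=> i j; rewrite mxE (_ : (fun v => _) = (fun v => upd th p v (inl (inl (i, j))))).
    exact: is_derive_upd.
  by apply/funext => v; rewrite mxE.
have HF : ismxderive (fun v => F_of (upd th p v)) (F_of (dlt p)) (th p).
  move=> i j; rewrite mxE (_ : (fun v => _) = (fun v => upd th p v (inl (inr (i, j))))).
    exact: is_derive_upd.
  by apply/funext => v; rewrite mxE.
have := ismxderiveD (ismxderiveZ c (ismxderiveM HW IH))
  (ismxderiveM HF (ismxderive_cst (ext_seq x t) (th p))).
rewrite upd_th W_th F_th mulmx0 addr0 => H.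
have -> : dhid p t.+1 = c *: (W_of (dlt p) *m hs t + W *m dhid p t) +
    F_of (dlt p) *m ext_seq x t; last exact: H.
by rewrite /= /gdrive /Wt scalerDr -scalemxAl addrA [_ + c *: (_ *m hs t)]addrC.
Qed.

Lemma dmodelE t k p : dmodel x th (t, k) p =
  c * (C_of (dlt p) *m hs t.+1) k 0 +
  c * \sum_(j < t.+1) ((colv (inr k))^T *m pw j *m gdrive p (t - j)) 0 0.
Proof.
have HC : ismxderive (fun v => C_of (upd th p v)) (C_of (dlt p)) (th p).
  move=> i j; rewrite mxE (_ : (fun v => _) = (fun v => upd th p v (inr (i, j)))).
    exact: is_derive_upd.
  by apply/funext => v; rewrite mxE.
have H := ismxderiveZ c (ismxderiveM HC (is_derive_hidden p t.+1)).
have Hk := H k ord0.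
rewrite /dmodel derive1E /model /rnn_output [LHS](@derive_val _ _ _ _ _ _ _ Hk).
rewrite upd_th C_th W_th F_th mxE mxE mulrDr; congr (_ + c * _).
have -> : dhid p t.+1 = \sum_(j < t.+1) pw j *m gdrive p (t.+1 - j.+1)%N.
  exact: (unroll (u := dhid p) (g := gdrive p)).
rewrite mulmx_sumr summxE; apply: eq_bigr => j _; rewrite subSS.
have -> : (colv (inr k))^T = row k C by rewrite /colv trmxK.
by rewrite mulmxA !mxE; apply: eq_bigr => i _; rewrite -row_mul !mxE.
Qed.

End ntk_formula.

(** * The kernel as a polynomial in the atoms *)

Section ntk_expression.
Context (R : realType) (nx ny T : nat).
Local Notation A := ('I_nx + 'I_ny)%type.

(** With [W] scaled, [Aatom] is the inner product of vectors [(W^T)^j c_k] carried back from the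
    outputs, and [Hatom] that of vectors [W^b f_a] carried forward from the inputs. *)
Definition Aatom j j' (k l : 'I_ny) : atom A :=
  (nseq j false ++ nseq j' true, Some (inr k, inr l)).
Definition Hatom b b' (a a' : 'I_nx) : atom A :=
  (nseq b true ++ nseq b' false, Some (inl a, inl a')).

Definition inner (u v : 'cV[R]_nx) : R := \sum_a u a 0 * v a 0.

Definition hidden_gram (val : atom A -> R) (x x' : 'I_T -> 'cV[R]_nx) s s' : R :=
  \sum_(b < s) \sum_(b' < s') \sum_a \sum_a'
    ext_seq x (s - b.+1) a 0 * ext_seq x' (s' - b'.+1) a' 0 * val (Hatom b b' a a').

(** The values of the atoms are an argument, so that one polynomial gives the kernel at the random
    atoms and its limit at [alim]. The first term comes from the derivatives in [C]; in the double
    sum [inner] belongs to [F] and [hidden_gram] to [W]. *)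
Definition ntk_expr (val : atom A -> R) (x x' : 'I_T -> 'cV[R]_nx) t s (k l : 'I_ny) : R :=
  (k == l)%:R * hidden_gram val x x' t.+1 s.+1 +
  \sum_(j < t.+1) \sum_(j' < s.+1) val (Aatom j j' k l) *
     (inner (ext_seq x (t - j)) (ext_seq x' (s - j')) +
      hidden_gram val x x' (t - j) (s - j')).

Lemma exchange_big3 (I J M : finType) (f : I -> J -> M -> R) :
  \sum_i \sum_j \sum_m f i j m = \sum_j \sum_m \sum_i f i j m.
Proof. by rewrite exchange_big; apply: eq_bigr => j _; exact: exchange_big. Qed.

(** The derivative in the entry [(m, a)] of [W] or [F] is a sum over time lags of a backward factor
    in [m] times a forward factor in [a]; for each pair of lags the sum over entries therefore
    splits into two Gram sums. *)
Lemma gram_sum (I J M N : finType) (u : I -> M -> R) (v : I -> N -> R)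
    (u' : J -> M -> R) (v' : J -> N -> R) :
  \sum_m \sum_a (\sum_i u i m * v i a) * (\sum_j u' j m * v' j a) =
  \sum_i \sum_j (\sum_m u i m * u' j m) * (\sum_a v i a * v' j a).
Proof.
transitivity (\sum_m \sum_a \sum_i \sum_j (u i m * u' j m) * (v i a * v' j a)).
  apply: eq_bigr => m _; apply: eq_bigr => a _; rewrite big_distrlr/=.
  by apply: eq_bigr => i _; apply: eq_bigr => j _; ring.
transitivity (\sum_m \sum_i \sum_j \sum_a (u i m * u' j m) * (v i a * v' j a)).
  by apply: eq_bigr => m _; exact: exchange_big3.
rewrite exchange_big3; apply: eq_bigr => i _; apply: eq_bigr => j _.
by rewrite big_distrlr.
Qed.

Lemma delta_mul_col p q (i : 'I_p) (j : 'I_q) (v : 'cV[R]_q) a :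
  (delta_mx i j *m v) a 0 = (a == i)%:R * v j 0.
Proof.
rewrite mxE (bigD1 j)//= big1 => [|l lj]; first by rewrite !mxE eqxx andbT addr0.
by rewrite !mxE (negPf lj) andbF mul0r.
Qed.

Lemma row_delta_col p q (u : 'rV[R]_p) (i : 'I_p) (j : 'I_q) (v : 'cV[R]_q) :
  (u *m (delta_mx i j *m v)) 0 0 = u 0 i * v j 0.
Proof.
rewrite mxE (bigD1 i)//= delta_mul_col eqxx mul1r big1 ?addr0// => l li.
by rewrite delta_mul_col (negPf li) mul0r mulr0.
Qed.

Lemma wordmx_nseq_true n (M : 'M[R]_n) j :
  wordmx M (nseq j true) = (wordmx M (nseq j false))^T.
Proof. by rewrite -wordmx_tword /tword map_nseq rev_nseq. Qed.

Section hidden_units.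
Variables (n : nat) (W : 'M[R]_n) (F : 'M[R]_(n, nx)) (C : 'M[R]_(ny, n)).
Local Notation c := ((Num.sqrt (n%:R : R))^-1).
Local Notation th := (params_of W F C).
Local Notation val := (atomv (c *: W) (colv F C)).
Local Notation pw j := (wordmx (c *: W) (nseq j false)).

Let cc : c * c = n%:R^-1.
Proof. by rewrite -invfM -expr2 sqr_sqrtr ?ler0n. Qed.

Definition resp k j (i : 'I_n) : R := ((colv F C (inr k))^T *m pw j) 0 i.
Definition hid (x : 'I_T -> 'cV[R]_nx) t i : R := hidden_state W F x t i 0.

Lemma val_Aatom k j k' j' :
  val (Aatom j j' k k') = c * c * \sum_i resp k j i * resp k' j' i.
Proof.
rewrite cc /atomv mxtr11 wordmx_cat wordmx_nseq_true; congr (_ * _).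
transitivity (((colv F C (inr k))^T *m pw j *m ((colv F C (inr k'))^T *m pw j')^T) 0 0).
  by rewrite [in RHS]trmx_mul [(colv F C (inr k'))^T^T]trmxK !mulmxA.
by rewrite mxE; apply: eq_bigr => i _; congr (_ * _); rewrite mxE.
Qed.

Lemma val_Hatom b b' a a' : val (Hatom b b' a a') =
  c * c * \sum_i (pw b *m colv F C (inl a)) i 0 * (pw b' *m colv F C (inl a')) i 0.
Proof.
rewrite cc /atomv mxtr11 wordmx_cat wordmx_nseq_true; congr (_ * _).
transitivity (((pw b *m colv F C (inl a))^T *m (pw b' *m colv F C (inl a'))) 0 0).
  by rewrite trmx_mul !mulmxA.
by rewrite mxE; apply: eq_bigr => i _; congr (_ * _); rewrite mxE.
Qed.

Lemma hid_unroll x t i : hid x t i =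
  \sum_(b < t) \sum_a ext_seq x (t - b.+1) a 0 * (pw b *m colv F C (inl a)) i 0.
Proof.
rewrite /hid hidden_unroll summxE; apply: eq_bigr => b _.
rewrite mulmxA mxE; apply: eq_bigr => a _; rewrite mulrC; congr (_ * _).
by rewrite mxE [RHS]mxE; apply: eq_bigr => l _; rewrite mxE.
Qed.

Lemma hid_gram x x' s s' :
  c * c * \sum_i hid x s i * hid x' s' i = hidden_gram val x x' s s'.
Proof.
pose f b a i : R := (pw b *m colv F C (inl a)) i 0.
transitivity (\sum_i \sum_(b < s) \sum_(b' < s') \sum_a \sum_a' c * c *
    ((ext_seq x (s - b.+1) a 0 * f b a i) * (ext_seq x' (s' - b'.+1) a' 0 * f b' a' i))).
  rewrite mulr_sumr; apply: eq_bigr => i _; rewrite !hid_unroll big_distrlr/= mulr_sumr.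
  apply: eq_bigr => b _; rewrite mulr_sumr; apply: eq_bigr => b' _.
  rewrite big_distrlr/= mulr_sumr; apply: eq_bigr => a _.
  by rewrite mulr_sumr.
rewrite [LHS]exchange_big; apply: eq_bigr => b _.
rewrite [LHS]exchange_big; apply: eq_bigr => b' _.
rewrite [LHS]exchange_big; apply: eq_bigr => a _.
rewrite [LHS]exchange_big; apply: eq_bigr => a' _.
by rewrite val_Hatom !mulr_sumr; apply: eq_bigr => i _; rewrite /f; ring.
Qed.

Lemma dmodel_C x t k k' i : dmodel x th (t, k) (inr (k', i)) =
  (k == k')%:R * (c * hid x t.+1 i).
Proof.
rewrite dmodelE big1 => [|j _]; last first.
  rewrite /gdrive (_ : W_of _ = 0); last by apply/matrixP => i0 j0; rewrite !mxE.
  rewrite (_ : F_of _ = 0); last by apply/matrixP => i0 j0; rewrite !mxE.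
  by rewrite !mul0mx scaler0 addr0 mulmx0 mxE.
rewrite (_ : C_of _ = delta_mx k' i); last by apply/matrixP => i0 j0; rewrite !mxE.
by rewrite delta_mul_col mulr0 addr0 mulrCA.
Qed.

Lemma dmodel_F (x : 'I_T -> 'cV[R]_nx) t k m a : dmodel x th (t, k) (inl (inr (m, a))) =
  c * \sum_(j < t.+1) resp k j m * ext_seq x (t - j) a 0.
Proof.
rewrite dmodelE (_ : C_of _ = 0); last by apply/matrixP => i0 j0; rewrite !mxE.
rewrite mul0mx mxE mulr0 add0r; congr (_ * _); apply: eq_bigr => j _.
rewrite /gdrive (_ : W_of _ = 0); last by apply/matrixP => i0 j0; rewrite !mxE.
rewrite (_ : F_of _ = delta_mx m a); last by apply/matrixP => i0 j0; rewrite !mxE.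
by rewrite mul0mx scaler0 add0r row_delta_col.
Qed.

Lemma dmodel_W (x : 'I_T -> 'cV[R]_nx) t k p q : dmodel x th (t, k) (inl (inl (p, q))) =
  c * \sum_(j < t.+1) resp k j p * (c * hid x (t - j) q).
Proof.
rewrite dmodelE (_ : C_of _ = 0); last by apply/matrixP => i0 j0; rewrite !mxE.
rewrite mul0mx mxE mulr0 add0r; congr (_ * _); apply: eq_bigr => j _.
rewrite /gdrive (_ : F_of _ = 0); last by apply/matrixP => i0 j0; rewrite !mxE.
rewrite (_ : W_of _ = delta_mx p q); last by apply/matrixP => i0 j0; rewrite !mxE.
by rewrite mul0mx addr0 -scalemxAr mxE row_delta_col mulrCA.
Qed.

Lemma ntk_exprE (x x' : 'I_T -> 'cV[R]_nx) (o o' : 'I_T * 'I_ny) :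
  ntk th x x' o o' = ntk_expr val x x' o.1 o'.1 o.2 o'.2.
Proof.
case: o => t k; case: o' => s l /=.
have CE : \sum_(p : 'I_ny * 'I_n) dmodel x th (t, k) (inr p) * dmodel x' th (s, l) (inr p) =
    (k == l)%:R * hidden_gram val x x' t.+1 s.+1.
  transitivity (\sum_(k' : 'I_ny) \sum_(i : 'I_n)
      dmodel x th (t, k) (inr (k', i)) * dmodel x' th (s, l) (inr (k', i))).
    by rewrite pair_bigA; apply: eq_bigr => -[].
  rewrite (bigD1 k)//= [X in _ + X]big1 => [|k' kk]; last first.
    by apply: big1 => i _; rewrite dmodel_C eq_sym (negPf kk) !mul0r.
  rewrite addr0 -hid_gram !mulr_sumr; apply: eq_bigr => i _.
  by rewrite !dmodel_C eqxx mul1r [l == k]eq_sym mulrCA mulrACA.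
have FE : \sum_(p : 'I_n * 'I_nx) dmodel x th (t, k) (inl (inr p)) *
      dmodel x' th (s, l) (inl (inr p)) =
    \sum_(j < t.+1) \sum_(j' < s.+1) val (Aatom j j' k l) *
      inner (ext_seq x (t - j)) (ext_seq x' (s - j')).
  transitivity (\sum_(m : 'I_n) \sum_(a : 'I_nx)
      dmodel x th (t, k) (inl (inr (m, a))) * dmodel x' th (s, l) (inl (inr (m, a)))).
    by rewrite pair_bigA; apply: eq_bigr => -[].
  under eq_bigr do under eq_bigr do rewrite !dmodel_F mulrACA.
  under eq_bigr do rewrite -mulr_sumr.
  rewrite -mulr_sumr gram_sum mulr_sumr; apply: eq_bigr => j _.
  by rewrite mulr_sumr; apply: eq_bigr => j' _; rewrite mulrA val_Aatom.
have WE : \sum_(p : 'I_n * 'I_n) dmodel x th (t, k) (inl (inl p)) *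
      dmodel x' th (s, l) (inl (inl p)) =
    \sum_(j < t.+1) \sum_(j' < s.+1) val (Aatom j j' k l) *
      hidden_gram val x x' (t - j) (s - j').
  transitivity (\sum_(m : 'I_n) \sum_(a : 'I_n)
      dmodel x th (t, k) (inl (inl (m, a))) * dmodel x' th (s, l) (inl (inl (m, a)))).
    by rewrite pair_bigA; apply: eq_bigr => -[].
  under eq_bigr do under eq_bigr do rewrite !dmodel_W mulrACA.
  under eq_bigr do rewrite -mulr_sumr.
  rewrite -mulr_sumr gram_sum mulr_sumr; apply: eq_bigr => j _.
  rewrite mulr_sumr; apply: eq_bigr => j' _; rewrite mulrA val_Aatom -hid_gram.
  by congr (_ * _); rewrite mulr_sumr; apply: eq_bigr => i _; ring.
transitivity (\sum_(p : ('I_n * 'I_n + 'I_n * 'I_nx + 'I_ny * 'I_n)%type)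
    dmodel x th (t, k) p * dmodel x' th (s, l) p); first by [].
rewrite !big_sumType/= CE FE WE /ntk_expr addrC -big_split/=; congr (_ + _).
apply: eq_bigr => j _; rewrite -big_split/=; apply: eq_bigr => j' _.
by rewrite mulrDr addrC.
Qed.

End hidden_units.

End ntk_expression.

Lemma cvg_sum_seq (R : realType) (J : eqType) (s : seq J) (f : J -> nat -> R) (l : J -> R) :
  (forall j, j \in s -> f j n @[n --> \oo] --> l j) ->
  (\sum_(j <- s) f j n) @[n --> \oo] --> \sum_(j <- s) l j.
Proof.
elim: s => [|j s IH] H.
  by rewrite big_nil; apply: cvg_near_cst; apply: nearW => n; rewrite big_nil.
rewrite (_ : (fun n => \sum_(i <- j :: s) f i n) =
  (fun n => f j n + \sum_(i <- s) f i n)); last first.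
  by apply/funext => n; rewrite big_cons.
rewrite big_cons; apply: cvgD; first by apply: H; rewrite mem_head.
by apply: IH => i si; apply: H; rewrite inE si orbT.
Qed.

(** * Almost sure convergence from fourth moments *)

Section borel_cantelli.
Context d (T : measurableType d) (R : realType) (P : probability T R).

(** The series of fourth powers has finite expectation, hence is almost surely finite, and its terms
    tend to [0]. The index is shifted since the hypotheses start at [n = 1]. *)
Lemma ae_cvg_moment4 (Y : nat -> T -> R) (y K : R) :
  (forall n, (0 < n)%N -> measurable_fun setT (Y n)) ->
  (forall n, (0 < n)%N -> P.-integrable setT (fun w => ((Y n w - y) ^+ 4)%:E)) ->
  (forall n, (0 < n)%N -> \int[P]_w ((Y n w - y) ^+ 4) <= K * n%:R^-1 ^+ 2) ->
  {ae P, forall w, (fun n => Y n w) @ \oo --> y}.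
Proof.
move=> mY iY bY.
pose u n w := ((Y n.+1 w - y) ^+ 4)%:E.
have u0 n w : (0 <= u n w)%E by rewrite lee_fin exprn_even_ge0.
have mu n : measurable_fun setT (u n).
  apply/measurable_EFinP; apply: measurable_funX; apply: measurable_funB => //.
  exact: mY.
have K0 : 0 <= K.
  have := bY 1%N isT; rewrite invr1 expr1n mulr1; apply: le_trans.
  by apply: Rintegral_ge0 => w _; rewrite exprn_even_ge0.
(* Comparison with a telescoping series through [1 / (n+1)^2 <= 2 (1 / (n+1) - 1 / (n+2))]; the
   total is at most [2 K]. *)
have bu n : (\int[P]_w u n w <= (K * 2 * (n.+1%:R^-1 - n.+2%:R^-1))%:E)%E.
  have -> : (\int[P]_w u n w = (\int[P]_w ((Y n.+1 w - y) ^+ 4))%:E)%E.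
    by rewrite /Rintegral fineK//; apply: integrable_fin_num => //; exact: iY.
  rewrite lee_fin (le_trans (bY _ _))// -mulrA ler_wpM2l//.
  have n10 : 0 < n.+1%:R :> R by rewrite ltr0n.
  have n20 : 0 < n.+2%:R :> R by rewrite ltr0n.
  have -> : n.+1%:R^-1 - n.+2%:R^-1 = n.+1%:R^-1 * n.+2%:R^-1 :> R.
    have gen (a : R) : 0 < a -> a^-1 - (a + 1)^-1 = a^-1 * (a + 1)^-1.
      by move=> a0; field; rewrite !gt_eqF// addr_gt0.
    by have := gen _ n10; rewrite natr1.
  have h2 : n.+1%:R^-1 <= 2 * n.+2%:R^-1 :> R.
    by rewrite ler_pdivlMr// ler_pdivrMl// mulrC -natrM ler_nat; lia.
  rewrite expr2 mulrCA; apply: ler_wpM2l; last exact: h2.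
  by rewrite invr_ge0.
have sumfin : (\int[P]_w (\sum_(n <oo) u n w) <= (K * 2)%:E)%E.
  rewrite integral_nneseries//.
  apply: lime_le.
    by apply: is_cvg_nneseries => n _ _; apply: integral_ge0 => w _.
  apply: nearW => n.
  apply: (@le_trans _ _ (\sum_(0 <= i < n) (K * 2 * (i.+1%:R^-1 - i.+2%:R^-1))%:E)%E).
    by apply: lee_sum => i _; exact: bu.
  rewrite sumEFin lee_fin -mulr_sumr ler_piMr ?mulr_ge0//.
  rewrite (@telescope_sumr_eq _ 0 n (fun i => - (i.+1%:R^-1 : R)))//; last first.
    by move=> i _; rewrite opprK addrC.
  by rewrite invr1 opprK gerDr oppr_le0 invr_ge0.
have intS : P.-integrable setT (fun w => \sum_(n <oo) u n w)%E.
  apply/integrableP; split.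
    by apply: ge0_emeasurable_sum.
  under eq_integral do rewrite gee0_abs ?nneseries_ge0//.
  by apply: le_lt_trans sumfin _; rewrite ltry.
have := integrable_ae measurableT intS.
apply: filterS => w /(_ I) fw.
pose s n := (Y n.+1 w - y) ^+ 4.
have sc : cvgn (series s).
  apply: nondecreasing_is_cvgn.
    by apply: nondecreasing_series => i _ _; rewrite exprn_even_ge0.
  exists (fine (\sum_(n <oo) u n w)) => _ [n _ <-].
  rewrite -lee_fin fineK// /series/=.
  have := @nneseries_lim_ge R (fun i => u i w) predT 0%N n (fun k _ _ => u0 k w).
  by rewrite /u sumEFin.
have s_0 := cvg_series_cvg_0 sc.
rewrite -cvg_shiftS; apply/cvgrPdist_lt => e e0.
have e40 : 0 < e ^+ 4 by rewrite exprn_gt0.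
move/cvgrPdist_lt : s_0 => /(_ _ e40); apply: filterS => n /=.
rewrite sub0r normrN /s normrX => h; rewrite distrC ltNge; apply/negP => eY.
by move: h; rewrite ltNge lerXn2r ?nnegrE// ltW.
Qed.

End borel_cantelli.

(** * The limit kernel *)

Section ntk_limit.
Context (R : realType) (nx ny T : nat) (nuW nuF nuC : R).
Local Notation A := ('I_nx + 'I_ny)%type.
Local Notation alm := (@alim R nx ny nuW nuF nuC).

Lemma diag_sum p q N (f : nat -> nat -> R) : (p <= N)%N ->
  \sum_(b < p) \sum_(b' < q) (b == b' :> nat)%:R * f b b' =
  \sum_(b < N) (if (b < p)%N && (b < q)%N then f b b else 0).
Proof.
have H (b : nat) : \sum_(b' < q) (b == b' :> nat)%:R * f b b' = if (b < q)%N then f b b else 0.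
  case: ltnP => bq; last first.
    by rewrite big1// => i _; rewrite gtn_eqF ?mul0r// (leq_trans (ltn_ord i)).
  rewrite (bigD1 (Ordinal bq))//= eqxx mul1r big1 ?addr0// => i ib.
  case: eqP => [e|_]; last by rewrite mul0r.
  by move/eqP: ib; case; apply: val_inj.
move=> pN; under eq_bigr do rewrite H.
rewrite (big_ord_widen N (fun b => if (b < q)%N then f b b else 0) pN) big_mkcond/=.
by apply: eq_bigr => b _; case: (b < p)%N.
Qed.

(** Exactly [m] pairs [(j, b)] satisfy [j + b + 1 = m]: they are the places at which a product of
    [m] factors [W] can be differentiated. This is the origin of the factor [j] in [rho]. *)
Lemma conv_sum N (f : nat -> R) : (forall m, (N <= m)%N -> f m = 0) ->
  \sum_(j < N) \sum_(b < N) f (j + b).+1 = \sum_(m < N) m%:R * f m.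
Proof.
move=> f0.
have H (j : 'I_N) : \sum_(b < N) f (j + b).+1 = \sum_(m < N) if (j < m)%N then f m else 0.
  transitivity (\sum_(j.+1 <= m < N + j.+1) f m).
    rewrite -{1}[j.+1]add0n big_addn addnK big_mkord.
    by apply: eq_bigr => b _; rewrite addnS addnC.
  rewrite (@big_cat_nat _ _ _ N)//= ?leq_addr//.
  rewrite [X in _ + X]big_nat [X in _ + X]big1 ?addr0; last by move=> i /andP[/f0].
  by rewrite big_geq_mkord big_mkcond.
under eq_bigr do rewrite H.
rewrite exchange_big/=; apply: eq_bigr => m _.
rewrite -big_mkcond/= -(big_ord_widen N (fun=> f m)) ?(ltnW (ltn_ord m))//.
by rewrite sumr_const card_ord mulr_natl.
Qed.

Lemma alim_Aatom j j' k l : alm (Aatom nx j j' k l) =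
  (j == j')%:R * nuW ^+ j * ((k == l)%:R * nuC).
Proof. by rewrite /alim /= (tlim_nseq_cat nuW false) (inj_eq (@inr_inj _ _)). Qed.

Lemma alim_Hatom b b' a a' : alm (Hatom ny b b' a a') =
  (b == b')%:R * nuW ^+ b * ((a == a')%:R * nuF).
Proof. by rewrite /alim /= (tlim_nseq_cat nuW true) (inj_eq (@inl_inj _ _)). Qed.

(** At the limits all double sums over lags collapse to the diagonal. The derivatives in [C]
    contribute [nuF * nuW ^+ j] to [rho], those in [F] contribute [nuC * nuW ^+ j], and those in [W]
    a convolution that becomes [nuC * j * nuF * nuW ^+ j.-1]. *)
Lemma ntk_expr_alim (x x' : 'I_T -> 'cV[R]_nx) (o o' : 'I_T * 'I_ny) :
  ntk_expr alm x x' o.1 o'.1 o.2 o'.2 = ntk_limit nuW nuF nuC x x' o o'.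
Proof.
case: o => t k; case: o' => s l /=; rewrite /ntk_limit /=.
(* The inner product of the two inputs delayed by [m]. Truncated subtraction would read [x 0] when
   the delay exceeds the time, so [G] cuts it off to [0], which also lets every sum run up to
   [T]. *)
pose g m := inner (ext_seq x (t - m)) (ext_seq x' (s - m)).
pose G m := if (m <= t)%N && (m <= s)%N then g m else 0.
have G0 m : (T <= m)%N -> G m = 0.
  by move=> Tm; rewrite /G leqNgt (leq_trans (ltn_ord t) Tm).
have HG p q : (p <= T)%N -> hidden_gram alm x x' p q =
    \sum_(b < T) (if (b < p)%N && (b < q)%N then
      nuW ^+ b * (nuF * inner (ext_seq x (p - b.+1)) (ext_seq x' (q - b.+1))) else 0).
  move=> pT; rewrite -(diag_sum q (fun b b' => nuW ^+ b *
    (nuF * inner (ext_seq x (p - b.+1)) (ext_seq x' (q - b'.+1)))) pT).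
  rewrite /hidden_gram; apply: eq_bigr => b _; apply: eq_bigr => b' _.
  transitivity (\sum_a (b == b' :> nat)%:R * (nuW ^+ b * (nuF *
      (ext_seq x (p - b.+1) a 0 * ext_seq x' (q - b'.+1) a 0)))).
    apply: eq_bigr => a _; rewrite (bigD1 a)//= big1 => [|a' aa].
      rewrite alim_Hatom eqxx mul1r addr0.
      by move: (ext_seq x _ _ _) (ext_seq x' _ _ _) (_ == _)%:R => u v z; ring.
    by rewrite alim_Hatom [a == _]eq_sym (negPf aa) mul0r !mulr0.
  by rewrite /inner !mulr_sumr.
have H1 : hidden_gram alm x x' t.+1 s.+1 = \sum_(b < T) nuW ^+ b * (nuF * G b).
  rewrite HG//; apply: eq_bigr => b _; rewrite !ltnS !subSS /G.
  by case: ifP => _ //; rewrite !mulr0.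
have H2 j : hidden_gram alm x x' (t - j) (s - j) =
    \sum_(b < T) nuW ^+ b * (nuF * G (j + b).+1).
  rewrite HG ?(leq_trans (leq_subr _ _) (ltnW (ltn_ord t)))//; apply: eq_bigr => b _.
  rewrite !ltn_subRL -!subnDA !addnS /G.
  by case: ifP => _ //; rewrite !mulr0.
pose ff j j' := nuW ^+ j * ((k == l)%:R * nuC) *
  (inner (ext_seq x (t - j)) (ext_seq x' (s - j')) + hidden_gram alm x x' (t - j) (s - j')).
have HA : \sum_(j < t.+1) \sum_(j' < s.+1) alm (Aatom nx j j' k l) *
     (inner (ext_seq x (t - j)) (ext_seq x' (s - j')) +
      hidden_gram alm x x' (t - j) (s - j')) =
    \sum_(j < T) nuW ^+ j * ((k == l)%:R * nuC) *
      (G j + \sum_(b < T) nuW ^+ b * (nuF * G (j + b).+1)).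
  transitivity (\sum_(j < t.+1) \sum_(j' < s.+1) (j == j' :> nat)%:R * ff j j').
    by apply: eq_bigr => j _; apply: eq_bigr => j' _; rewrite alim_Aatom /ff !mulrA.
  rewrite (diag_sum _ _ (ltn_ord t)); apply: eq_bigr => j _; rewrite !ltnS /ff.
  case: ifP => [/andP[jt js]|nj]; first by rewrite H2 /G jt js.
  have Gz m : (j <= m)%N -> G m = 0.
    move=> jm; rewrite /G; case: ifP => // /andP[mt ms].
    by move: nj; rewrite (leq_trans jm mt) (leq_trans jm ms).
  rewrite Gz// big1 ?addr0 ?mulr0// => b _.
  by rewrite Gz ?mulr0// -addnS leq_addr.
have CV : \sum_(j < T) nuW ^+ j * \sum_(b < T) nuW ^+ b * (nuF * G (j + b).+1) =
    nuF * \sum_(m < T) m%:R * (nuW ^+ m.-1 * G m).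
  rewrite -(@conv_sum T (fun m => nuW ^+ m.-1 * G m)); last first.
    by move=> m Tm; rewrite G0 ?mulr0.
  rewrite mulr_sumr; apply: eq_bigr => j _; rewrite !mulr_sumr.
  by apply: eq_bigr => b _; rewrite /= exprD; ring.
rewrite /ntk_expr H1 HA.
transitivity (\sum_(j < T) rho nuW nuF nuC j * G j * (k == l)%:R).
  transitivity ((k == l)%:R * (\sum_(b < T) nuW ^+ b * (nuF * G b)) + (k == l)%:R * nuC *
      (\sum_(j < T) nuW ^+ j * G j + nuF * \sum_(m < T) m%:R * (nuW ^+ m.-1 * G m))).
    congr (_ + _); rewrite -CV -big_split/= mulr_sumr; apply: eq_bigr => j _.
    by rewrite mulrDr; ring.
  rewrite mulrDr addrA !mulr_sumr -!big_split/=; apply: eq_bigr => j _.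
  by rewrite /rho; ring.
rewrite -mulr_suml; congr (_ * _).
transitivity (\sum_(j < T) \sum_a toeplitz x (j, a) t * rho nuW nuF nuC j * toeplitz x' (j, a) s).
  apply: eq_bigr => j _; rewrite /toeplitz/= /G.
  case: (j <= t)%N => /=; last by rewrite mulr0 big1// => a _; rewrite !mul0r.
  case: (j <= s)%N => /=; last by rewrite mulr0 big1// => a _; rewrite mulr0.
  by rewrite /g /inner mulr_sumr; apply: eq_bigr => a _; ring.
rewrite pair_bigA; apply: eq_bigr => -[j a] _ /=.
rewrite (bigD1 (j, a))//= big1 ?addr0 => [|ja' ne]; first by rewrite /Drho eqxx.
by rewrite /Drho eq_sym (negPf ne) mulr0 mul0r.
Qed.

Lemma ntk_expr_cvg (v : nat -> atom A -> R) (v0 : atom A -> R)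
    (x x' : 'I_T -> 'cV[R]_nx) t s k l :
  (forall y, v n y @[n --> \oo] --> v0 y) ->
  ntk_expr (v n) x x' t s k l @[n --> \oo] --> ntk_expr v0 x x' t s k l.
Proof.
move=> H.
have HG p q : hidden_gram (v n) x x' p q @[n --> \oo] --> hidden_gram v0 x x' p q.
  apply: cvg_sum_seq => b _; apply: cvg_sum_seq => b' _; apply: cvg_sum_seq => a _.
  apply: cvg_sum_seq => a' _; apply: cvgM; [exact: cvg_cst|exact: H].
apply: cvgD; first by apply: cvgM; [exact: cvg_cst|exact: HG].
apply: cvg_sum_seq => j _; apply: cvg_sum_seq => j' _; apply: cvgM; first exact: H.
by apply: cvgD; [exact: cvg_cst|exact: HG].
Qed.

Context d (Om : measurableType d) (P : probability Om R).
Hypotheses (nuW0 : 0 < nuW) (nuF0 : 0 < nuF) (nuC0 : 0 < nuC).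
Variable X : forall n, param_index n nx ny -> Om -> R.
Hypothesis gX : forall n, (0 < n)%N ->
  forall p : param_index n nx ny, is_gaussian P (param_var nuW nuF nuC p) (X p).
Hypothesis indep : forall n, (0 < n)%N -> mutually_independent P (@X n).

Let nu0 n (p : param_index n nx ny) : 0 < param_var nuW nuF nuC p.
Proof. by case: p => [[]|]. Qed.

(** Four centred copies of the same atom have order [uphalf 4 = 2], a summable rate. *)
Lemma atom_ae_cvg y :
  {ae P, forall w, (fun n => atomv (rW (@X n) w) (rv (@X n) w) y) @ \oo --> alm y}.
Proof.
have [pH [K K0 bH]] := fprod_bound nuW0 nuF0 nuC0 gX indep (nseq 4 (true, y)).
have fpE n w : (atomv (rW (@X n) w) (rv (@X n) w) y - alm y) ^+ 4 =
    fp nuW nuF nuC X n (nseq 4 (true, y)) w.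
  by rewrite /fp /fprod /= !big_cons big_nil /flim /= mul1r !exprS expr0.
apply: (@ae_cvg_moment4 _ _ _ _ _ _ K) => n n0.
- exact: (ispoly_measurable (@nu0 n) (gX n0) (indep n0) (ispoly_atom (@X n) y)).
- have [dg Hg] := pH n n0.
  rewrite (_ : (fun w => _) = (fun w => (fp nuW nuF nuC X n (nseq 4 (true, y)) w)%:E)).
    exact: (ispoly_integrable (@nu0 n) (gX n0) (indep n0) Hg).
  by apply/funext => w; rewrite fpE.
- rewrite (_ : Rintegral _ _ _ =
      Rintegral P setT (fun w => fp nuW nuF nuC X n (nseq 4 (true, y)) w)).
    exact: le_trans (ler_norm _) (bH n n0).
  by apply: eq_Rintegral => w _; rewrite fpE.
Qed.

(** There are countably many atoms, so one null set serves them all; [unpickle] enumerates them. *)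
Lemma atoms_ae_cvg : {ae P, forall w, forall y,
  (fun n => atomv (rW (@X n) w) (rv (@X n) w) y) @ \oo --> alm y}.
Proof.
have H (m : nat) : {ae P, forall w, forall y : seq bool * option (A * A),
    unpickle m = Some y ->
    (fun n => atomv (rW (@X n) w) (rv (@X n) w) y) @ \oo --> alm y}.
  case e : (unpickle m) => [y|]; last by apply: aeW.
  by apply: filterS (atom_ae_cvg y) => w Hw z [<-].
have := ae_foralln H; apply: filterS => w Hw y.
exact: (Hw (pickle (y : seq bool * option (A * A))) y (pickleK _)).
Qed.

End ntk_limit.

(** * Mixed moments of the impulse responses *)

Section impulse_moments.
Context d (T : measurableType d) (R : realType) (P : probability T R).
Variables (nx ny : nat) (nuW nuF nuC : R).
Hypotheses (nuW0 : 0 < nuW) (nuF0 : 0 < nuF) (nuC0 : 0 < nuC).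
Variable X : forall n, param_index n nx ny -> T -> R.
Hypothesis gX : forall n, (0 < n)%N ->
  forall p : param_index n nx ny, is_gaussian P (param_var nuW nuF nuC p) (X p).
Hypothesis indep : forall n, (0 < n)%N -> mutually_independent P (@X n).
Variables (TT : nat).
Local Notation A := ('I_nx + 'I_ny)%type.
Local Notation J := ('I_TT * 'I_ny * 'I_nx)%type.
Local Notation E g := (Rintegral P setT g).

Let nu0 n (p : param_index n nx ny) : 0 < param_var nuW nuF nuC p.
Proof. by case: p => [[]|]. Qed.

Definition Vcol n (o : J) w : 'cV[R]_n :=
  wordmx (rW (@X n) w) (nseq o.1.1 false) *m rv (@X n) w (inl o.2).

(** The impulse response written linearly in a row of [C], with coefficients free of [C];
    [Limp_impulse] identifies it with [impulse]. *)
Definition Limp n (o : J) w : R :=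
  \sum_m X (@vec_index n nx ny (inr o.1.2) m) w * ((Num.sqrt n%:R)^-1 * Vcol n o w m 0).

Definition lprod n (l : seq J) w := \prod_(o <- l) Limp n o w.
Definition yprod n (ys : seq (atom A)) w := \prod_(y <- ys) atomv (rW (@X n) w) (rv (@X n) w) y.

(** Bilinear atoms in columns of [F], which derivatives in [C] pass by. *)
Definition cfree (y : atom A) := if y.2 is Some (inl _, inl _) then true else false.

Definition Batom (o o' : J) : atom A :=
  (nseq o.1.1 true ++ nseq o'.1.1 false, Some (inl o.2, inl o'.2)).

Definition fixes_C n (g : T -> R) (dg : param_index n nx ny -> T -> R) :=
  ispoly (@X n) g dg /\ forall (k : 'I_ny) m w, dg (vec_index (inr k) m) w = 0.

Lemma dword_C n k m w u : dword (rW (@X n) w) false (dW R (@vec_index n nx ny (inr k) m)) u = 0.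
Proof.
rewrite dW_vec /dword big1// => s _.
by case: ifP => _; rewrite ?trmx0 mulmx0 mul0mx.
Qed.

Lemma dv_C n k m i : dv R (@vec_index n nx ny (inr k) m) (inl i) = 0.
Proof. by apply/matrixP => a b; rewrite !mxE vec_index_eq. Qed.

Lemma Vcol_poly n o m : exists dg, fixes_C (n := n) (fun w => Vcol n o w m 0) dg.
Proof.
eexists; split.
  exact: (ispolymxM (ispolymx_word (@X n) _) (ispolymx_rv (@X n) (inl o.2)) m 0).
by move=> k m' w; cbv beta; rewrite dword_C dv_C mul0mx mulmx0 addr0 mxE.
Qed.

Lemma yprod_poly n ys : all cfree ys -> exists dg, fixes_C (n := n) (yprod n ys) dg.
Proof.
elim: ys => [|y ys IH] /=.
  move=> _; eexists; split.
    by apply: ispoly_ext (ispoly_cst _ 1) => // w; rewrite /yprod big_nil.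
  by [].
move=> /andP[cy /IH[dg [Hg g0]]]; eexists; split.
  apply: ispoly_ext (ispolyM (ispoly_atom (@X n) y) Hg) => // w.
  by rewrite /yprod big_cons.
move=> k m w; cbv beta; rewrite g0 mulr0 addr0 /datom dword_C.
case: y cy => u [[[a|//] [b|//]]|//] _.
have -> : datommx (@X n) (vec_index (inr k) m) w (Some (inl a, inl b)) = 0.
  by rewrite /datommx !dv_C trmx0 mul0mx mulmx0 addr0.
by rewrite mul0mx mulmx0 addr0 mxtrace0 mulr0 mul0r.
Qed.

Lemma Limp_poly n o : exists dL, ispoly (@X n) (Limp n o) dL /\
  forall k m w, dL (vec_index (inr k) m) w =
    (k == o.1.2)%:R * ((Num.sqrt n%:R)^-1 * Vcol n o w m 0).
Proof.
have /choice[dg dgP] := @Vcol_poly n o.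
eexists; split.
  apply: (ispoly_sum _ (fun m => ispolyM (ispoly_var (@X n) (vec_index (inr o.1.2) m))
    (ispolyZ (Num.sqrt n%:R)^-1 (dgP m).1))).
move=> k m w /=; rewrite (bigD1 m)//= big1 => [|i im].
  by rewrite (dgP m).2 !mulr0 !addr0 (inj_eq (@inr_inj _ _)) xpair_eqE eqxx andbT.
by rewrite (dgP i).2 !mulr0 addr0 (inj_eq (@inr_inj _ _)) xpair_eqE [m == i]eq_sym (negPf im) andbF mul0r.
Qed.

Lemma lprod_poly n l : exists dL, ispoly (@X n) (lprod n l) dL /\
  forall k m w, dL (vec_index (inr k) m) w =
    \sum_(y <- picks l) (k == y.1.1.2)%:R *
      ((Num.sqrt n%:R)^-1 * Vcol n y.1 w m 0) * lprod n y.2 w.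
Proof.
elim: l => [|o l [dL [HL LE]]].
  eexists; split.
    by apply: ispoly_ext (ispoly_cst _ 1) => // w; rewrite /lprod big_nil.
  by move=> *; rewrite big_nil.
have [d1 [H1 E1]] := @Limp_poly n o.
eexists; split.
  by apply: ispoly_ext (ispolyM H1 HL) => // w; rewrite /lprod big_cons.
move=> k m w; rewrite /= E1 LE big_cons big_map mulr_sumr; congr (_ + _).
by apply: eq_bigr => y _; rewrite [X in _ = _ * X]/lprod big_cons mulrCA.
Qed.

(** One Wick step: the row of [C] in [o] is contracted with the row in each other factor.
    Contracting [o] with [o'] leaves the inner product of their columns, the atom [Batom o o']; it
    is free of [C] and is set aside, which is why the statement carries the list [ys]. *)
Lemma Limp_stein n o l ys : (0 < n)%N -> all cfree ys ->
  E (fun w => lprod n (o :: l) w * yprod n ys w) =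
  \sum_(y <- picks l) nuC * (o.1.2 == y.1.1.2)%:R *
    E (fun w => lprod n y.2 w * yprod n (Batom o y.1 :: ys) w).
Proof.
move=> n0 cys.
have [dL [HL LE]] := lprod_poly n l; have [dy [Hy y0]] := yprod_poly n cys.
have /choice[dV dVP] := @Vcol_poly n o.
pose c : R := (Num.sqrt n%:R)^-1.
have Hm m := ispolyM (ispolyZ c (dVP m).1) (ispolyM HL Hy).
have intP g dg (H : ispoly (@X n) g dg) : P.-integrable setT (fun w => (g w)%:E).
  exact: (ispoly_integrable (@nu0 n) (gX n0) (indep n0) H).
transitivity (E (fun w => \sum_(m <- enum 'I_n) X (vec_index (inr o.1.2) m) w *
    (c * Vcol n o w m 0 * (lprod n l w * yprod n ys w)))).
  apply: eq_Rintegral => w _; rewrite /lprod big_cons big_enum/= -mulrA mulr_suml.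
  by apply: eq_bigr => m _; rewrite -mulrA.
rewrite (expectation_contraction nuW0 nuF0 nuC0 (gX n0) (indep n0) (k := nuC) _ _ Hm)//.
transitivity (nuC * E (fun w => \sum_(y <- picks l) (o.1.2 == y.1.1.2)%:R *
    (lprod n y.2 w * yprod n (Batom o y.1 :: ys) w))).
  congr (_ * _); apply: eq_Rintegral => w _; rewrite big_enum/=.
  under eq_bigr do rewrite (dVP _).2 y0 LE !mulr0 mul0r add0r addr0 mulr_suml mulr_sumr.
  rewrite exchange_big/=; apply: eq_bigr => y _.
  have BE : atomv (rW (@X n) w) (rv (@X n) w) (Batom o y.1) =
      \sum_m n%:R^-1 * (Vcol n o w m 0 * Vcol n y.1 w m 0).
    rewrite /atomv mxtr11 wordmx_cat -mulr_sumr; congr (_ * _).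
    have -> : wordmx (rW (@X n) w) (nseq o.1.1 true) =
        (wordmx (rW (@X n) w) (nseq o.1.1 false))^T.
      rewrite -wordmx_tword; congr wordmx.
      by rewrite /tword map_nseq rev_nseq.
    rewrite mulmxA -trmx_mul -mulmxA mxE; apply: eq_bigr => m _.
    by rewrite mxE.
  rewrite /yprod big_cons BE -/(yprod n ys w) !mulr_suml !mulr_sumr.
  have cc : n%:R^-1 = c * c by rewrite -invfM -expr2 sqr_sqrtr ?ler0n.
  apply: eq_bigr => m _; rewrite cc.
  have rg (z a b u p q : R) : z * a * (u * (z * b) * p * q) = u * (p * (z * z * (a * b) * q)).
    by ring.
  exact: rg.
have HB y : exists dB, ispoly (@X n) (fun w => lprod n y.2 w * yprod n (Batom o y.1 :: ys) w) dB.
  have [d1 [K1 _]] := lprod_poly n y.2.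
  have cB : all cfree (Batom o y.1 :: ys) by [].
  have [d2 [K2 _]] := yprod_poly n cB.
  by eexists; exact: ispolyM K1 K2.
rewrite Rintegral_sum; last first.
  by move=> y; have [dB KB] := HB y; exact: intP (ispolyZ _ KB).
rewrite mulr_sumr; apply: eq_bigr => y _.
by have [dB KB] := HB y; rewrite RintegralZl ?mulrA//; exact: intP KB.
Qed.

Variables (d' : measure_display) (T' : measurableType d') (Q : probability T' R).
Variable Z : J -> T' -> R.
Definition nuL (o : J) : R := nuC * nuF * nuW ^+ o.1.1.
Hypothesis gZ : forall o, is_gaussian Q (nuL o) (Z o).
Hypothesis indepZ : mutually_independent Q Z.

Lemma dmonom_picks o l w :
  dmonom Z o l w = \sum_(y <- picks l) (o == y.1)%:R * monom Z y.2 w.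
Proof.
elim: l => [|a l IH] /=; first by rewrite big_nil.
rewrite big_cons big_map IH mulr_sumr; congr (_ + _).
by apply: eq_bigr => y _; rewrite /monom big_cons mulrCA.
Qed.

(** Both sides obey the same recursion in [l]: [nuC] times the limit of [Batom o o'], with the
    indicator that the rows of [C] agree, is the covariance of [Z o] and [Z o']. Once [l] is
    exhausted only atoms remain, and [telescope] makes the expectation of their product converge at
    rate [n^-1]. *)
Lemma impulse_moments_cvg l ys : all cfree ys ->
  E (fun w => lprod n l w * yprod n ys w) @[n --> \oo] -->
  Rintegral Q setT (monom Z l) * \prod_(y <- ys) alim nuW nuF nuC y.
Proof.
have nuL0 o : 0 < nuL o by rewrite !mulr_gt0 ?exprn_gt0.
have [N] := ubnP (size l); elim: N l ys => [//|N IH] [|o l] ys lN cys.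
  have -> : Rintegral Q setT (monom Z [::]) = 1.
    under eq_Rintegral do rewrite /monom big_nil.
    by rewrite Rintegral_probability_cst.
  rewrite mul1r.
  have [_ [K K0 bK]] := telescope nuW0 nuF0 nuC0 gX indep (e := 1) (l := [::]) (ys := ys)
    (fun l' _ => fprod_bound nuW0 nuF0 nuC0 gX indep l') erefl (leqnn _).
  apply/cvgrPdist_le => e e0; near=> n.
  have n0 : (0 < n)%N by near: n; exact: nbhs_infty_gt.
  have [dy [Hy _]] := yprod_poly n cys.
  have iy := ispoly_integrable (@nu0 n) (gX n0) (indep n0) Hy.
  have := bK n n0; rewrite expr1.
  have -> : E (fun w => (\prod_(y <- ys) atomv (rW (@X n) w) (rv (@X n) w) y -
      \prod_(y <- ys) alim nuW nuF nuC y) * fp nuW nuF nuC X n [::] w) =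
      E (fun w => lprod n [::] w * yprod n ys w) - \prod_(y <- ys) alim nuW nuF nuC y.
    transitivity (E (fun w => yprod n ys w - \prod_(y <- ys) alim nuW nuF nuC y)).
      by apply: eq_Rintegral => w _; rewrite /fp /fprod big_nil mulr1.
    rewrite RintegralB//; last exact: finite_measure_integrable_cst.
    rewrite Rintegral_probability_cst; congr (_ - _).
    by apply: eq_Rintegral => w _; rewrite /lprod big_nil mul1r.
  rewrite distrC => /le_trans; apply.
  rewrite ler_pdivrMr ?ltr0n// mulrC -ler_pdivrMr//.
  by near: n; exact: nbhs_infty_ger.
have -> : Rintegral Q setT (monom Z (o :: l)) * \prod_(y <- ys) alim nuW nuF nuC y =
    \sum_(y <- picks l) nuC * (o.1.2 == y.1.1.2)%:R *
      (Rintegral Q setT (monom Z y.2) * \prod_(z <- Batom o y.1 :: ys) alim nuW nuF nuC z).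
  have -> : monom Z (o :: l) = (fun w => Z o w * monom Z l w).
    by apply/funext => w; rewrite /monom big_cons.
  rewrite (stein_monom nuL0 gZ indepZ).
  have -> : dmonom Z o l = (fun w => \sum_(y <- picks l) (o == y.1)%:R * monom Z y.2 w).
    by apply/funext => w; exact: dmonom_picks.
  have iZ m : Q.-integrable setT (fun w => (monom Z m w)%:E).
    exact: integrable_monom nuL0 gZ indepZ m.
  rewrite Rintegral_sum; last first.
    by move=> y; under eq_fun do rewrite EFinM; exact: integrableZl.
  rewrite mulr_sumr mulr_suml; apply: eq_bigr => y _.
  rewrite RintegralZl//; last exact: iZ.
  rewrite big_cons /alim /= (tlim_nseq_cat nuW true) /nuL.
  case: o {lN} => [[j k] i]; case: (y.1) => [[j' k'] i'] /=.
  rewrite !xpair_eqE (inj_eq (@inl_inj _ _)) -(inj_eq val_inj j) /=.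
  by case: eqP => _; case: eqP => _; case: eqP => _ /=; ring.
apply: (@cvg_trans _ (\sum_(y <- picks l) nuC * (o.1.2 == y.1.1.2)%:R *
    E (fun w => lprod n y.2 w * yprod n (Batom o y.1 :: ys) w) @[n --> \oo])).
  apply: near_eq_cvg; near=> n; rewrite Limp_stein//.
  by near: n; exact: nbhs_infty_gt.
apply: cvg_sum_seq => y yl; apply: cvgM; first exact: cvg_cst.
apply: IH => //; have := perm_size (perm_picks yl) => /= sl.
by move: lN; rewrite /= sl !ltnS; lia.
Unshelve. all: by end_near. Qed.

End impulse_moments.

(** * Taylor bounds for trigonometric functions *)

Section trig_taylor.
Context (R : realType).

(** The derivatives at [0] of [a cos + b sin]: differentiation sends [(a, b)] to [(b, - a)]. Keeping
    both coefficients makes the family closed under it. *)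
Fixpoint trig_coef (a b : R) (k : nat) : R :=
  if k is k'.+1 then trig_coef b (- a) k' else a.

Definition trig_taylor (a b : R) (m : nat) (x : R) : R :=
  \sum_(k < m) trig_coef a b k * (x ^+ k / k`!%:R).

Lemma trig_coefN a b k : trig_coef a (- b) k = (-1) ^+ k * trig_coef a b k.
Proof.
have eN c e j : trig_coef (- c) (- e) j = - trig_coef c e j.
  by elim: j c e => [|j IHj] c e //=; rewrite -IHj.
elim: k a b => [|k IH] a b /=; first by rewrite expr0 mul1r.
by rewrite eN IH exprS -mulrA signrMK mulN1r.
Qed.

Lemma is_derive_trig_taylor a b m (x : R) :
  is_derive x (1:R) (trig_taylor a b m.+1) (trig_taylor b (- a) m x).
Proof.
have dt k : is_derive x (1:R) (fun y : R => y ^+ k.+1 / k.+1`!%:R) (x ^+ k / k`!%:R).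
  have dX : is_derive x (1:R) (fun y : R => y ^+ k.+1) (k.+1%:R * x ^+ k).
    have := @is_deriveX _ _ id k.+1 x 1 1 (is_derive_id x 1).
    by rewrite exprfctE /GRing.scale/= mulr1.
  have := @is_deriveZ _ _ _ (fun y : R => y ^+ k.+1) (k.+1`!%:R^-1) x 1 _ dX.
  rewrite (_ : (_ \*: _) = (fun y : R => y ^+ k.+1 / k.+1`!%:R)); last first.
    by apply/funext => y; rewrite /GRing.scale/= mulrC.
  move=> H; apply: (is_derive_eq H); rewrite /GRing.scale/= factS natrM.
  field.
  by rewrite nat1r !pnatr_eq0 /= -lt0n fact_gt0.
rewrite (_ : trig_taylor a b m.+1 = cst a +
    \sum_(k < m) (fun y : R => trig_coef b (- a) k *: (y ^+ k.+1 / k.+1`!%:R))); last first.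
  apply/funext => y; rewrite /trig_taylor big_ord_recl/= expr0 fact0 divr1 mulr1.
  rewrite fctE; congr (_ + _).
  by rewrite fct_sumE; apply: eq_bigr => k _.
have := @is_deriveD _ _ _ (cst a) _ x 1 0 _ (is_derive_cst a x 1)
  (@is_derive_sum _ _ _ m (fun (k : 'I_m) (y : R) => trig_coef b (- a) k *: (y ^+ k.+1 / k.+1`!%:R)) x 1
   (fun k => trig_coef b (- a) k * (x ^+ k / k`!%:R))
   (fun k => @is_deriveZ _ _ _ (fun y : R => y ^+ k.+1 / k.+1`!%:R) (trig_coef b (- a) k) x 1 _ (dt k))).
by move=> H; apply: (is_derive_eq H); rewrite add0r.
Qed.

(** Induction on [m]: the derivative of the remainder is the remainder of one order less for
    [(b, - a)], and [|a| + |b|] is unchanged. A function that vanishes at [0] and has nonnegative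
    derivative on the half-line is nonnegative; this is applied to the bound plus and minus the
    remainder. *)
Lemma trig_taylor_bound_ge0 a b m (x : R) : 0 <= x ->
  `|a * cos x + b * sin x - trig_taylor a b m x| <=
    (`|a| + `|b|) * (x ^+ m / m`!%:R).
Proof.
elim: m a b x => [|m IH] a b x x0.
  rewrite /trig_taylor big_ord0 subr0 expr0 fact0 divr1 mulr1.
  apply: (le_trans (ler_normD _ _)); rewrite !normrM lerD// ler_piMr//.
    by rewrite ler_norml cos_geN1 cos_le1.
  by rewrite ler_norml sin_geN1 sin_le1.
pose c := `|a| + `|b|.
pose h (y : R) := a * cos y + b * sin y - trig_taylor a b m.+1 y.
pose p (y : R) := c * (y ^+ m.+1 / m.+1`!%:R).
have dh (y : R) : is_derive y (1:R) h (b * cos y + - a * sin y - trig_taylor b (- a) m y).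
  have dT := is_derive_trig_taylor a b m y.
  have d1 : is_derive y (1:R) (fun z : R => a * cos z + b * sin z) (b * cos y + - a * sin y).
    apply: is_derive_eq; rewrite /GRing.scale/=. by rewrite mulrN mulNr addrC.
  exact: is_deriveB.
have dp (y : R) : is_derive y (1:R) p (c * (y ^+ m / m`!%:R)).
  have dX : is_derive y (1:R) (fun y : R => y ^+ m.+1) (m.+1%:R * y ^+ m).
    have := @is_deriveX _ _ id m.+1 y 1 1 (is_derive_id y 1).
    by rewrite exprfctE /GRing.scale/= mulr1.
  have := @is_deriveZ _ _ _ (fun y : R => y ^+ m.+1) (c * m.+1`!%:R^-1) y 1 _ dX.
  rewrite (_ : (_ \*: _) = p); last first.
    by apply/funext => z; rewrite /p /GRing.scale/= [RHS]mulrA mulrAC.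
  move=> H; apply: (is_derive_eq H); rewrite /GRing.scale/= factS natrM.
  field.
  by rewrite nat1r !pnatr_eq0 /= -lt0n fact_gt0.
have h0 : h 0 = 0.
  rewrite /h cos0 sin0 /trig_taylor big_ord_recl/= expr0 fact0 divr1 big1 => [|k _].
    by ring.
  by rewrite expr0n/= mul0r mulr0.
have p0 : p 0 = 0 by rewrite /p expr0n/= mul0r mulr0.
have mono (q : R -> R) (dq : R -> R) : (forall y : R, is_derive y (1:R) q (dq y)) ->
    (forall y, 0 <= y -> 0 <= dq y) -> q 0 = 0 -> 0 <= q x.
  move=> dqP dq0 q0; move: x0; rewrite le_eqVlt => /predU1P[<-|x0]; first by rewrite q0.
  have [] := @MVT R q dq 0 x x0 (fun y _ => dqP y).
    apply: derivable_within_continuous => y _; exact: ex_derive.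
  move=> y; rewrite in_itv/= => /andP[y0 _]; rewrite q0 !subr0 => ->.
  by rewrite mulr_ge0 ?dq0// ltW.
have ce : `|b| + `|- a| = c by rewrite normrN addrC.
have hp : 0 <= (h + p) x.
  apply: (mono (h + p) (fun y => (b * cos y + - a * sin y -
      trig_taylor b (- a) m y) + c * (y ^+ m / m`!%:R))).
  - move=> y y0; have := IH b (- a) y y0.
    by rewrite ce ler_norml => /andP[h1 _]; rewrite addrC -lerBlDl sub0r.
  - by rewrite -[LHS]/(h 0 + p 0) h0 p0 addr0.
have hm : 0 <= (p - h) x.
  apply: (mono (p - h) (fun y => c * (y ^+ m / m`!%:R) - (b * cos y +
      - a * sin y - trig_taylor b (- a) m y))).
  - move=> y y0; have := IH b (- a) y y0.
    by rewrite ce ler_norml => /andP[_]; rewrite subr_ge0.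
  - by rewrite -[LHS]/(p 0 - h 0) h0 p0 subr0.
rewrite ler_norml -/(h x) -/(p x) -subr_ge0 opprK -[X in _ && X]subr_ge0.
by apply/andP.
Qed.

Lemma trig_taylor_bound a b m (x : R) :
  `|a * cos x + b * sin x - trig_taylor a b m x| <=
    (`|a| + `|b|) * (`|x| ^+ m / m`!%:R).
Proof.
have [x0|/ltW x0] := leP 0 x.
  by rewrite (ger0_norm x0); exact: trig_taylor_bound_ge0.
rewrite (ler0_norm x0) -(normrN b).
have nx0 : 0 <= - x by rewrite oppr_ge0.
have := trig_taylor_bound_ge0 a (- b) m nx0.
rewrite cosN sinN mulrNN.
suff -> : trig_taylor a (- b) m (- x) = trig_taylor a b m x by [].
apply: eq_bigr => k _; rewrite trig_coefN [(- x) ^+ k]exprNn.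
rewrite -[X in _ * X]mulrA mulrACA.
by rewrite -[X in X * _]expr2 sqrr_sign mul1r.
Qed.

End trig_taylor.

(** * Bernstein weights *)

Section bernstein.
Context (R : realType).

(** The probability of [j] successes in [N] independent trials of success probability [u], by
    conditioning on one trial. *)
Fixpoint bern (N : nat) (u : R) (j : nat) : R :=
  if N is N'.+1 then
    (1 - u) * bern N' u j + u * (if j is j'.+1 then bern N' u j' else 0)
  else (j == 0)%:R.

Lemma bern_ge0 N u j : 0 <= u <= 1 -> 0 <= bern N u j.
Proof.
move=> /andP[u0 u1]; elim: N j => [|N IH] j /=; first exact: ler0n.
rewrite addr_ge0// mulr_ge0//; first by rewrite subr_ge0.
by case: j.
Qed.

Lemma bern_eq0 N u j : (N < j)%N -> bern N u j = 0.
Proof.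
elim: N j => [|N IH] [|j]//= Nj.
by rewrite !IH ?mulr0 ?addr0//; apply: leq_trans Nj.
Qed.

Lemma bern_sumS N u (h : nat -> R) :
  \sum_(j < N.+2) bern N.+1 u j * h j =
  (1 - u) * (\sum_(j < N.+1) bern N u j * h j) +
  u * (\sum_(j < N.+1) bern N u j * h j.+1).
Proof.
have -> : \sum_(j < N.+2) bern N.+1 u j * h j =
  (1 - u) * (\sum_(j < N.+2) bern N u j * h j) +
  u * (\sum_(j < N.+2) (if val j is j'.+1 then bern N u j' else 0) * h j).
  rewrite !mulr_sumr -big_split/=; apply: eq_bigr => j _.
  by rewrite mulrDl !mulrA.
congr (_ * _ + _ * _).
  by rewrite big_ord_recr/= bern_eq0// mul0r addr0.
by rewrite big_ord_recl/= mul0r add0r.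
Qed.

Lemma bern_sum1 N u : \sum_(j < N.+1) bern N u j = 1.
Proof.
have H : \sum_(j < N.+1) bern N u j * 1 = 1.
  elim: N => [|N IH]; first by rewrite big_ord1 /= mulr1.
  by rewrite (bern_sumS N u (fun=> 1)) IH; ring.
by rewrite -[RHS]H; apply: eq_bigr => j _; rewrite mulr1.
Qed.

(** The centre [a] is left free so that the induction can move it to [a - 1] after a success; at
    [a = N u] the last term vanishes. *)
Lemma bern_variance N u a :
  \sum_(j < N.+1) bern N u j * (j%:R - a) ^+ 2 =
  N%:R * u * (1 - u) + (N%:R * u - a) ^+ 2.
Proof.
elim: N a => [|N IH] a; first by rewrite big_ord1 /= ; ring.
rewrite (bern_sumS N u (fun j => (j%:R - a) ^+ 2)) IH.
have -> : \sum_(j < N.+1) bern N u j * (j.+1%:R - a) ^+ 2 =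
    \sum_(j < N.+1) bern N u j * (j%:R - (a - 1)) ^+ 2.
  by apply: eq_bigr => j _; rewrite -natr1; congr (_ * _ ^+ 2); ring.
by rewrite IH -natr1; ring.
Qed.

Variable K : finType.

Definition bernK N (u : K -> R) (k : {ffun K -> 'I_N.+1}) : R :=
  \prod_a bern N (u a) (k a).

Lemma bernK_ge0 N u k : (forall a, 0 <= u a <= 1) -> 0 <= bernK (N := N) u k.
Proof. by move=> u01; apply: prodr_ge0 => a _; exact: bern_ge0. Qed.

Lemma bernK_sum1 N u : \sum_(k : {ffun K -> 'I_N.+1}) bernK u k = 1.
Proof.
rewrite -(bigA_distr_bigA (fun a (j : 'I_N.+1) => bern N (u a) j)) big1// => a _.
exact: bern_sum1.
Qed.

(** Summing out the other coordinates leaves the one-dimensional variance [u (1 - u) / N]. *)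
Lemma bernK_variance N u a : (0 < N)%N -> 0 <= u a <= 1 ->
  \sum_(k : {ffun K -> 'I_N.+1}) bernK u k * ((k a)%:R / N%:R - u a) ^+ 2 <= N%:R^-1.
Proof.
move=> N0 /andP[u0 u1].
have NR0 : (N%:R : R) != 0 by rewrite pnatr_eq0 -lt0n.
pose F b (j : 'I_N.+1) := bern N (u b) j *
  (if b == a then (j%:R / N%:R - u a) ^+ 2 else 1).
have -> : \sum_(k : {ffun K -> 'I_N.+1}) bernK u k * ((k a)%:R / N%:R - u a) ^+ 2 =
    \sum_(k : {ffun K -> 'I_N.+1}) \prod_b F b (k b).
  apply: eq_bigr => k _; rewrite big_split/=; congr (_ * _).
  by rewrite (bigD1 a)//= eqxx big1 ?mulr1// => b /negPf ->.
rewrite -(bigA_distr_bigA F) (bigD1 a)//= [X in _ * X]big1 ?mulr1; last first.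
  move=> b /negPf ba; rewrite -[RHS](bern_sum1 N (u b)); apply: eq_bigr => j _.
  by rewrite /F ba mulr1.
rewrite /F eqxx.
have -> : \sum_(j < N.+1) bern N (u a) j * (j%:R / N%:R - u a) ^+ 2 =
    N%:R ^- 2 * \sum_(j < N.+1) bern N (u a) j * (j%:R - N%:R * u a) ^+ 2.
  rewrite mulr_sumr; apply: eq_bigr => j _.
  by field.
rewrite bern_variance subrr expr0n addr0.
have -> : N%:R ^- 2 * (N%:R * u a * (1 - u a)) = N%:R^-1 * (u a * (1 - u a)) by field.
rewrite ler_piMr ?invr_ge0//.
by rewrite mulr_ile1// ?subr_ge0// gerBl.
Qed.

End bernstein.

(** * Trigonometric polynomials and uniform approximation on boxes *)

Section trig_class.
Context (R : realType) (K : finType).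

Definition linform (t z : K -> R) : R := \sum_a t a * z a.

Definition trig_eval (s : seq ((R * R) * (K -> R))) (z : K -> R) : R :=
  \sum_(c <- s) (c.1.1 * cos (linform c.2 z) + c.1.2 * sin (linform c.2 z)).

Definition is_trig (g : (K -> R) -> R) := exists s, g =1 trig_eval s.

Lemma is_trig_ext g h : g =1 h -> is_trig h -> is_trig g.
Proof. by move=> gh [s hs]; exists s => z; rewrite gh hs. Qed.

Lemma is_trig_cst r : is_trig (fun=> r).
Proof.
exists [:: ((r, 0), fun=> 0)] => z; rewrite /trig_eval big_seq1/=.
have -> : linform (fun=> 0) z = 0 by apply: big1 => a _; rewrite mul0r.
by rewrite cos0 sin0; ring.
Qed.

Lemma is_trigD g h : is_trig g -> is_trig h -> is_trig (fun z => g z + h z).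
Proof.
by move=> [s gs] [t ht]; exists (s ++ t) => z; rewrite gs ht /trig_eval big_cat.
Qed.

Lemma is_trig_sum (J : Type) (s : seq J) (g : J -> (K -> R) -> R) :
  (forall j, is_trig (g j)) -> is_trig (fun z => \sum_(j <- s) g j z).
Proof.
move=> H; elim: s => [|j s IH].
  by apply: is_trig_ext (is_trig_cst 0) => z; rewrite big_nil.
by apply: is_trig_ext (is_trigD (H j) IH) => z; rewrite big_cons.
Qed.

Lemma is_trigM g h : is_trig g -> is_trig h -> is_trig (fun z => g z * h z).
Proof.
move=> [s gs] [t ht].
apply: (@is_trig_ext _ (fun z => \sum_(x <- s) \sum_(y <- t)
  ((x.1.1 * cos (linform x.2 z) + x.1.2 * sin (linform x.2 z)) *
   (y.1.1 * cos (linform y.2 z) + y.1.2 * sin (linform y.2 z))))).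
  move=> z; rewrite gs ht /trig_eval mulr_suml; apply: eq_bigr => x _.
  by rewrite mulr_sumr.
apply: is_trig_sum => -[[a b] A]; apply: is_trig_sum => -[[e f] B] /=.
exists [:: ((2^-1 * (a * e + b * f), 2^-1 * (b * e - a * f)), fun k => A k - B k);
  ((2^-1 * (a * e - b * f), 2^-1 * (a * f + b * e)), fun k => A k + B k)] => z.
rewrite /trig_eval big_cons big_seq1/=.
have -> : linform (fun k => A k - B k) z = linform A z - linform B z.
  by rewrite /linform -sumrB; apply: eq_bigr => k _; rewrite mulrBl.
have -> : linform (fun k => A k + B k) z = linform A z + linform B z.
  by rewrite /linform -big_split; apply: eq_bigr => k _; rewrite mulrDl.
by rewrite cosB sinB cosD sinD; field.
Qed.

Lemma is_trig_prod (J : Type) (s : seq J) (g : J -> (K -> R) -> R) :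
  (forall j, is_trig (g j)) -> is_trig (fun z => \prod_(j <- s) g j z).
Proof.
move=> H; elim: s => [|j s IH].
  by apply: is_trig_ext (is_trig_cst 1) => z; rewrite big_nil.
by apply: is_trig_ext (is_trigM (H j) IH) => z; rewrite big_cons.
Qed.

Lemma is_trig_sin a r : is_trig (fun z => sin (z a / r)).
Proof.
exists [:: ((0, 1), fun b => (b == a)%:R / r)] => z.
rewrite /trig_eval big_seq1/= mul0r add0r mul1r; congr (sin _).
rewrite /linform (bigD1 a)//= eqxx big1 => [|b /negPf ->]; last by rewrite !mul0r.
by rewrite addr0 -[true%:R]/(1 : R) mul1r mulrC.
Qed.

Lemma is_trig_bern N g j : is_trig g -> is_trig (fun z => bern N (g z) j).
Proof.
move=> tg; elim: N j => [|N IH] j /=; first exact: is_trig_cst.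
apply: is_trigD; apply: is_trigM => //.
  apply: is_trigD; first exact: is_trig_cst.
  by apply: is_trig_ext (is_trigM (is_trig_cst (-1)) tg) => z; rewrite mulN1r.
by case: j => [|j]; [exact: is_trig_cst|exact: IH].
Qed.

End trig_class.

Section trig_approximation.
Context (R : realType) (K : finType).

(** The function is transported to row vectors, where boxes are compact, and the near-covering form
    of compactness yields one [r] for all [z]. Only [z] is confined to the box: the grid points that
    will play the role of [y] may lie outside. *)
Lemma unif_continuous_box (f : {ptws K -> R} -> R) (L e : R) :
  continuous f -> 0 < e -> exists2 r : R, 0 < r &
    forall z y : K -> R, (forall a, `|z a| <= L) -> (forall a, `|z a - y a| < r) ->
      `|f y - f z| <= e.
Proof.
move=> cf e0.
pose j (v : 'rV[R]_#|K|) : {ptws K -> R} := fun a => v ord0 (enum_rank a).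
pose jj (z : K -> R) : 'rV[R]_#|K| := \row_i z (enum_val i).
have jK z : j (jj z) = z by apply/funext => a; rewrite /j mxE enum_rankK.
have cj : continuous j.
  move=> v; have FF : Filter (j @ nbhs v) by apply: fmap_filter.
  apply/cvg_sup => a.
  apply: (@continuous_comp_initial _ _ _ (fun g : K -> R => g a) j).
  exact: (@coord_continuous R 1 #|K| ord0 (enum_rank a)).
have cfj : continuous (f \o j).
  by move=> v; exact: (@continuous_comp _ _ _ j f v (cj v) (cf (j v))).
pose B := [set v : 'rV[R]_#|K| | forall i, `[- L, L]%classic (v ord0 i)].
have cB : compact B.
  by apply: (@rV_compact R #|K| (fun=> `[- L, L]%classic)) => i; exact: segment_compact.
pose Q (r : R) (v : 'rV[R]_#|K|) := forall y : 'rV[R]_#|K|,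
  (forall i, `|v ord0 i - y ord0 i| < r) -> `|f (j y) - f (j v)| <= e.
have /compact_near_coveringP/(_ R (0 : R)^'+ Q _) := cB.
case=> [x Bx|r0 /= r00 H].
  have /cvgrPdist_lt/(_ (e / 2)) := cfj x.
  rewrite divr_gt0// => /(_ isT)/nbhs_ballP[s /= s0 sx].
  have s20 : 0 < s / 2 by rewrite divr_gt0.
  exists (ball x (s / 2), [set r | r < s / 2]).
    split; first exact: nbhsx_ballx.
    by exists (s / 2) => //= r /=; rewrite sub0r normrN => h r_gt0; rewrite (le_lt_trans _ h)// ler_norm.
  move=> [x' r] /= [xx' rs] y yr.
  have h1 : ball x s x'.
    by apply: le_ball xx'; rewrite ler_pdivrMr// ler_peMr ?ltW// ltr1n.
  have h2 : ball x s y.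
    have -> : s = s / 2 + s / 2 by rewrite -splitr.
    apply: ball_triangle xx' _; split => // i k.
    rewrite /ball/= !ord1; exact: lt_trans (yr k) rs.
  have /= k1 := sx _ h1; have /= k2 := sx _ h2.
  have -> : f (j y) - f (j x') = (f (j x) - f (j x')) - (f (j x) - f (j y)) by ring.
  rewrite (splitr e) (le_trans (ler_normB _ _))// lerD// ltW//.
have [r rr] : exists2 r : R, 0 < r & B `<=` Q r.
  exists (r0 / 2); first by rewrite divr_gt0.
  apply: H => /=; last by rewrite divr_gt0.
  by rewrite sub0r normrN gtr0_norm ?divr_gt0// ltr_pdivrMr// ltr_pMr// ltr1n.
move=> BQ; exists r => // z y zL zy.
rewrite -(jK z) -(jK y); apply: BQ => [i|i] /=; rewrite !mxE.
  by rewrite in_itv/= -ler_norml.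
exact: zy.
Qed.

(** By [sin a - sin b = 2 sin ((a - b) / 2) cos ((a + b) / 2)]. Since [a] stays well inside
    [pi / 2], half-sum and half-difference are at most [q < pi / 2] in size, so the cosine is at
    least [cos q]; if [|a - b| >= r], the sine is at least [sin m] in size. *)
Lemma sin_separation (r : R) : 0 < r -> exists2 h : R, 0 < h &
  forall a b : R, `|a| <= 1 / 2 -> `|b| <= pi / 2 -> `|sin a - sin b| < h -> `|a - b| < r.
Proof.
move=> r0; have pi2 : 2 <= pi :> R by exact: pi_ge2.
pose q : R := (1 / 2 + pi / 2) / 2.
pose m : R := Num.min (r / 2) (1 / 2).
have m0 : 0 < m by rewrite lt_min; apply/andP; split; lra.
have mr : m <= r / 2 by rewrite ge_min lexx.
have m1 : m <= 1 / 2 by rewrite ge_min lexx orbT.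
have q_lt : q < pi / 2 by rewrite /q; lra.
have q0 : 0 < q by rewrite /q; lra.
have cq : 0 < cos q by apply: cos_gt0_pihalf; apply/andP; split; lra.
have sm : 0 < sin m by apply: sin_gt0_pi; apply/andP; split; lra.
exists (2 * sin m * cos q); first by rewrite !mulr_gt0.
move=> a b a1 b1; rewrite ltNge => /negP hab; rewrite ltNge; apply/negP => rab; apply: hab.
pose s := (a + b) / 2; pose t := (a - b) / 2.
have -> : sin a - sin b = 2 * sin t * cos s.
  have -> : a = s + t by rewrite /s /t; field.
  have -> : b = s - t by rewrite /s /t; field.
  by rewrite sinD sinB; ring.
have sq : `|s| <= q.
  rewrite /s normrM (gtr0_norm (_ : 0 < 2^-1)) ?invr_gt0// /q ler_pM2r ?invr_gt0//.
  by apply: (le_trans (ler_normD _ _)); exact: lerD.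
have tq : `|t| <= q.
  rewrite /t normrM (gtr0_norm (_ : 0 < 2^-1)) ?invr_gt0// /q ler_pM2r ?invr_gt0//.
  by apply: (le_trans (ler_normB _ _)); exact: lerD.
have tm : m <= `|t|.
  rewrite /t normrM (gtr0_norm (_ : 0 < 2^-1)) ?invr_gt0//; lra.
have cs : cos q <= cos s.
  have -> : cos s = cos `|s| by case: ger0P => _ //; rewrite cosN.
  have s0 : 0 <= `|s| by [].
  rewrite leNgt ltr_cos ?in_itv/= -?leNgt//; apply/andP; split; lra.
have st : sin m <= `|sin t|.
  have e : `|sin t| = `|sin `|t| |.
    by case: (ger0P t) => _ //; rewrite sinN normrN.
  rewrite e (le_trans _ (ler_norm _))// leNgt ltr_sin ?in_itv/= -?leNgt//; apply/andP; split; lra.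
rewrite !normrM (@ger0_norm _ 2)// (@ger0_norm _ (cos s)); last by rewrite (le_trans (ltW cq)).
apply: ler_pM => //; [by rewrite mulr_ge0 ?(ltW sm)|exact: ltW|by rewrite ler_pM2l].
Qed.

(** The Bernstein operator in the variables [u = (1 + sin (z / s)) / 2], with [f] sampled at the
    grid points [psi k]. The weights are nonnegative with sum one, so the bound by [M] holds on the
    whole space; the tail estimate in [moments_cvg_in_distribution] relies on that. In the box, grid
    points with [|k / N - u| < h / 2] are close to [z], and the others are charged to the variance
    as in Chebyshev's inequality. *)
Lemma trig_approx (f : {ptws K -> R} -> R) (M L e : R) :
  continuous f -> (forall z, `|f z| <= M) -> 0 < L -> 0 < e ->
  exists g : (K -> R) -> R, [/\ is_trig g, forall z, `|g z| <= M &
    forall z, (forall a, `|z a| <= L) -> `|g z - f z| <= e].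
Proof.
move=> cf fM L0 e0.
have e20 : 0 < e / 2 by rewrite divr_gt0.
have M0 : 0 <= M by apply: le_trans (fM (fun=> 0)).
have [r r0 fr] := unif_continuous_box L cf e20.
(* On the box this scale brings [z a / s] into [[-1/2, 1/2]], as [sin_separation] asks. *)
pose s := 2 * L; have s0 : 0 < s by rewrite mulr_gt0.
have [h h0 sinh] := sin_separation (divr_gt0 r0 s0).
pose u (z : K -> R) a := (1 + sin (z a / s)) / 2.
have u01 z a : 0 <= u z a <= 1.
  have := sin_geN1 (z a / s); have := sin_le1 (z a / s); rewrite /u => h1 h2.
  by apply/andP; split; lra.
have [N N0 NB] : exists2 N, (0 < N)%N & 2 * M * (4 / h ^+ 2) * #|K|%:R * N%:R^-1 <= e / 2.
  pose B := 2 * M * (4 / h ^+ 2) * #|K|%:R.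
  have B0 : 0 <= B by rewrite !mulr_ge0// ?invr_ge0 ?exprn_ge0 ?ltW.
  exists (Num.truncn (B / (e / 2))).+1 => //.
  rewrite ler_pdivrMr ?ltr0n// -ler_pdivrMl// mulrC.
  by rewrite ltW// truncnS_gt.
pose psi (k : {ffun K -> 'I_N.+1}) : K -> R :=
  fun a => s * asin ((k a)%:R / N%:R * 2 - 1).
pose g z := \sum_(k : {ffun K -> 'I_N.+1}) f (psi k) * bernK (u z) k.
have NR0 : 0 < N%:R :> R by rewrite ltr0n.
have kN (k : {ffun K -> 'I_N.+1}) a : -1 <= ((k a)%:R / N%:R * 2 - 1 : R) <= 1.
  have k1 : (k a)%:R / N%:R <= 1 :> R.
    by rewrite ler_pdivrMr// mul1r ler_nat -ltnS.
  have k0 : 0 <= (k a)%:R / N%:R :> R by rewrite divr_ge0.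
  have gen (q : R) : 0 <= q -> q <= 1 -> -1 <= q * 2 - 1 <= 1.
    by move=> q0 q1; apply/andP; split; lra.
  exact: gen.
exists g; split.
- apply: is_trig_sum => k; apply: is_trigM; first exact: is_trig_cst.
  apply: is_trig_prod => a; apply: is_trig_bern.
  apply: (is_trig_ext (h := fun z => 2^-1 + 2^-1 * sin (z a / s))).
    by move=> z; rewrite /u; field.
  apply: is_trigD; first exact: is_trig_cst.
  by apply: is_trigM; [exact: is_trig_cst|exact: is_trig_sin].
- move=> z; rewrite (le_trans (ler_norm_sum _ _ _))//.
  rewrite -[leRHS]mulr1 -(bernK_sum1 N (u z)) mulr_sumr; apply: ler_sum => k _.
  by rewrite normrM (ger0_norm (bernK_ge0 _ (u01 z))) ler_wpM2r// bernK_ge0.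
- move=> z zL.
  have -> : g z - f z = \sum_(k : {ffun K -> 'I_N.+1}) (f (psi k) - f z) * bernK (u z) k.
    rewrite -[f z in LHS]mulr1 -(bernK_sum1 N (u z)) mulr_sumr -sumrB.
    by apply: eq_bigr => k _; rewrite mulrBl.
  (* The threshold is [h / 2] because [sin (z a / s) = 2 u - 1] doubles distances. One coordinate
     beyond it makes the variance term at least [2 M], the trivial bound. *)
  have ptw (k : {ffun K -> 'I_N.+1}) : `|f (psi k) - f z| <=
      e / 2 + 2 * M * (4 / h ^+ 2) * \sum_a ((k a)%:R / N%:R - u z a) ^+ 2.
    have B0 : 0 <= 2 * M * (4 / h ^+ 2).
      by rewrite !mulr_ge0// ?invr_ge0 ?exprn_ge0 ?ltW.
    have S0 : 0 <= \sum_a ((k a)%:R / N%:R - u z a) ^+ 2.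
      by apply: sumr_ge0 => a _; rewrite sqr_ge0.
    have [close|/existsNP[a /negP]] := pselect (forall a, `|(k a)%:R / N%:R - u z a| < h / 2).
      apply: (@le_trans _ _ (e / 2)); last by rewrite lerDl mulr_ge0.
      apply: (fr z (psi k)) => // a.
      have zs : `|z a / s| <= 1 / 2.
        rewrite normrM normfV (gtr0_norm s0) ler_pdivrMr//.
        by rewrite (le_trans (zL a))// /s; lra.
      have := sinh (z a / s) (asin ((k a)%:R / N%:R * 2 - 1)) zs.
      have -> : z a / s - asin ((k a)%:R / N%:R * 2 - 1) = (z a - psi k a) / s.
        by rewrite /psi; field; rewrite gt_eqF.
      rewrite normrM normfV (gtr0_norm s0) ltr_pM2r ?invr_gt0//; apply.
        by rewrite ler_norml asin_geNpi2 ?asin_lepi2.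
      rewrite asinK ?in_itv//=; have := close a; rewrite distrC !ltr_norml /u.
      by move=> /andP[h1 h2]; apply/andP; split; lra.
    rewrite -leNgt => ha.
    apply: (@le_trans _ _ (2 * M)).
      apply: (le_trans (ler_normB _ _)); rewrite mulr2n mulrDl mul1r lerD//.
    apply: (@le_trans _ _ (2 * M * (4 / h ^+ 2) * \sum_a ((k a)%:R / N%:R - u z a) ^+ 2)); last first.
      by rewrite lerDr ltW.
    rewrite -mulrA ler_peMr ?mulr_ge0//.
    apply: (@le_trans _ _ (4 / h ^+ 2 * ((k a)%:R / N%:R - u z a) ^+ 2)); last first.
      rewrite ler_wpM2l//; first by rewrite divr_ge0 ?exprn_ge0 ?ltW.
      by rewrite (bigD1 a)//= lerDl sumr_ge0// => b _; rewrite sqr_ge0.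
    rewrite mulrAC ler_pdivlMr ?exprn_gt0// mul1r.
    have -> : 4 = 2 ^+ 2 :> R by ring.
    rewrite -exprMn -[leRHS]real_normK ?num_real// lerXn2r ?nnegrE ?(ltW h0)//.
    by rewrite normrM (@ger0_norm _ 2)//; lra.
  rewrite (le_trans (ler_norm_sum _ _ _))//.
  apply: (@le_trans _ _ (\sum_(k : {ffun K -> 'I_N.+1}) (e / 2 + 2 * M * (4 / h ^+ 2) *
     \sum_a ((k a)%:R / N%:R - u z a) ^+ 2) * bernK (u z) k)).
    apply: ler_sum => k _.
    by rewrite normrM (ger0_norm (bernK_ge0 _ (u01 z))) ler_wpM2r// bernK_ge0.
  under eq_bigr do rewrite mulrDl.
  rewrite big_split/= -mulr_sumr bernK_sum1 mulr1 [leRHS]splitr lerD2l.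
  apply: le_trans NB.
  have -> : \sum_(k : {ffun K -> 'I_N.+1}) 2 * M * (4 / h ^+ 2) *
      (\sum_a ((k a)%:R / N%:R - u z a) ^+ 2) * bernK (u z) k =
    2 * M * (4 / h ^+ 2) * \sum_a \sum_(k : {ffun K -> 'I_N.+1})
      bernK (u z) k * ((k a)%:R / N%:R - u z a) ^+ 2.
    rewrite exchange_big/= mulr_sumr; apply: eq_bigr => k _.
    by rewrite -mulrA mulr_suml; congr (_ * _); apply: eq_bigr => a _; rewrite mulrC.
  have B0 : 0 <= 2 * M * (4 / h ^+ 2).
    by rewrite !mulr_ge0// ?invr_ge0 ?exprn_ge0 ?ltW.
  rewrite -[leRHS]mulrA ler_wpM2l//.
  apply: (@le_trans _ _ (\sum_(a : K) N%:R^-1)).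
    by apply: ler_sum => a _; exact: bernK_variance.
  by rewrite sumr_const mulr_natl.
Qed.

End trig_approximation.

(** * Convergence in distribution from moments *)

Section method_of_moments.
Context (R : realType) (K : finType).
Context d (T : measurableType d) (P : probability T R).
Context d' (T' : measurableType d') (Q : probability T' R).
Variables (Y : nat -> K -> T -> R) (Z : K -> T' -> R) (sg : K -> R).
Hypothesis mY : forall n a, (0 < n)%N -> measurable_fun setT (Y n a).
Hypothesis iY : forall n l, (0 < n)%N -> P.-integrable setT (fun w => (monom (Y n) l w)%:E).
Hypothesis sg0 : forall a, 0 < sg a.
Hypothesis gZ : forall a, is_gaussian Q (sg a) (Z a).
Hypothesis indepZ : mutually_independent Q Z.
Hypothesis YZ : forall l, Rintegral P setT (monom (Y n) l) @[n --> \oo] -->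
  Rintegral Q setT (monom Z l).

Local Notation EY n g := (Rintegral P setT (fun w => g (Y n ^~ w))).
Local Notation EZ g := (Rintegral Q setT (fun w => g (Z ^~ w))).

Definition polyfun (g : (K -> R) -> R) :=
  exists s : seq (R * seq K), forall z, g z = \sum_(c <- s) c.1 * \prod_(a <- c.2) z a.

Lemma polyfun_pow t k : polyfun (fun z => linform t z ^+ k).
Proof.
elim: k => [|k [s IH]].
  by exists [:: (1, [::])] => z; rewrite big_seq1 big_nil mulr1 expr0.
exists [seq (t a * c.1, a :: c.2) | a <- enum K, c <- s] => z.
rewrite exprS IH /linform big_allpairs_dep big_enum/= mulr_suml.
apply: eq_bigr => a _; rewrite mulr_sumr; apply: eq_bigr => c _.
by rewrite big_cons; ring.
Qed.

Lemma polyfunZ c g : polyfun g -> polyfun (fun z => c * g z).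
Proof.
move=> [s gs]; exists [seq (c * x.1, x.2) | x <- s] => z.
by rewrite gs big_map mulr_sumr; apply: eq_bigr => x _; rewrite mulrA.
Qed.

Lemma polyfun_sum (J : Type) (s : seq J) (g : J -> (K -> R) -> R) :
  (forall j, polyfun (g j)) -> polyfun (fun z => \sum_(j <- s) g j z).
Proof.
move=> H; elim: s => [|j s [u IH]].
  by exists [::] => z; rewrite !big_nil.
have [v gv] := H j.
by exists (v ++ u) => z; rewrite big_cons big_cat gv IH.
Qed.

Lemma polyfun_intY g n : (0 < n)%N -> polyfun g ->
  P.-integrable setT (fun w => (g (Y n ^~ w))%:E).
Proof.
move=> n0 [s gs]; under eq_fun do rewrite gs -sumEFin.
apply: integrable_sum => // c _; under eq_fun do rewrite EFinM.
by apply: integrableZl => //; exact: iY.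
Qed.

Lemma polyfun_intZ g : polyfun g -> Q.-integrable setT (fun w => (g (Z ^~ w))%:E).
Proof.
move=> [s gs]; under eq_fun do rewrite gs -sumEFin.
apply: integrable_sum => // c _; under eq_fun do rewrite EFinM.
by apply: integrableZl => //; exact: (integrable_monom sg0 gZ indepZ).
Qed.

Lemma polyfun_cvg g : polyfun g -> EY n g @[n --> \oo] --> EZ g.
Proof.
move=> [s gs].
have -> : EZ g = \sum_(c <- s) c.1 * Rintegral Q setT (monom Z c.2).
  under eq_Rintegral do rewrite gs.
  rewrite Rintegral_sum; last first.
    move=> c; under eq_fun do rewrite EFinM.
    by apply: integrableZl => //; exact: (integrable_monom sg0 gZ indepZ).
  apply: eq_bigr => c _; rewrite RintegralZl//.
  exact: (integrable_monom sg0 gZ indepZ).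
apply: (@cvg_trans _ (\sum_(c <- s) c.1 * Rintegral P setT (monom (Y n) c.2) @[n --> \oo])).
  apply: near_eq_cvg; near=> n.
  have n0 : (0 < n)%N by near: n; exact: nbhs_infty_gt.
  under [RHS]eq_Rintegral do rewrite gs.
  rewrite Rintegral_sum; last first.
    move=> c; under eq_fun do rewrite EFinM.
    by apply: integrableZl => //; exact: iY.
  by apply: eq_bigr => c _; rewrite RintegralZl//; exact: iY.
by apply: cvg_sum_seq => c _; apply: cvgM; [exact: cvg_cst|exact: YZ].
Unshelve. all: by end_near. Qed.

(** One factor of the linear form is integrated by parts in each [Z a]. The result is the moment
    recursion of a Gaussian of variance [S], the sum of the [t a ^+ 2 * sg a], obtained without
    identifying the law of the form. *)
Lemma linform_moment t k :
  EZ (fun z => linform t z ^+ (2 * k.+1)) =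
  (2 * k).+1%:R * (\sum_a t a ^+ 2 * sg a) * EZ (fun z => linform t z ^+ (2 * k)).
Proof.
have Hl : ispoly Z (fun w => linform t (Z ^~ w)) (fun p _ => t p).
  apply: ispoly_ext (ispoly_sum _ (fun a => ispolyZ (t a) (ispoly_var Z a))) => // p w.
  rewrite (bigD1 p)//= eqxx mulr1 big1 ?addr0// => a /negPf ap.
  by rewrite eq_sym ap mulr0.
have Hp (j : nat) : ispoly Z (fun w => linform t (Z ^~ w) ^+ j)
    (fun p w => j%:R * t p * linform t (Z ^~ w) ^+ j.-1).
  elim: j => [|j IH].
    by apply: ispoly_ext (ispoly_cst Z 1) => // *; ring.
  apply: ispoly_ext (ispolyM Hl IH) => [w|p w]; first by rewrite exprS.
  case: j {IH} => [|j] /=; first by rewrite !expr0; ring.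
  by rewrite -[j.+2%:R]natr1 exprS; ring.
have -> : (2 * k.+1 = (2 * k).+2)%N by lia.
transitivity (\sum_a t a * Rintegral Q setT (fun w => Z a w * linform t (Z ^~ w) ^+ (2 * k).+1)).
  transitivity (Rintegral Q setT (fun w =>
      \sum_a t a * (Z a w * linform t (Z ^~ w) ^+ (2 * k).+1))).
    apply: eq_Rintegral => w _; rewrite exprS.
    transitivity ((\sum_a t a * Z a w) * linform t (Z ^~ w) ^+ (2 * k).+1); first by [].
    by rewrite mulr_suml; apply: eq_bigr => a _; rewrite mulrA.
  have iT a : Q.-integrable setT (fun w => (Z a w * linform t (Z ^~ w) ^+ (2 * k).+1)%:E).
    exact: (ispoly_integrable sg0 gZ indepZ (ispolyM (ispoly_var Z a) (Hp _))).
  rewrite Rintegral_sum; last first.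
    by move=> a; under eq_fun do rewrite EFinM; exact: integrableZl.
  by apply: eq_bigr => a _; rewrite RintegralZl//; exact: iT.
rewrite -mulrA [X in _ = _ * X]mulr_suml mulr_sumr; apply: eq_bigr => a _.
rewrite (stein sg0 gZ indepZ _ (Hp _)) /= RintegralZl//; first by ring.
exact: (ispoly_integrable sg0 gZ indepZ (Hp _)).
Qed.

(** From [k] to [k + 1] the left side gains the factor [S / (2 k + 2)] and the right side
    [S / (k + 1)]. The factorial thus beats the growth of Gaussian moments, which makes the Taylor
    remainder small. *)
Lemma linform_moment_bound t k :
  EZ (fun z => linform t z ^+ (2 * k)) / (2 * k)`!%:R <=
  (\sum_a t a ^+ 2 * sg a) ^+ k / k`!%:R.
Proof.
have S0 : 0 <= \sum_a t a ^+ 2 * sg a.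
  by apply: sumr_ge0 => a _; rewrite mulr_ge0 ?sqr_ge0 ?ltW.
elim: k => [|k IH].
  have e0 : EZ (fun z => linform t z ^+ 0) = 1.
    transitivity (Rintegral Q setT (cst (1 : R))); first exact: eq_Rintegral.
    by rewrite Rintegral_probability_cst.
  by rewrite muln0 fact0 !divr1 expr0 e0.
rewrite linform_moment.
have -> : (2 * k.+1 = (2 * k).+2)%N by lia.
set S := \sum_a _ in S0 IH *; set M := Rintegral _ _ _ in IH *.
rewrite !factS !natrM exprS.
have f1 : (0 : R) < (2 * k)`!%:R by rewrite ltr0n fact_gt0.
have f2 : (0 : R) < k`!%:R by rewrite ltr0n fact_gt0.
have n1 : (0 : R) < (2 * k).+1%:R by rewrite ltr0n.
have n2 : (0 : R) < (2 * k).+2%:R by rewrite ltr0n.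
have n3 : (0 : R) < k.+1%:R by rewrite ltr0n.
have -> : (2 * k).+1%:R * S * M / ((2 * k).+2%:R * ((2 * k).+1%:R * (2 * k)`!%:R)) =
    (S / (2 * k).+2%:R) * (M / (2 * k)`!%:R).
  by field; rewrite !gt_eqF.
have -> : S * S ^+ k / (k.+1%:R * k`!%:R) = (S / k.+1%:R) * (S ^+ k / k`!%:R).
  by field; rewrite !gt_eqF.
apply: (@le_trans _ _ ((S / (2 * k).+2%:R) * (S ^+ k / k`!%:R))).
  by rewrite ler_wpM2l// divr_ge0 ?ler0n.
rewrite ler_wpM2r//; first by rewrite divr_ge0 ?exprn_ge0 ?ler0n.
by rewrite ler_wpM2l// lef_pV2 ?posrE// ler_nat; lia.
Qed.

Lemma polyfun_trig_taylor a b m t : polyfun (fun z => trig_taylor a b m (linform t z)).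
Proof.
have H (k : 'I_m) : polyfun (fun z => trig_coef a b k / k`!%:R * linform t z ^+ k).
  by apply: polyfunZ; exact: polyfun_pow.
have [s hs] := polyfun_sum (index_enum _) H.
exists s => z; rewrite -hs /trig_taylor; apply: eq_bigr => k _.
by rewrite mulrA mulrAC.
Qed.

Lemma measurable_linform e (U : measurableType e) (V : K -> U -> R) t :
  (forall a, measurable_fun setT (V a)) ->
  measurable_fun setT (fun w => linform t (V ^~ w)).
Proof.
by move=> mV; apply: measurable_sum => a; apply: measurable_funM.
Qed.

Lemma measurable_trig e (U : measurableType e) (V : K -> U -> R) g :
  (forall a, measurable_fun setT (V a)) -> is_trig g ->
  measurable_fun setT (fun w => g (V ^~ w)).
Proof.
move=> mV [s gs]; under eq_fun do rewrite gs.
apply: measurable_sum => c; have ml := measurable_linform c.2 mV.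
apply: measurable_funD; apply: measurable_funM => //.
  by apply: measurableT_comp ml; apply: continuous_measurable_fun; exact: continuous_cos.
by apply: measurableT_comp ml; apply: continuous_measurable_fun; exact: continuous_sin.
Qed.

Lemma integrable_bounded e (U : measurableType e) (mu : probability U R) (g : U -> R) (M : R) :
  measurable_fun setT g -> (forall w, `|g w| <= M) ->
  mu.-integrable setT (fun w => (g w)%:E).
Proof.
move=> mg gM.
have iM : mu.-integrable setT (EFin \o cst M) by exact: finite_measure_integrable_cst.
apply: le_integrable iM => //.
  exact/measurable_EFinP.
by move=> w _; rewrite !abse_EFin lee_fin (le_trans (gM w))// ler_norm.
Qed.

Let mZ a : measurable_fun setT (Z a). Proof. by case: (gZ a). Qed.

Lemma trig1_bound (a b : R) (t z : K -> R) :
  `|a * cos (linform t z) + b * sin (linform t z)| <= `|a| + `|b|.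
Proof.
have := trig_taylor_bound a b 0 (linform t z).
by rewrite /trig_taylor big_ord0 subr0 expr0 fact0 divr1 mulr1.
Qed.

Lemma integrable_trig e (U : measurableType e) (mu : probability U R) (V : K -> U -> R) g :
  (forall a, measurable_fun setT (V a)) -> is_trig g ->
  mu.-integrable setT (fun w => (g (V ^~ w))%:E).
Proof.
move=> mV tg; have [s gs] := tg.
apply: (@integrable_bounded _ _ _ _ (\sum_(c <- s) (`|c.1.1| + `|c.1.2|))).
  exact: measurable_trig.
move=> w; rewrite gs /trig_eval (le_trans (ler_norm_sum _ _ _))//.
by apply: ler_sum => c _; exact: trig1_bound.
Qed.

Lemma Rintegral_dist e (U : measurableType e) (mu : probability U R) (f g h : U -> R) :
  mu.-integrable setT (fun w => (f w)%:E) -> mu.-integrable setT (fun w => (g w)%:E) ->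
  mu.-integrable setT (fun w => (h w)%:E) -> (forall w, `|f w - g w| <= h w) ->
  `|Rintegral mu setT f - Rintegral mu setT g| <= Rintegral mu setT h.
Proof.
move=> fi gi hi fgh; rewrite -RintegralB//.
have i3 : mu.-integrable setT (fun w => (f w - g w)%:E).
  by under eq_fun do rewrite EFinB; exact: integrableB.
rewrite (le_trans (le_normr_Rintegral _ i3))//; apply: le_Rintegral => //.
by have := integrable_abse i3.
Qed.

(** The Taylor order is even, so the remainder is bounded by a polynomial, whose expectation
    converges too: smallness under [Z] is carried over to [Y n]. Of the error [e], two quarters go
    to the remainder under [Y n], one to the remainder under [Z], one to the Taylor polynomial. *)
Lemma trig1_cvg a b t :
  EY n (fun z => a * cos (linform t z) + b * sin (linform t z)) @[n --> \oo] -->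
  EZ (fun z => a * cos (linform t z) + b * sin (linform t z)).
Proof.
pose h z := a * cos (linform t z) + b * sin (linform t z).
have hE z : h z = trig_eval [:: ((a, b), t)] z by rewrite /trig_eval big_seq1.
have ht : is_trig h by eexists; exact: hE.
pose S := \sum_a0 t a0 ^+ 2 * sg a0.
pose c := `|a| + `|b| + 1.
have c0 : 0 < c by rewrite ltr_wpDl ?addr_ge0.
apply/cvgrPdist_le => e e0.
have e4 : 0 < e / 4 / c by rewrite !divr_gt0.
have [k Sk] : exists k, S ^+ k / k`!%:R <= e / 4 / c.
  have := @cvg_exp_coeff R S; move/cvgrPdist_le => /(_ _ e4) [k _ /(_ k (leqnn k))] /=.
  rewrite sub0r normrN => hk; exists k; rewrite (le_trans (ler_norm _))//.
pose m := (2 * k)%N.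
pose Tm z := trig_taylor a b m (linform t z).
pose Lm z := linform t z ^+ m.
have rem z : `|h z - Tm z| <= c / m`!%:R * Lm z.
  rewrite (le_trans (trig_taylor_bound _ _ _ _))//.
  have -> : `|linform t z| ^+ m = linform t z ^+ m.
    by rewrite -normrX ger0_norm// /m exprM exprn_ge0// sqr_ge0.
  rewrite mulrA mulrAC ler_wpM2r//; first by rewrite /Lm /m exprM exprn_ge0 ?sqr_ge0.
  by rewrite ler_wpM2r ?invr_ge0// /c lerDl.
have pT : polyfun Tm by exact: polyfun_trig_taylor.
have pL : polyfun (fun z => c / m`!%:R * Lm z) by apply: polyfunZ; exact: polyfun_pow.
have LZ : EZ (fun z => c / m`!%:R * Lm z) <= e / 4.
  rewrite RintegralZl//; last by apply: polyfun_intZ; exact: polyfun_pow.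
  rewrite -mulrA [X in c * X]mulrC -ler_pdivlMl// [leRHS]mulrC; apply: le_trans Sk.
  exact: linform_moment_bound.
have e40 : 0 < e / 4 by rewrite divr_gt0.
near=> n.
have n0 : (0 < n)%N by near: n; exact: nbhs_infty_gt.
have dT : `|EZ Tm - EY n Tm| <= e / 4.
  by near: n; exact: (cvgrPdist_le _ _).1 (polyfun_cvg pT) _ e40.
have dL : `|EZ (fun z => c / m`!%:R * Lm z) - EY n (fun z => c / m`!%:R * Lm z)| <= e / 4.
  by near: n; exact: (cvgrPdist_le _ _).1 (polyfun_cvg pL) _ e40.
have ihY : P.-integrable setT (fun w => (h (Y n ^~ w))%:E).
  by apply: integrable_trig ht => x; exact: mY.
have ihZ : Q.-integrable setT (fun w => (h (Z ^~ w))%:E) by exact: integrable_trig ht.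
have dY := Rintegral_dist ihY (polyfun_intY n0 pT) (polyfun_intY n0 pL) (fun w => rem _).
have dZ := Rintegral_dist ihZ (polyfun_intZ pT) (polyfun_intZ pL) (fun w => rem _).
rewrite -/h; move: dT dL dY dZ LZ.
rewrite !ler_norml => /andP[? ?] /andP[? ?] /andP[? ?] /andP[? ?] ?.
by apply/andP; split; lra.
Unshelve. all: by end_near. Qed.

Lemma cvg_sum_list (J : Type) (s : seq J) (f : J -> nat -> R) (l : J -> R) :
  (forall j, f j n @[n --> \oo] --> l j) ->
  (\sum_(j <- s) f j n) @[n --> \oo] --> \sum_(j <- s) l j.
Proof.
move=> H; case: s => [|c0 s].
  by rewrite big_nil; apply: cvg_near_cst; apply: nearW => n; rewrite big_nil.
rewrite (big_nth c0) big_mkord.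
rewrite (_ : (fun n => _) = fun n =>
    \sum_(i < size (c0 :: s)) f (nth c0 (c0 :: s) i) n); last first.
  by apply/funext => n; rewrite (big_nth c0) big_mkord.
by apply: cvg_sum_seq => i _; exact: H.
Qed.

Lemma trig_cvg g : is_trig g -> EY n g @[n --> \oo] --> EZ g.
Proof.
move=> [s gs].
pose h (c : (R * R) * (K -> R)) z :=
  c.1.1 * cos (linform c.2 z) + c.1.2 * sin (linform c.2 z).
have ht c : is_trig (h c) by exists [:: c] => z; rewrite /trig_eval big_seq1.
have -> : EZ g = \sum_(c <- s) EZ (h c).
  under eq_Rintegral do rewrite gs /trig_eval.
  by rewrite Rintegral_sum// => c; exact: integrable_trig mZ (ht c).
apply: (@cvg_trans _ (\sum_(c <- s) EY n (h c) @[n --> \oo])).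
  apply: near_eq_cvg; near=> n.
  have n0 : (0 < n)%N by near: n; exact: nbhs_infty_gt.
  under [RHS]eq_Rintegral do rewrite gs /trig_eval.
  by rewrite Rintegral_sum// => c; apply: integrable_trig (ht c) => a; exact: mY.
by apply: cvg_sum_list => c; exact: trig1_cvg.
Unshelve. all: by end_near. Qed.

(** Continuity refers to the pointwise topology; measurability is reached through trigonometric
    polynomials, within [1 / (k + 1)] of [f] on the box of size [k + 1], whose pointwise limit is
    [f]. *)
Lemma measurable_ptws (f : {ptws K -> R} -> R) (M : R) e (U : measurableType e)
    (V : K -> U -> R) :
  continuous f -> (forall z, `|f z| <= M) -> (forall a, measurable_fun setT (V a)) ->
  measurable_fun setT (fun w => f (V ^~ w)).
Proof.
move=> cf fM mV.
have e0 (k : nat) : 0 < (k.+1%:R)^-1 :> R by rewrite invr_gt0.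
have L0 (k : nat) : 0 < k.+1%:R :> R by rewrite ltr0n.
have /choice[g gP] := fun k : nat => trig_approx cf fM (L0 k) (e0 k).
have H := @measurable_fun_cvg _ U R setT (fun k w => g k (V ^~ w)) (fun w => f (V ^~ w)).
apply: H; first by move=> k; have [tg _ _] := gP k; exact: measurable_trig.
move=> w _; apply/cvgrPdist_le => eps eps0; near=> k.
have [_ _ ap] := gP k.
rewrite distrC (le_trans (ap _ _))//.
- move=> a; apply: (@le_trans _ _ (\sum_b `|V b w|)).
    by rewrite (bigD1 a)//= lerDl sumr_ge0.
  apply: (@le_trans _ _ k%:R); last by rewrite ler_nat.
  by near: k; exact: nbhs_infty_ger.
- rewrite -[leRHS]invrK lef_pV2 ?posrE ?invr_gt0//.
  apply: (@le_trans _ _ k%:R); last by rewrite ler_nat.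
  by near: k; exact: nbhs_infty_ger.
Unshelve. all: by end_near. Qed.

(** Off the box the approximation errs by at most [2 M], hence by at most [2 M |z|^2 / L^2]. Second
    moments converge, so this is small under [Y n] as well as under [Z]: the moments also supply the
    tightness. *)
Lemma moments_cvg_in_distribution :
  cvg_in_distribution P (fun n w a => Y n a w) Q (fun w a => Z a w).
Proof.
move=> f cf [M fM].
have M0 : 0 <= M by exact: le_trans (fM (fun=> 0)).
have ifY n : (0 < n)%N -> P.-integrable setT (fun w => (f (Y n ^~ w))%:E).
  move=> n0; apply: (@integrable_bounded _ _ _ _ M) => [|w]; last exact: fM.
  by apply: measurable_ptws cf fM _ => a; exact: mY.
have ifZ : Q.-integrable setT (fun w => (f (Z ^~ w))%:E).
  apply: (@integrable_bounded _ _ _ _ M) => [|w]; last exact: fM.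
  exact: measurable_ptws cf fM mZ.
suff H : EY n f @[n --> \oo] --> EZ f.
  have -> : (\int[Q]_w (f (Z ^~ w))%:E)%E = (EZ f)%:E.
    by rewrite /Rintegral fineK//; exact: integrable_fin_num.
  apply/fine_cvgP; split; last exact: H.
  near=> n; apply: integrable_fin_num => //; apply: ifY.
  by near: n; exact: nbhs_infty_gt.
pose sq (z : K -> R) := \sum_a z a ^+ 2.
have psq : polyfun sq.
  exists [seq (1, [:: a; a]) | a <- enum K] => z.
  rewrite big_map big_enum/=; apply: eq_bigr => a _.
  by rewrite !big_cons big_nil mulr1 mul1r.
have sq0 z : 0 <= sq z by apply: sumr_ge0 => a _; rewrite sqr_ge0.
pose B := EZ sq + 1.
have B0 : 0 < B.
  by rewrite ltr_wpDl// /Rintegral fine_ge0// integral_ge0// => w _; rewrite lee_fin.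
apply/cvgrPdist_le => e e0.
have e8 : 0 < e / 8 by rewrite divr_gt0.
(* As [L >= 1], [2 M B / L^2 <= 2 M B / L <= e / 8], where [B] exceeds the second moment of [Z]. *)
pose L := 1 + 2 * M * B / (e / 8).
have MB : 0 <= 2 * M * B by rewrite !mulr_ge0// ltW.
have L1 : 1 <= L by rewrite lerDl divr_ge0// ltW.
have L0 : 0 < L by exact: lt_le_trans L1.
have LB : 2 * M / L ^+ 2 * B <= e / 8.
  rewrite mulrAC ler_pdivrMr ?exprn_gt0//.
  apply: (@le_trans _ _ (e / 8 * L)).
    by rewrite -ler_pdivrMl// [leLHS]mulrC /L lerDr.
  by rewrite ler_wpM2l ?(ltW e8)// expr2 ler_peMr// ltW.
have [g [tg gM gf]] := trig_approx cf fM L0 e8.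
pose h z := e / 8 + 2 * M / L ^+ 2 * sq z.
have c0 : 0 <= 2 * M / L ^+ 2.
  by apply: divr_ge0; [exact: mulr_ge0|exact/exprn_ge0/ltW].
have ptw z : `|f z - g z| <= h z.
  have [zL|/existsNP[a /negP]] := pselect (forall a, `|z a| <= L).
    by rewrite distrC (le_trans (gf z zL))// lerDl mulr_ge0.
  rewrite -ltNge => La.
  apply: (@le_trans _ _ (2 * M)).
    by rewrite (le_trans (ler_normB _ _))// mulr2n mulrDl mul1r lerD.
  apply: (@le_trans _ _ (2 * M / L ^+ 2 * sq z)); last by rewrite lerDr ltW.
  rewrite -mulrA ler_peMr ?mulr_ge0// mulrC ler_pdivlMr ?exprn_gt0// mul1r.
  apply: (@le_trans _ _ (z a ^+ 2)); last first.
    by rewrite /sq (bigD1 a)//= lerDl sumr_ge0// => b _; rewrite sqr_ge0.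
  by rewrite -[leRHS]real_normK ?num_real// lerXn2r ?nnegrE ?(ltW L0) ?(ltW La).
have ph : polyfun h.
  have [s hs] := polyfunZ (2 * M / L ^+ 2) psq.
  by exists ((e / 8, [::]) :: s) => z; rewrite big_cons big_nil mulr1 -hs.
have hZ : EZ h <= e / 4.
  have -> : EZ h = e / 8 + 2 * M / L ^+ 2 * EZ sq.
    rewrite /h RintegralD//; [|exact: finite_measure_integrable_cst|].
      rewrite Rintegral_probability_cst RintegralZl//; exact: polyfun_intZ psq.
    exact: polyfun_intZ (polyfunZ _ psq).
  have : 2 * M / L ^+ 2 * EZ sq <= 2 * M / L ^+ 2 * B.
    by rewrite ler_wpM2l// lerDl.
  by move: LB; lra.
have igY m : (0 < m)%N -> P.-integrable setT (fun w => (g (Y m ^~ w))%:E).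
  by move=> m0; apply: integrable_trig tg => a; exact: mY.
have igZ := integrable_trig Q mZ tg.
near=> n.
have n0 : (0 < n)%N by near: n; exact: nbhs_infty_gt.
have dg : `|EZ g - EY n g| <= e / 8.
  by near: n; exact: (cvgrPdist_le _ _).1 (trig_cvg tg) _ e8.
have dh : `|EZ h - EY n h| <= e / 8.
  by near: n; exact: (cvgrPdist_le _ _).1 (polyfun_cvg ph) _ e8.
have dY := Rintegral_dist (ifY n n0) (igY n n0) (polyfun_intY n0 ph) (fun w => ptw _).
have dZ := Rintegral_dist ifZ igZ (polyfun_intZ ph) (fun w => ptw _).
move: dg dh dY dZ hZ.
rewrite !ler_norml => /andP[? ?] /andP[? ?] /andP[? ?] /andP[? ?] ?.
by apply/andP; split; lra.
Unshelve. all: by end_near. Qed.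

End method_of_moments.

(** * The two limits for the network *)

Section conclusion.
Context (R : realType) d (Om : measurableType d) (P : probability Om R).

(** Indices outside the image of [idx] receive the whole line, which contributes a factor one;
    injectivity makes [B'] well determined on the image. *)
Lemma mutually_independent_reindex (K J : finType) (X : K -> Om -> R) (idx : J -> K)
    (h : J -> R -> R) :
  injective idx -> (forall o, measurable_fun setT (h o)) ->
  mutually_independent P X -> mutually_independent P (fun o w => h o (X (idx o) w)).
Proof.
move=> inj mh indX B mB.
pose B' i : set R := if [pick o | idx o == i] is Some o then h o @^-1` B o else setT.
have mB' i : measurable (B' i).
  rewrite /B'; case: pickP => [k _ | _] //.
  by rewrite -[X in measurable X]setTI; exact: mh.
have BE o : B' (idx o) = h o @^-1` B o.
  rewrite /B'; case: pickP => [k /eqP/inj -> // | /(_ o)].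
  by rewrite eqxx.
have -> : \bigcap_(o in [set: J]) ((fun w => h o (X (idx o) w)) @^-1` B o) =
    \bigcap_(i in [set: K]) (X i @^-1` B' i).
  apply/seteqP; split=> w H i _ /=; last by have := H (idx i) I; rewrite /= BE.
  rewrite /B'; case: pickP => [k /eqP <- | //]; exact: (H k I).
rewrite indX// (bigID (fun i => i \in imset idx (mem (@predT J))))/=.
rewrite [X in (_ * X)%E]big1 => [ | i iN]; last first.
  rewrite (_ : X i @^-1` B' i = setT) ?probability_setT//.
  apply/seteqP; split=> // w _ /=; rewrite /B'; case: pickP => [k /eqP ki | //].
  by move: iN; rewrite -ki imset_f.
rewrite mule1 big_imset/=; last by move=> o o' _ _; exact: inj.
by apply: eq_bigr => o _; rewrite BE.
Qed.

Variables (T nx ny : nat) (nuW nuF nuC : R).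
Hypotheses (nuW0 : 0 < nuW) (nuF0 : 0 < nuF) (nuC0 : 0 < nuC).
Variables (W : forall n : nat, Om -> 'M[R]_n) (F : forall n : nat, Om -> 'M[R]_(n, nx))
  (C : forall n : nat, Om -> 'M[R]_(ny, n)).
Definition initial_params n (p : param_index n nx ny) w := params_of (W n w) (F n w) (C n w) p.
Hypothesis gX : forall n, (0 < n)%N ->
  forall p : param_index n nx ny, is_gaussian P (param_var nuW nuF nuC p) (initial_params p).
Hypothesis indep : forall n, (0 < n)%N -> mutually_independent P (@initial_params n).
Local Notation J := ('I_T * 'I_ny * 'I_nx)%type.

Let nu0 n (p : param_index n nx ny) : 0 < param_var nuW nuF nuC p.
Proof. by case: p => [[]|]. Qed.

Let rWE n w : rW (@initial_params n) w = (Num.sqrt n%:R)^-1 *: W n w.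
Proof. by apply/matrixP => i j; rewrite !mxE. Qed.

Let rvE n w : rv (@initial_params n) w = colv (F n w) (C n w).
Proof. by apply/funext => -[a|a]; apply/matrixP => i j; rewrite !mxE. Qed.

Lemma wordmx_pow n (c : R) (M : 'M[R]_n) j :
  wordmx (c *: M) (nseq j false) = c ^+ j *: M ^+ j.
Proof.
elim: j => [|j IH]; first by rewrite scale1r.
by rewrite /= IH -scalemxAl -scalemxAr scalerA -exprS (exprS M).
Qed.

(** One factor [n^(-1/2)] for each [W] and one for [C] make up the exponent [j + 1]. *)
Lemma Limp_impulse n (o : J) w :
  Limp initial_params n o w = impulse (W n w) (F n w) (C n w) o.1.1 o.1.2 o.2.
Proof.
set c := (Num.sqrt (n%:R : R))^-1.
transitivity (c * (C n w *m (wordmx (c *: W n w) (nseq o.1.1 false) *m col o.2 (F n w)))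
    o.1.2 0).
  rewrite mxE mulr_sumr; apply: eq_bigr => m _.
  by rewrite /Vcol rWE rvE mulrCA.
rewrite wordmx_pow -scalemxAl -scalemxAr [Y in c * Y]mxE mulrA -exprS mulmxA.
rewrite [RHS]mxE; congr (_ * _); rewrite [LHS]mxE [RHS]mxE.
by apply: eq_bigr => m _; congr (_ * _); rewrite mxE.
Qed.

(** The exceptional null set is that of the atoms, common to all output indices. *)
Lemma ntk_ae_cvg (x x' : 'I_T -> 'cV[R]_nx) :
  {ae P, forall w, forall o o' : 'I_T * 'I_ny,
    (fun n => ntk (params_of (W n w) (F n w) (C n w)) x x' o o') @ \oo -->
    ntk_limit nuW nuF nuC x x' o o'}.
Proof.
apply: filterS (atoms_ae_cvg nuW0 nuF0 nuC0 gX indep) => w Hw o o'.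
rewrite -ntk_expr_alim; under eq_fun do rewrite ntk_exprE -rWE -rvE.
exact: ntk_expr_cvg.
Qed.

(* The limit law is realised on the given space, by rescaling distinct entries of one [W N]. *)
Let limit_index (o : J) : param_index #|{: J}|.+1 nx ny :=
  inl (inl (ord0, lift ord0 (enum_rank o))).
Let limit_scale (o : J) : R := Num.sqrt (nuL nuW nuF nuC o / nuW).
Let limit (w : Om) (o : J) : R := limit_scale o * initial_params (limit_index o) w.

Let nuL0 (o : J) : 0 < nuL nuW nuF nuC o.
Proof. by rewrite !mulr_gt0 ?exprn_gt0. Qed.

Let limit_gaussian o : is_gaussian P (nuL nuW nuF nuC o) (fun w => limit w o).
Proof.
have := @is_gaussian_scale _ _ _ P nuW (limit_scale o) (initial_params (limit_index o)) nuW0.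
(* The successor in the matrix size of [limit_index] keeps it positive even when [J] is empty, so
   the Gaussian hypothesis applies. *)
rewrite sqrtr_gt0 divr_gt0// => /(_ isT (gX (ltn0Sn _) _)).
by rewrite sqr_sqrtr ?divfK ?gt_eqF// ltW// divr_gt0.
Qed.

Let limit_independent : mutually_independent P (fun o w => limit w o).
Proof.
apply: (@mutually_independent_reindex _ _ _ limit_index (fun o r => limit_scale o * r)) => //.
- move=> o o' /(congr1 (fun p : param_index #|{: J}|.+1 nx ny =>
    if p is inl (inl (_, j)) then j else ord0)) e.
  exact/enum_rank_inj/(@lift_inj _ ord0 _ _ e).
- by move=> o; exact: measurable_funM.
- exact: indep.
Qed.

Lemma impulse_cvg_in_distribution :
  exists (d' : measure_display) (Om' : measurableType d') (Q : probability Om' R)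
    (Z : Om' -> J -> R),
    (forall o : J, is_gaussian Q (nuC * nuF * nuW ^+ o.1.1) (fun w => Z w o)) /\
    mutually_independent Q (fun (o : J) w => Z w o) /\
    cvg_in_distribution P (fun n w (o : J) =>
      impulse (W n w) (F n w) (C n w) o.1.1 o.1.2 o.2) Q Z.
Proof.
exists d, Om, P, limit; split; [exact: limit_gaussian|split; first exact: limit_independent].
have -> : (fun n w (o : J) => impulse (W n w) (F n w) (C n w) o.1.1 o.1.2 o.2) =
    (fun n w o => Limp initial_params n o w).
  by apply/funext => n; apply/funext => w; apply/funext => o; rewrite Limp_impulse.
pose Y n (o : J) w := Limp initial_params n o w.
have mom := @moments_cvg_in_distribution R _ _ _ P _ _ P Y (fun o w => limit w o)
  (fun o => nuL nuW nuF nuC o).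
refine (mom _ _ _ _ _ _).
- move=> n o n0; have [dL [HL _]] := Limp_poly initial_params n o.
  exact: (ispoly_measurable (@nu0 n) (gX n0) (indep n0) HL).
- move=> n l n0; have [dL [HL _]] := lprod_poly initial_params n l.
  exact: (ispoly_integrable (@nu0 n) (gX n0) (indep n0) HL).
- exact: nuL0.
- exact: limit_gaussian.
- exact: limit_independent.
move=> l.
have mc : Rintegral P setT (fun w =>
      lprod initial_params n l w * yprod initial_params n [::] w) @[n --> \oo] -->
    Rintegral P setT (monom (fun o w => limit w o) l) *
    \prod_(y <- [::] : seq (atom ('I_nx + 'I_ny)%type)) alim nuW nuF nuC y.
  exact: (impulse_moments_cvg nuW0 nuF0 nuC0 gX indep limit_gaussian limit_independent).
move: mc; rewrite big_nil mulr1; apply: cvg_trans; apply: near_eq_cvg; apply: nearW => n.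
by apply: eq_Rintegral => w _; rewrite /yprod big_nil mulr1.
Qed.

End conclusion.

Theorem theorem2 (R : realType) (T nx ny : nat) (hT : (0 < T)%N)
  (nuW nuF nuC : R) (hnuW : 0 < nuW) (hnuF : 0 < nuF) (hnuC : 0 < nuC)
  (d : measure_display) (Omega : measurableType d) (P : probability Omega R)
  (W : forall n : nat, Omega -> 'M[R]_n)
  (F : forall n : nat, Omega -> 'M[R]_(n, nx))
  (C : forall n : nat, Omega -> 'M[R]_(ny, n))
  (hgauss : forall n : nat, (0 < n)%N -> forall p : param_index n nx ny,
     is_gaussian P (param_var nuW nuF nuC p)
       (fun w => params_of (W n w) (F n w) (C n w) p))
  (hindep : forall n : nat, (0 < n)%N ->
     mutually_independent P
       (fun (p : param_index n nx ny) w => params_of (W n w) (F n w) (C n w) p)) :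
  (* (a) impulse responses converge in distribution to independent Gaussians *)
  (exists (d' : measure_display) (Omega' : measurableType d')
          (Q : probability Omega' R) (Z : Omega' -> ('I_T * 'I_ny * 'I_nx) -> R),
      (forall o : 'I_T * 'I_ny * 'I_nx,
          is_gaussian Q (nuC * nuF * nuW ^+ o.1.1) (fun w => Z w o)) /\
      mutually_independent Q (fun (o : 'I_T * 'I_ny * 'I_nx) w => Z w o) /\
      cvg_in_distribution P
        (fun n w (o : 'I_T * 'I_ny * 'I_nx) =>
           impulse (W n w) (F n w) (C n w) o.1.1 o.1.2 o.2) Q Z)
  /\
  (* (b) the NTK converges almost surely to the deterministic limit *)
  (forall x x' : 'I_T -> 'cV[R]_nx,
     {ae P, forall w, forall o o' : 'I_T * 'I_ny,
        (fun n => ntk (params_of (W n w) (F n w) (C n w)) x x' o o') @ \oo -->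
          ntk_limit nuW nuF nuC x x' o o'}).
Proof.
split.
  exact: (@impulse_cvg_in_distribution R d Omega P T nx ny nuW nuF nuC hnuW hnuF hnuC W F C hgauss hindep).
move=> x x'.
exact: (@ntk_ae_cvg R d Omega P T nx ny nuW nuF nuC hnuW hnuF hnuC W F C hgauss hindep x x').
Qed.
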